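(* Let $(Y,X),(Y_1,X_1),(Y_2,X_2),\ldots$ be i.i.d. random vectors in $\mathbb{R}\times\mathbb{R}^d$ ($d\ge1$) such that $X$ has a marginal Lebesgue density $f$ and the regression function $m(x)=\mathbb{E}[Y|X=x]$ exists. Let $I$ be a compact subset of $\mathbb{R}^d$ and let the kernel $K$ satisfy conditions (K.i), (K.ii), (K.iii), (K.iv) listed in the context and have support contained in $[-1/2,1/2]^d$. Suppose further that there exists an $\varepsilon>0$ such that $f$ is continuous and strictly positive on $J:=I^\varepsilon$. (1) If there exists an $M>0$ such that $|Y|\,\mathbf{1}\{X\in J\}\le M$ almost surely, then for all large enough $c>0$ and any $b_n\searrow0$, $$\limsup_{n\to\infty}\ \sup_{c\log n/n\le h\le b_n}\frac{\sqrt{nh}\,\big\|\widehat m_{n,h}-\bar r(\cdot,h)/\bar f(\cdot,h)\big\|_I}{\sqrt{\log(1/h)\vee\log\log n}}=:K(I,c)<\infty\qquad\text{almost surely.}$$ (2) If instead, for some $p>2$, $\sup_{z\in J}\mathbb{E}(|Y|^p\,|\,X=z)=:\alpha<\infty$, then for any $c>0$ and any $b_n\searrow0$, with $\gamma=\gamma(p)=1-2/p$, $$\limsup_{n\to\infty}\ \sup_{c(\log n/n)^\gamma\le h\le b_n}\frac{\sqrt{nh}\,\big\|\widehat m_{n,h}-\bar r(\cdot,h)/\bar f(\cdot,h)\big\|_I}{\sqrt{\log(1/h)\vee\log\log n}}=:K'(I,c)<\infty\qquad\text{almost surely.}$$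
   Context: For $0<h<1$ the Nadaraya–Watson estimator is $$\widehat m_{n,h}(x)=\frac{\sum_{i=1}^nY_iK((x-X_i)/h^{1/d})}{\sum_{i=1}^nK((x-X_i)/h^{1/d})},$$ and $$\bar r(x,h)=\mathbb{E}[YK((x-X)/h^{1/d})]/h,\qquad \bar f(x,h)=\mathbb{E}[K((x-X)/h^{1/d})]/h .$$ For $I\subset\mathbb{R}^d$, $I^\varepsilon$ is the closed $\varepsilon$-neighborhood of $I$ with respect to the maximum norm $|x|_+=\max_{1\le i\le d}|x_i|$; $\|\psi\|_I=\sup_{x\in I}|\psi(x)|$; $a\vee b=\max(a,b)$. A kernel is a measurable function $K:\mathbb{R}^d\to\mathbb{R}$. Conditions on $K$: (K.i) $\int_{\mathbb{R}^d}K(s)\,ds=1$. (K.ii) $\|K\|_\infty=\sup_{x\in\mathbb{R}^d}|K(x)|=\kappa<\infty$. Let $\mathcal{K}=\{K((x-\cdot)/h^{1/d}): h>0,\ x\in\mathbb{R}^d\}$. For $\varepsilon>0$ let $N(\varepsilon,\mathcal{K})=\sup_Q N(\kappa\varepsilon,\mathcal{K},d_Q)$, the supremum being over all probability measures $Q$ on the Borel sets of $\mathbb{R}^d$, where $d_Q$ is the $L_2(Q)$-metric and $N(\delta,\mathcal{K},d_Q)$ is the minimal number of balls $\{g: d_Q(g,g')<\delta\}$ of $d_Q$-radius $\delta$ needed to cover $\mathcal{K}$. (K.iii) For some $C>0$ and $\nu>0$, $N(\varepsilon,\mathcal{K})\le C\varepsilon^{-\nu}$ for all $0<\varepsilon<1$.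 (K.iv) $\mathcal{K}$ is a pointwise measurable class: there is a countable subclass $\mathcal{K}_0\subset\mathcal{K}$ such that for every $g\in\mathcal{K}$ there is a sequence $\{g_m\}$ in $\mathcal{K}_0$ with $g_m(z)\to g(z)$ for all $z\in\mathbb{R}^d$. *)

(* Defs.v *)
From HB Require Import structures.
From mathcomp Require Import all_boot all_order all_algebra.
From mathcomp Require Import all_classical all_reals all_analysis.
From mathcomp Require Import measurable_realfun.

Set Implicit Arguments.
Unset Strict Implicit.
Unset Printing Implicit Defensive.
Import Order.TTheory GRing.Theory Num.Theory.
Import numFieldNormedType.Exports.

Local Open Scope classical_set_scope.
Local Open Scope ring_scope.

(* The Borel sigma-algebra of R^n = 'rV[R]_n. The library's norm and topology
   on 'rV[R]_n are those of the maximum norm. *)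
HB.instance Definition _ (R : realType) (n : nat) :=
  @isMeasurable.Build (sigma_display (@open 'rV[R]_n)) 'rV[R]_n
    <<s @open 'rV[R]_n >> (@sigma_algebra0 _ setT _) (@sigma_algebraC _ _)
    (@sigma_algebra_bigcup _ setT _).

Section borel_rV.
Context {R : realType} {n : nat}.

Lemma measurable_coord_rV (i : 'I_n) :
  measurable_fun [set: 'rV[R]_n] (fun v : 'rV[R]_n => v ord0 i).
Proof.
apply: (measurability _ (RGenOpens.measurableE R)).
move=> _ [_ [a [b ->]] <-]; rewrite setTI.
apply: sub_sigma_algebra; apply: open_comp; last exact: itv_open.
by move=> v _; exact: coord_continuous.
Qed.

Lemma measurable_rVP d (T : measurableType d) (g : T -> 'rV[R]_n) :
  (forall i, measurable_fun [set: T] (fun x => g x ord0 i)) ->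
  measurable_fun [set: T] g.
Proof.
move=> mg; apply: (measurability (@open 'rV[R]_n)) => //.
move=> _ [U oU <-]; rewrite setTI.
pose B (qk : 'rV[rat]_n * nat) : set 'rV[R]_n :=
  [set v | forall i, `|v ord0 i - ratr (qk.1 ord0 i)| < qk.2.+1%:R^-1].
have mB qk : measurable (g @^-1` B qk).
  rewrite (_ : g @^-1` B qk = \bigcap_(i in [set: 'I_n])
      ((fun x => g x ord0 i) @^-1`
        [set r : R | `|r - ratr (qk.1 ord0 i)| < qk.2.+1%:R^-1])); last first.
    by apply/seteqP; split=> [x Bx i _|x Bx i]; [exact: Bx|exact: Bx].
  apply: fin_bigcap_measurable; first exact: finite_finset.
  move=> i _; rewrite -[X in measurable X]setTI; apply: mg => //.
  rewrite (_ : mkset _ = ball (ratr (qk.1 ord0 i) : R) qk.2.+1%:R^-1).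
    exact: measurable_ball.
  by apply/seteqP; split=> r; rewrite -ball_normE /ball_/= distrC.
have -> : g @^-1` U = \bigcup_(qk in [set qk | B qk `<=` U]) (g @^-1` B qk).
  apply/seteqP; split=> [x Ux|x [qk BU Bx]]; last exact: BU.
  have [e /= e0 eU] : nbhs_ball (g x) U.
    by apply/nbhs_ballP; move: oU; rewrite openE; exact.
  have [k ke] : exists k : nat, 2 * k.+1%:R^-1 < e.
    have /ltr_add_invr[k] : 0 < e / 2 by rewrite divr_gt0.
    by rewrite add0r ltr_pdivlMr// mulrC => ke; exists k.
  have k0 : 0 < (k.+1%:R^-1 : R) by rewrite invr_gt0.
  have qP i : exists q : rat, `|g x ord0 i - ratr q| < k.+1%:R^-1.
    have /rat_in_itvoo[q] : g x ord0 i - k.+1%:R^-1 < g x ord0 i + k.+1%:R^-1.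
      by rewrite ltrBlDr -addrA ltrDl addr_gt0.
    rewrite in_itv/= => /andP[q1 q2]; exists q.
    by rewrite ltr_distlC; rewrite q1 q2.
  have /choice[q qP'] := qP.
  exists (\row_i q i, k); last by move=> i /=; rewrite mxE.
  move=> v Bv; apply: eU; split => // i j; rewrite ord1.
  rewrite -ball_normE /ball_/=; apply: le_lt_trans ke.
  rewrite mulr_natl mulr2n.
  rewrite -(subrKA (ratr (q j))) (le_trans (ler_normD _ _))// lerD ?ltW//.
  by rewrite distrC; have := Bv j; rewrite /= mxE.
rewrite bigcup_mkcond; apply: countable_bigcupT_measurable; first exact: countableP.
by move=> qk; case: ifP => // _; exact: measurable0.
Qed.

End borel_rV.

Definition pushforward_measure d1 d2 (T1 : measurableType d1)
    (T2 : measurableType d2) (R : realType) (mu : {measure set T1 -> \bar R})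
    (g : T1 -> T2) (mg : measurable_fun [set: T1] g) :
    {measure set T2 -> \bar R} :=
  measure_function_pushforward__canonical__measure_function_Measure mu mg.

Section lebesgue_rV.
Context {R : realType}.

Definition cons_pair n (z : n.-tuple R * measurableTypeR R) : n.+1.-tuple R :=
  [tuple of z.2 :: z.1].

Lemma measurable_cons_pair n :
  measurable_fun [set: n.-tuple R * measurableTypeR R] (@cons_pair n).
Proof.
apply: (@measurable_cons _ _ _ R
  (fun z : n.-tuple R * measurableTypeR R => z.2) n fst).
- exact: measurable_snd.
- exact: measurable_fst.
Qed.

Fixpoint lebesgue_tuple n : {measure set (n.-tuple R) -> \bar R} :=
  if n is m.+1 then
    pushforward_measure (lebesgue_tuple m \x lebesgue_measure)%E
      (@measurable_cons_pair m)
  else \d_([tuple] : 0.-tuple R).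

Definition row_tuple n (t : n.-tuple R) : 'rV[R]_n := \row_i tnth t i.

Lemma measurable_row_tuple n : measurable_fun [set: n.-tuple R] (@row_tuple n).
Proof.
apply: measurable_rVP => i.
under eq_fun do rewrite mxE.
exact: measurable_tnth.
Qed.

Definition lebesgue_rV n : {measure set 'rV[R]_n -> \bar R} :=
  pushforward_measure (lebesgue_tuple n) (@measurable_row_tuple n).

Lemma lebesgue_rV_rectangle n (A : 'I_n -> set R) :
    (forall i, measurable (A i)) ->
  lebesgue_rV n [set x | forall i, A i (x ord0 i)] =
  (\prod_(i < n) lebesgue_measure (A i))%E.
Proof.
rewrite /lebesgue_rV/= /pushforward.
under [X in _ -> lebesgue_tuple n X = _]eq_set => t do
  under eq_forall => i do rewrite mxE.
elim: n A => [|n IH] A mA.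
  by rewrite big_ord0 /= diracE mem_set// => -[].
rewrite big_ord_recl /= /pushforward.
rewrite (_ : _ @^-1` _ = [set t : n.-tuple R | forall i, A (lift ord0 i) (tnth t i)]
    `*` A ord0).
  rewrite product_measure1E//; first by rewrite [RHS]muleC; congr (_ * _)%E; exact: IH.
    rewrite (_ : mkset _ = \bigcap_(i in [set: 'I_n])
        ((@tnth n R)^~ i @^-1` A (lift ord0 i))); last first.
      by apply/seteqP; split=> [t At i _|t At i]; exact: At.
    apply: fin_bigcap_measurable; first exact: finite_finset.
    by move=> i _; rewrite -[X in measurable X]setTI; exact: measurable_tnth.
  exact: mA.
apply/seteqP; split=> [[t r] /= At|[t r] [/= At Ar] i].
  split=> [i|]; last exact: (At ord0).
  by have := At (lift ord0 i); rewrite tnthS.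
have [->//|] := eqVneq i ord0.
by case: (unliftP ord0 i) => [j ->|->]; rewrite ?eqxx// => _; rewrite tnthS; exact: At.
Qed.

End lebesgue_rV.

Section probability_notions.
Context {d d' : measure_display} {Omega : measurableType d}
  {T : measurableType d'} {R : realType} (P : probability Omega R).

Definition mutually_independent (Z : nat -> {RV P >-> T}) : Prop :=
  forall (s : seq nat) (A : nat -> set T), uniq s ->
    (forall i, measurable (A i)) ->
    P (\bigcap_(i in [set` s]) (Z i @^-1` A i)) =
    (\prod_(i <- s) P (Z i @^-1` A i))%E.

Definition identically_distributed (Z : nat -> {RV P >-> T}) : Prop :=
  forall (i j : nat) (A : set T), measurable A ->
    distribution P (Z i) A = distribution P (Z j) A.

Definition iid (Z : nat -> {RV P >-> T}) : Prop :=
  mutually_independent Z /\ identically_distributed Z.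

(* [g] is a version of z |-> E[V | X = z]. Intended for V integrable or V
   nonnegative; in the latter case g may take the value +oo. *)
Definition cond_expectation (V : Omega -> \bar R) (X : Omega -> T)
    (g : T -> \bar R) : Prop :=
  measurable_fun [set: T] g /\
  forall B : set T, measurable B ->
    (\int[P]_(w in X @^-1` B) g (X w) = \int[P]_(w in X @^-1` B) V w)%E.

End probability_notions.

Definition has_lebesgue_density (d : measure_display) (Omega : measurableType d)
    (R : realType) (P : probability Omega R) (n : nat) (X : Omega -> 'rV[R]_n)
    (f : 'rV[R]_n -> R) : Prop :=
  [/\ measurable_fun [set: 'rV[R]_n] f, forall x, 0 <= f x &
    forall B : set 'rV[R]_n, measurable B ->
      P (X @^-1` B) = (\int[lebesgue_rV n]_(x in B) (f x)%:E)%E].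

Definition closed_nbhd (R : realType) (n : nat) (I : set 'rV[R]_n) (e : R) :
    set 'rV[R]_n :=
  [set x | exists2 y, I y & `|x - y| <= e].

Definition sup_norm (R : realType) (T : Type) (A : set T) (psi : T -> R) :
    \bar R :=
  ereal_sup [set `|psi x|%:E | x in A].

Section covering_numbers.
Context {d : measure_display} {T : measurableType d} {R : realType}.

(* The centers of the balls range over all measurable functions, and are not
   required to belong to [F]. *)
Definition coverable_with (Q : probability T R) (F : set (T -> R)) (delta : R)
    (N : nat) : Prop :=
  exists c : 'I_N -> T -> R, (forall j, measurable_fun [set: T] (c j)) /\
    F `<=` \bigcup_(j in [set: 'I_N])
      [set g | ('N[Q]_2%:E[EFin \o (g \- c j)%R] < delta%:E)%E].

(* +oo when no finite cover exists *)
Definition covering_number (Q : probability T R) (F : set (T -> R))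
    (delta : R) : \bar R :=
  ereal_inf [set N%:R%:E | N in coverable_with Q F delta].

End covering_numbers.

Section kernel.
Context {R : realType} {d : nat}.
Implicit Types (K g : 'rV[R]_d -> R) (x y : 'rV[R]_d) (h : R).

Definition scaled_kernel K x h y : R := K ((h `^ d%:R^-1)^-1 *: (x - y)).

Definition kernel_class K : set ('rV[R]_d -> R) :=
  [set g | exists x h, 0 < h /\ g = scaled_kernel K x h].

Definition kernel_bound K : R := fine (sup_norm [set: 'rV[R]_d] K).

Definition uniform_covering_number K (e : R) : \bar R :=
  ereal_sup [set covering_number Q (kernel_class K) (kernel_bound K * e) |
    Q in [set: probability 'rV[R]_d R]].

Definition kernel_cond_i K : Prop :=
  (\int[lebesgue_rV d]_s (K s)%:E = 1)%E.

Definition kernel_cond_ii K : Prop := (sup_norm [set: 'rV[R]_d] K < +oo)%E.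

Definition kernel_cond_iii K : Prop :=
  exists C nu : R, [/\ 0 < C, 0 < nu & forall e : R, 0 < e < 1 ->
    (uniform_covering_number K e <= (C * e `^ (- nu))%:E)%E].

Definition pointwise_measurable (F : set ('rV[R]_d -> R)) : Prop :=
  exists F0 : set ('rV[R]_d -> R), [/\ F0 `<=` F, countable F0 &
    forall g, F g -> exists g_ : nat -> 'rV[R]_d -> R,
      (forall m, F0 (g_ m)) /\ forall z, g_ m z @[m --> \oo] --> g z].

Definition kernel_cond_iv K : Prop := pointwise_measurable (kernel_class K).

Definition kernel_support K : Prop :=
  forall x, K x != 0 -> forall i, - 2^-1 <= x ord0 i <= 2^-1.

End kernel.

Section nadaraya_watson.
Context {R : realType} {d : nat} (K : 'rV[R]_d -> R).

(* The sample is z_1, ..., z_n, with z_i = (y_i, x_i). *)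
Definition nadaraya_watson (z : nat -> R * 'rV[R]_d) (n : nat) (h : R)
    (x : 'rV[R]_d) : R :=
  (\sum_(1 <= i < n.+1) (z i).1 * scaled_kernel K x h (z i).2) /
  (\sum_(1 <= i < n.+1) scaled_kernel K x h (z i).2).

Context {d0 : measure_display} {Omega : measurableType d0}
  (P : probability Omega R).

Definition rbar (Y : Omega -> R) (X : Omega -> 'rV[R]_d) (x : 'rV[R]_d)
    (h : R) : R :=
  fine 'E_P[fun w => Y w * scaled_kernel K x h (X w)] / h.

Definition fbar (X : Omega -> 'rV[R]_d) (x : 'rV[R]_d) (h : R) : R :=
  fine 'E_P[fun w => scaled_kernel K x h (X w)] / h.

(* [Z 0] is the generic pair (Y, X), and [Z 1], [Z 2], ... is the sample.
   Suprema are taken in \bar R, so that a supremum over an empty range of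
   bandwidths is -oo. *)
Definition normalized_deviation (Z : nat -> Omega -> R * 'rV[R]_d)
    (I : set 'rV[R]_d) (n : nat) (a b : R) (w : Omega) : \bar R :=
  ereal_sup [set
    ((Num.sqrt (n%:R * h))%:E *
     sup_norm I (fun x => (nadaraya_watson (Z ^~ w) n h x -
       rbar (fst \o Z 0%N) (snd \o Z 0%N) x h / fbar (snd \o Z 0%N) x h)%R) *
     ((Num.sqrt (Num.max (ln h^-1) (ln (ln n%:R))))^-1)%:E)%E
    | h in `[a, b]].

End nadaraya_watson.

(* Main.v *)
Require Import Defs.
From HB Require Import structures.
From mathcomp Require Import all_boot all_order all_algebra.
From mathcomp Require Import all_classical all_reals all_analysis.
From mathcomp Require Import measurable_realfun.
From mathcomp Require Import ring lra.

Set Implicit Arguments.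
Unset Strict Implicit.
Unset Printing Implicit Defensive.
Import Order.TTheory GRing.Theory Num.Theory.
Import numFieldNormedType.Exports.

Local Open Scope classical_set_scope.
Local Open Scope ring_scope.

(** * Rademacher sums *)

Section rademacher.
Context {R : realType}.
Implicit Types (f g : seq bool -> R) (E F : set (seq bool)) (a v : nat -> R).

Fixpoint rexp n f : R :=
  if n is m.+1 then
    (rexp m (fun s => f (true :: s)) + rexp m (fun s => f (false :: s))) / 2
  else f [::].

Definition rprob n E : R := rexp n \1_E.

Definition signed_sum (s : seq bool) a m : R :=
  \sum_(i < m) (-1) ^+ nth false s i * a i.

Lemma le_rexp n f g : (forall s, f s <= g s) -> rexp n f <= rexp n g.
Proof.
elim: n f g => [|n IH] f g fg /=; first exact: fg.
by rewrite ler_pM2r ?invr_gt0// lerD// IH.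
Qed.

Lemma rexp_cst n (c : R) : rexp n (fun=> c) = c.
Proof. by elim: n => //= n ->; field. Qed.

Lemma rexp_sum n (T : Type) (r : seq T) (h : T -> seq bool -> R) :
  rexp n (fun s => \sum_(i <- r) h i s) = \sum_(i <- r) rexp n (h i).
Proof.
elim: n h => [//|n IH] h /=.
by rewrite !IH -big_split/= mulr_suml.
Qed.

Lemma rexpD n f g : rexp n (fun s => f s + g s) = rexp n f + rexp n g.
Proof. by elim: n f g => //= n IH f g; rewrite !IH; field. Qed.

Lemma rprob_le1 n E : rprob n E <= 1.
Proof.
rewrite -(rexp_cst n 1); apply: le_rexp => s.
by rewrite indicE; case: (_ \in _).
Qed.

Lemma rprob_subset_sum n (T : finType) (F : T -> set (seq bool)) E :
  (forall s, E s -> exists i, F i s) -> rprob n E <= \sum_i rprob n (F i).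
Proof.
move=> EF; rewrite -rexp_sum; apply: le_rexp => s.
rewrite indicE; case: (boolP (s \in E)) => [/set_mem /EF[i Fis]|_].
- rewrite (bigD1 i)//= [X in _ <= X + _]indicE mem_set// lerDl.
  by apply: sumr_ge0 => k _; rewrite indicE.
- by apply: sumr_ge0 => i _; rewrite indicE.
Qed.

Lemma rprob_subset n E F : E `<=` F -> rprob n E <= rprob n F.
Proof.
move=> EF; apply: le_rexp => s; rewrite !indicE ler_nat.
by case: (boolP (s \in E)) => // /set_mem/EF Fs; rewrite mem_set.
Qed.

(** Both halves of the proof avoid power series: for small [x] the bound
[expR y <= (1 - y)^-1] at [y = x] and [y = - x] averages to [(1 - x ^+ 2)^-1],
for large [x] one exponential already exceeds the average. *)
Lemma cosh_le_expR_sqr (x : R) : (expR x + expR (- x)) / 2 <= expR (2 * x ^+ 2).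
Proof.
have [xs|xl] := lerP (x ^+ 2) (2^-1).
  have x1 : `|x| < 1.
    rewrite -(ltr_pXn2r (n := 2))// ?nnegrE// expr1n real_normK ?num_real//.
    by apply: (le_lt_trans xs); rewrite invf_lt1// ltr1n.
  have /andP[x1l x1r] : -1 < x < 1 by rewrite -ltr_norml.
  have H (y : R) : -1 < y < 1 -> expR y <= (1 - y)^-1.
    move=> /andP[_ y1]; rewrite -[X in X <= _]invrK lef_pV2 ?posrE ?invr_gt0 ?expR_gt0 ?subr_gt0//.
    by rewrite -expRN; apply: expR_ge1Dx.
  have Hx := H x; have HNx := H (- x).
  rewrite opprK in HNx.
  have e1 : expR x <= (1 - x)^-1 by apply: Hx; rewrite x1l x1r.
  have e2 : expR (- x) <= (1 + x)^-1 by apply: HNx; lra.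
  have e3 : 1 + 2 * x ^+ 2 <= expR (2 * x ^+ 2) by exact: expR_ge1Dx.
  apply: le_trans e3; apply: (@le_trans _ _ (((1 - x)^-1 + (1 + x)^-1) / 2)); first lra.
  have -> : ((1 - x)^-1 + (1 + x)^-1) / 2 = (1 - x ^+ 2)^-1.
    have h1 : 1 - x != 0 by rewrite lt0r_neq0//; lra.
    have h2 : 1 + x != 0 by rewrite lt0r_neq0//; lra.
    have h3 : 1 - x ^+ 2 != 0 by rewrite lt0r_neq0//; lra.
    by field; rewrite h1 h2 h3.
  rewrite -[X in X <= _]mul1r ler_pdivrMr; last by lra.
  by have := sqr_ge0 x; move: (x ^+ 2) xs => y ys y0; nra.
apply: (@le_trans _ _ (expR `|x|)).
  have e1 : expR x <= expR `|x| by rewrite ler_expR ler_norm.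
  have e2 : expR (- x) <= expR `|x| by rewrite ler_expR -normrN ler_norm.
  lra.
rewrite ler_expR -real_normK ?num_real//.
rewrite -real_normK ?num_real// in xl.
have := normr_ge0 x; move: (`|x|) xl => y; nra.
Qed.

Lemma signed_sum_cons b s a m :
  signed_sum (b :: s) a m.+1 = (-1) ^+ b * a 0%N + signed_sum s (fun i => a i.+1) m.
Proof. by rewrite /signed_sum big_ord_recl. Qed.

Lemma signed_sumN s a m : signed_sum s (fun i => - a i) m = - signed_sum s a m.
Proof. by rewrite /signed_sum -sumrN; apply: eq_bigr => i _; rewrite mulrN. Qed.

Lemma signed_sumD s a v m :
  signed_sum s (fun i => a i + v i) m = signed_sum s a m + signed_sum s v m.
Proof. by rewrite /signed_sum -big_split; apply: eq_bigr => i _; rewrite mulrDr. Qed.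

Lemma signed_sum_sum s N (c : 'I_N -> nat -> R) m :
  signed_sum s (fun i => \sum_(l < N) c l i) m = \sum_(l < N) signed_sum s (c l) m.
Proof.
rewrite /signed_sum exchange_big; apply: eq_bigr => i _.
by rewrite mulr_sumr.
Qed.

Lemma norm_signed_sum_le s a m : `|signed_sum s a m| <= \sum_(i < m) `|a i|.
Proof.
apply: (le_trans (ler_norm_sum _ _ _)); apply: ler_sum => i _.
by rewrite normrM normrX normrN normr1 expr1n mul1r.
Qed.

(** [expR (k * (S_m - t))] times the compensator [expR (- 2 * k ^+ 2 * V_m)] is
a supermartingale; the induction on the number of signs is optional stopping at
the first passage above [t]. *)
Lemma rprob_max_signed_sum n a (x t k : R) : 0 <= k ->
  rprob n [set s | exists2 m, (m <= n)%N & t < x + signed_sum s a m] <=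
  expR (k * (x - t) + 2 * k ^+ 2 * \sum_(i < n) a i ^+ 2).
Proof.
move=> k0; elim: n a x => [|n IH] a x.
  rewrite big_ord0 mulr0 addr0 /rprob/= indicE; case: (boolP (_ \in _)) => [|_]; last exact: expR_ge0.
  move=> /set_mem[m]; rewrite leqn0 => /eqP -> ; rewrite /signed_sum big_ord0 addr0 => tx.
  by rewrite -expR0 ler_expR mulr_ge0// subr_ge0 ltW.
have [tx|xt] := ltP t x.
  apply: (le_trans (rprob_le1 _ _)); rewrite -expR0 ler_expR addr_ge0 ?mulr_ge0 ?subr_ge0 ?exprn_ge0 ?(ltW tx)//.
  by apply: sumr_ge0 => i _; exact: sqr_ge0.
rewrite /rprob/= big_ord_recl.
set a' := fun i => a i.+1.
have H b : rexp n (fun s => \1_[set s | exists2 m, (m <= n.+1)%N & t < x + signed_sum s a m] (b :: s))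
    <= expR (k * (x + (-1) ^+ b * a 0%N - t) + 2 * k ^+ 2 * \sum_(i < n) a' i ^+ 2).
  apply: (le_trans _ (IH a' _)).
  apply: le_rexp => s; rewrite !indicE; case: (boolP (_ \in _)) => // /set_mem[m].
  case: m => [_|m]; first by rewrite /signed_sum big_ord0 addr0 ltNge xt.
  rewrite ltnS => mn; rewrite signed_sum_cons => tm.
  by rewrite mem_set//; exists m => //; rewrite -addrA.
apply: (le_trans (ler_wpM2r _ (lerD (H true) (H false)))); first by rewrite invr_ge0.
rewrite /= expr0 expr1 !mul1r mulN1r.
rewrite [leRHS](_ : _ = expR (k * (x - t) + 2 * k ^+ 2 * \sum_(i < n) a' i ^+ 2) * expR (2 * (k * a 0%N) ^+ 2)); last first.
  have -> : \sum_(i < n) a (lift ord0 i) ^+ 2 = \sum_(i < n) a' i ^+ 2 by [].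
  by rewrite -expRD; congr expR; rewrite /=; ring.
rewrite [X in (expR X + _) / 2](_ : _ = (k * (x - t) + 2 * k ^+ 2 * \sum_(i < n) a' i ^+ 2) + - (k * a 0%N)); last by ring.
rewrite [X in (_ + expR X) / 2](_ : _ = (k * (x - t) + 2 * k ^+ 2 * \sum_(i < n) a' i ^+ 2) + (k * a 0%N)); last by ring.
move: (k * (x - t) + _) => c.
rewrite !expRD -mulrDr -mulrA ler_pM2l ?expR_gt0// addrC; exact: cosh_le_expR_sqr.
Qed.

Lemma rprob_max_norm_signed_sum n a (t V : R) : 0 <= t -> 0 < V ->
  \sum_(i < n) a i ^+ 2 <= V ->
  rprob n [set s | exists2 m, (m <= n)%N & t < `|signed_sum s a m|] <=
  2 * expR (- (t ^+ 2 / (8 * V))).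
Proof.
move=> t0 V0 aV.
have k0 : 0 <= t / (4 * V) by rewrite divr_ge0// mulr_ge0// ltW.
have H a' : \sum_(i < n) a' i ^+ 2 <= V ->
    rprob n [set s | exists2 m, (m <= n)%N & t < 0 + signed_sum s a' m] <=
    expR (- (t ^+ 2 / (8 * V))).
  move=> a'V; apply: (le_trans (rprob_max_signed_sum _ _ _ _ k0)).
  rewrite ler_expR add0r.
  apply: (@le_trans _ _ (t / (4 * V) * - t + 2 * (t / (4 * V)) ^+ 2 * V)).
    by rewrite lerD2l ler_wpM2l// mulr_ge0// sqr_ge0.
  by rewrite le_eqVlt; apply/orP; left; apply/eqP; field; rewrite gt_eqF.
have HN := H (fun i => - a i).
have {}HN := HN ltac:(by under eq_bigr do rewrite sqrrN).
rewrite mulr2n mulrDl mul1r.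
apply: (le_trans _ (lerD (H _ aV) HN)).
rewrite -rexpD; apply: le_rexp => s; rewrite !indicE.
case: (boolP (s \in _)) => [/set_mem[m mn]|_]; last by rewrite -natrD.
rewrite ltr_normr => /orP[tm|tm].
  by rewrite mem_set ?lerDl//; exists m => //; rewrite add0r.
have -> : s \in [set s | exists2 m, (m <= n)%N & t < 0 + signed_sum s (fun i => - a i) m].
  by rewrite mem_set//; exists m => //; rewrite add0r signed_sumN.
by rewrite lerDr.
Qed.

Lemma sum_half_le2 L : \sum_(l < L) 2 ^- l <= 2 :> R.
Proof.
suff -> : \sum_(l < L) 2 ^- l = 2 - 2 * 2 ^- L :> R.
  by rewrite gerBl mulr_ge0// invr_ge0 exprn_ge0.
elim: L => [|L IH]; first by rewrite big_ord0 expr0 invr1 mulr1 subrr.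
by rewrite big_ord_recr/= IH exprS invfM; field; rewrite expf_neq0.
Qed.

Lemma sum_nat_half_le2 L : \sum_(l < L) l.+1%:R * 2 ^- l.+1 <= 2 :> R.
Proof.
suff -> : \sum_(l < L) l.+1%:R * 2 ^- l.+1 = 2 - (L%:R + 2) * 2 ^- L :> R.
  by rewrite gerBl mulr_ge0// ?invr_ge0 ?exprn_ge0// addr_ge0.
elim: L => [|L IH]; first by rewrite big_ord0 expr0 invr1 add0r mulr1 subrr.
rewrite big_ord_recr/= IH exprS invfM -[L.+1]addn1 natrD.
by field; rewrite expf_neq0.
Qed.

(** Chaining through covers of [F] at the scales [D / 2 ^+ l]. The step from
scale [l] to [l.+1] is allowed the deviation [D / 2 ^+ l.+1 * l.+1 * b * u]:
the factor [l.+1] beats the number [B ^+ l.+1 * B ^+ l] of pairs of centers,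
and the deviations still sum to a multiple of [D * u]. *)
Lemma rademacher_chaining (B b D u : R) n (F : set (nat -> R)) :
  1 <= B -> 0 <= b -> 80 * (1 + 2 * ln B) <= b ^+ 2 -> 0 < D -> 1 <= u ->
  (forall v, F v -> \sum_(i < n) v i ^+ 2 <= D ^+ 2) ->
  (forall l, (0 < l)%N -> exists N (c : 'I_N -> nat -> R), N%:R <= B ^+ l /\
     forall v, F v -> exists j, \sum_(i < n) (v i - c j i) ^+ 2 <= (D / 2 ^+ l) ^+ 2) ->
  rprob n [set s | exists m v, [/\ (m <= n)%N, F v &
     (2 * b + 1) * D * u < `|signed_sum s v m|]] <= 4 * expR (- u ^+ 2).
Proof.
move=> B1 b0 bB D0 u1 FD cov.
have u0 : 0 <= u by exact: le_trans u1.
have lnB0 : 0 <= ln B by exact: ln_ge0.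
have {cov} : forall l, exists p : {N : nat & 'I_N -> nat -> R},
    [/\ (tag p)%:R <= B ^+ l, (forall v, F v -> exists j,
      \sum_(i < n) (v i - tagged p j i) ^+ 2 <= (D / 2 ^+ l) ^+ 2) &
      l = 0%N -> forall j i, tagged p j i = 0].
  case=> [|l].
    exists (existT (fun N : nat => 'I_N -> nat -> R) 1%N (fun _ _ => 0)); split => //= v Fv.
    exists ord0; rewrite expr0 divr1; under eq_bigr do rewrite subr0.
    exact: FD.
  have [N [c [NB cF]]] := cov l.+1 isT.
  by exists (existT (fun N : nat => 'I_N -> nat -> R) N c).
move=> /choice[p hp].
pose N l := tag (p l); pose c l : 'I_(N l) -> nat -> R := tagged (p l).
pose eta l := D / 2 ^+ l.+1 * l.+1%:R * b * u.
pose V l := 10 * (D / 2 ^+ l.+1) ^+ 2.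
have V0 l : 0 < V l by rewrite mulr_gt0// exprn_gt0// divr_gt0// exprn_gt0.
have eta0 l : 0 <= eta l.
  by rewrite !mulr_ge0// ?(ltW D0)// invr_ge0 exprn_ge0.
pose diff l (q : 'I_(N l.+1) * 'I_(N l)) i := c l.+1 q.1 i - c l q.2 i.
pose E l (q : 'I_(N l.+1) * 'I_(N l)) := [set s | \sum_(i < n) diff l q i ^+ 2 <= V l /\
  exists2 m, (m <= n)%N & eta l < `|signed_sum s (diff l q) m|].
pose EE l := [set s | exists q, E l q s].
have pE l q : rprob n (E l q) <= 2 * expR (- (eta l ^+ 2 / (8 * V l))).
  have [h|h] := boolP (\sum_(i < n) diff l q i ^+ 2 <= V l).
    apply: (le_trans _ (rprob_max_norm_signed_sum (eta0 l) (V0 l) h)).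
    by apply: rprob_subset => s [].
  apply: (@le_trans _ _ 0); last by rewrite mulr_ge0// expR_ge0.
  rewrite -(rexp_cst n 0); apply: le_rexp => s; rewrite indicE memNset// => -[].
  by rewrite (negbTE h).
have etaV l : eta l ^+ 2 / (8 * V l) = l.+1%:R ^+ 2 * (b ^+ 2 / 80) * u ^+ 2.
  rewrite /eta /V; field.
  by rewrite ?expf_neq0//= gt_eqF.
have pEE l : rprob n (EE l) <= 2 * expR (- u ^+ 2) * 2 ^- l.
  apply: (le_trans (@rprob_subset_sum _ _ (E l) _ _)); first by [].
  apply: (le_trans (ler_sum _ (fun q _ => pE l q))).
  rewrite sumr_const card_prod !card_ord -[leLHS]mulr_natl natrM etaV.
  have NB k : (N k)%:R <= B ^+ k by have [] := hp k.
  apply: (@le_trans _ _ (B ^+ l.+1 * B ^+ l.+1 * (2 * expR (- (l.+1%:R ^+ 2 * (b ^+ 2 / 80) * u ^+ 2))))).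
    rewrite ler_wpM2r ?mulr_ge0 ?expR_ge0//.
    rewrite ler_pM//; apply: (le_trans (NB l)).
    by rewrite exprS ler_peMl// exprn_ge0// (le_trans ler01).
  have Bpos : B \is Num.pos by rewrite posrE (lt_le_trans ltr01).
  have BE k : B ^+ k = expR (k%:R * ln B) by rewrite expRM_natl lnK.
  rewrite !BE mulrCA -[leRHS]mulrA ler_pM2l// -2!expRD.
  have half : expR (- 1) <= 2^-1 :> R.
    rewrite expRN lef_pV2 ?posrE ?expR_gt0//.
    by apply: le_trans (expR_ge1Dx _); rewrite -natr1.
  apply: (@le_trans _ _ (expR (- u ^+ 2) * expR (l%:R * - 1))); last first.
    by rewrite ler_pM2l ?expR_gt0// expRM_natl -exprVn lerXn2r// ?nnegrE ?expR_ge0.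
  rewrite -expRD ler_expR.
  have l1 : 1 <= l.+1%:R :> R by rewrite ler1n.
  have -> : l%:R = l.+1%:R - 1 :> R by rewrite -natr1; ring.
  move: (l.+1%:R) l1 => y y1.
  have u2 : 1 <= u ^+ 2 by rewrite exprn_ege1.
  have y2 : y <= y ^+ 2 by rewrite expr2 ler_peMr// (le_trans ler01).
  have bB' : 1 + 2 * ln B <= b ^+ 2 / 80 by rewrite ler_pdivlMr// mulrC.
  have q1 : y * (1 + 2 * ln B) <= y ^+ 2 * (b ^+ 2 / 80).
    by rewrite ler_pM//; lra.
  have q2 : y * (1 + 2 * ln B) * u ^+ 2 <= y ^+ 2 * (b ^+ 2 / 80) * u ^+ 2.
    by rewrite ler_wpM2r// sqr_ge0.
  have q3 : y * ln B <= y * ln B * u ^+ 2.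
    by rewrite ler_peMr// mulr_ge0//; lra.
  have q4 : y - 1 <= (y - 1) * u ^+ 2 by rewrite ler_peMr//; lra.
  move: q2 q3 q4; move: (u ^+ 2) (y ^+ 2 * _) => *; lra.
have sumE : rprob n [set s | exists l : 'I_n, EE l s] <= 4 * expR (- u ^+ 2).
  apply: (le_trans (@rprob_subset_sum n _ (fun l : 'I_n => EE l) _ _)) => //.
  apply: (le_trans (ler_sum _ (fun (l : 'I_n) _ => pEE l))).
  rewrite -mulr_sumr; have := sum_half_le2 n; have := expR_ge0 (- u ^+ 2); nra.
apply: le_trans sumE; apply: rprob_subset => s [m [v [mn Fv]]].
apply: contraPP => /= nE; apply/negP; rewrite -leNgt.
have ex_j l : exists j : 'I_(N l),
   \sum_(i < n) (v i - c l j i) ^+ 2 <= (D / 2 ^+ l) ^+ 2.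
  by have [_ /(_ _ Fv)] := hp l.
pose j l := projT1 (cid (ex_j l)).
have hj l : \sum_(i < n) (v i - c l (j l) i) ^+ 2 <= (D / 2 ^+ l) ^+ 2.
  exact: projT2 (cid (ex_j l)).
pose w (l : 'I_n) i := diff l (j l.+1, j l) i.
pose r i := v i - c n (j n) i.
have vE : v = fun i => \sum_(l < n) w l i + r i.
  apply/funext => i; rewrite /w /diff /r /=.
  rewrite -(big_mkord xpredT (fun l => c l.+1 (j l.+1) i - c l (j l) i)).
  rewrite telescope_sumr//.
  have [_ _ h0] := hp 0%N; have -> : c 0%N (j 0%N) i = 0 by exact: h0.
  by rewrite subr0 addrC subrK.
rewrite vE signed_sumD signed_sum_sum (le_trans (ler_normD _ _))//.
have -> : (2 * b + 1) * D * u = D * b * u * 2 + D * u by ring.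
apply: lerD.
  apply: (le_trans (ler_norm_sum _ _ _)).
  apply: (@le_trans _ _ (\sum_(l < n) eta l)).
    apply: ler_sum => l _; rewrite leNgt; apply/negP => etal; apply: nE.
    exists l; exists (j l.+1, j l); split; last by exists m.
    apply: (@le_trans _ _ (2 * (D / 2 ^+ l.+1) ^+ 2 + 2 * (D / 2 ^+ l) ^+ 2)); last first.
      have -> : D / 2 ^+ l = 2 * (D / 2 ^+ l.+1).
        by rewrite (exprS 2 l); field; rewrite expf_neq0.
      by rewrite /V exprMn; lra.
    apply: (le_trans _ (lerD (ler_wpM2l _ (hj l.+1)) (ler_wpM2l _ (hj l)))) => //.
    rewrite !mulr_sumr -big_split/=; apply: ler_sum => i _; rewrite /diff/=.
    move: (v i) (c l.+1 _ i) (c l _ i) => x1 x2 x3; have := sqr_ge0 (x1 - x2 + (x1 - x3)); lra.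
  have -> : \sum_(l < n) eta l = D * b * u * \sum_(l < n) l.+1%:R * 2 ^- l.+1.
    by rewrite mulr_sumr; apply: eq_bigr => l _; rewrite /eta; ring.
  by rewrite ler_wpM2l ?sum_nat_half_le2// !mulr_ge0// ltW.
apply: (le_trans (norm_signed_sum_le _ _ _)).
apply: (@le_trans _ _ (\sum_(i < m) D / 2 ^+ n)).
  apply: ler_sum => i _.
  have Dn0 : 0 <= D / 2 ^+ n by rewrite divr_ge0 ?exprn_ge0// ltW.
  rewrite -(ler_pXn2r (n := 2))// real_normK ?num_real//.
  have lt_in : (i < n)%N by exact: leq_trans (ltn_ord i) mn.
  apply: le_trans (hj n).
  rewrite (bigD1 (Ordinal lt_in))//= lerDl; apply: sumr_ge0 => k _; exact: sqr_ge0.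
rewrite sumr_const card_ord -[leLHS]mulr_natl.
apply: (@le_trans _ _ (2 ^+ n * (D / 2 ^+ n))).
  rewrite ler_wpM2r// ?divr_ge0 ?exprn_ge0// ?(ltW D0)// -natrX ler_nat.
  by apply: leq_trans mn _; apply: ltnW; exact: ltn_expl.
by rewrite mulrCA divff ?expf_neq0// ler_wpM2l// ltW.
Qed.

End rademacher.

(** * Independent sequences on the canonical path space *)

Definition path_space (d : measure_display) (T : measurableType d) : Type := nat -> T.

Definition cylinders (d : measure_display) (T : measurableType d) :
    set (set (path_space T)) :=
  [set C | exists i (A : set T), measurable A /\ C = [set z | A (z i)]].

Arguments cylinders {d} T _.

Definition path_display : measure_display -> measure_display.
Proof. exact: id. Qed.

HB.instance Definition _ d (T : measurableType d) := gen_eqMixin (path_space T).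
HB.instance Definition _ d (T : measurableType d) := gen_choiceMixin (path_space T).
HB.instance Definition _ d (T : measurableType d) :=
  isPointed.Build (path_space T) (fun=> point).
HB.instance Definition _ d (T : measurableType d) :=
  @isMeasurable.Build (path_display d) (path_space T)
    <<s cylinders T >> (@sigma_algebra0 _ setT _) (@sigma_algebraC _ _)
    (@sigma_algebra_bigcup _ setT _).

Section path_space_theory.
Context {d : measure_display} {T : measurableType d}.
Local Notation S := (path_space T).

Lemma measurable_eval i : measurable_fun [set: S] (fun z : S => z i).
Proof.
move=> _ A mA; rewrite setTI; apply: sub_sigma_algebra.
by exists i, A.
Qed.

Lemma measurable_pathP d' (X : measurableType d') (g : X -> S) :
  (forall i, measurable_fun [set: X] (fun x => g x i)) -> measurable_fun [set: X] g.
Proof.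
move=> mg; apply: (@measurability _ _ X S setT g (cylinders T)) => //.
by move=> _ [_ [i [A [mA ->]]] <-]; rewrite setTI -[X in measurable X]setTI; exact: mg.
Qed.

Definition box (n : nat) (A : nat -> set T) : set S :=
  [set z | forall i, (i < n)%N -> A i (z i)].

Lemma boxE n A : box n A = \bigcap_(i in `I_n) ((fun z : S => z i) @^-1` A i).
Proof. by apply/seteqP; split=> z Az i; exact: Az. Qed.

Lemma measurable_box n A : (forall i, measurable (A i)) -> measurable (box n A).
Proof.
move=> mA; rewrite boxE; apply: fin_bigcap_measurable; first exact: finite_II.
by move=> i _; rewrite -[X in measurable X]setTI; exact: measurable_eval.
Qed.

Context {R : realType} (nu : probability T R).

(** [mu] is the law of a sequence of independent variables with law [nu]. *)
Definition iid_law (mu : probability S R) : Prop :=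
  forall (s : seq nat) (A : nat -> set T), uniq s -> (forall i, measurable (A i)) ->
    mu [set z | forall i, i \in s -> A i (z i)] = (\prod_(i <- s) nu (A i))%E.

Definition boxes : set (set S) :=
  [set B | exists n A, (forall i, measurable (A i)) /\ B = box n A].

Lemma boxes_generate : @measurable _ S = <<s boxes >>.
Proof.
apply/seteqP; split; last first.
  apply: smallest_sub; first exact: sigma_algebra_measurable.
  by move=> _ [n [A [mA ->]]]; exact: measurable_box.
apply: smallest_sub; first exact: smallest_sigma_algebra.
move=> _ [i [A [mA ->]]]; apply: sub_sigma_algebra.
exists i.+1, (fun j => if j == i then A else setT); split.
  by move=> j; case: ifP.
apply/seteqP; split=> z /=.
  by move=> Az j _; case: eqP => // ->.
by move=> /(_ i (ltnSn _)); rewrite eqxx.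
Qed.

Lemma boxes_setI_closed : setI_closed boxes.
Proof.
move=> _ _ [n [A [mA ->]]] [m [B [mB ->]]].
exists (maxn n m), (fun i => (if (i < n)%N then A i else setT) `&` (if (i < m)%N then B i else setT)).
split; first by move=> i; apply: measurableI; case: ifP.
apply/seteqP; split=> z /=.
  by move=> [Az Bz] i _; split; case: ifP => // h; [exact: Az|exact: Bz].
move=> h; split=> i im.
  by have [] := h i (leq_trans im (leq_maxl _ _)); rewrite im.
by have [] := h i (leq_trans im (leq_maxr _ _)); rewrite im.
Qed.

Lemma path_measure_unique (m1 m2 : {measure set S -> \bar R}) :
  (m1 setT < +oo)%E ->
  (forall n A, (forall i, measurable (A i)) -> m1 (box n A) = m2 (box n A)) ->
  forall B, measurable B -> m1 B = m2 B.
Proof.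
move=> m1oo m12; apply: (measure_unique boxes (fun=> setT)).
- exact: boxes_generate.
- exact: boxes_setI_closed.
- by move=> _; exists 0%N, (fun=> setT); split => //; apply/seteqP; split.
- by rewrite bigcup_const//; exists 0%N.
- by move=> _ [n [A [mA ->]]]; exact: m12.
- by [].
Qed.

Lemma iid_law_box mu n A : iid_law mu -> (forall i, measurable (A i)) ->
  mu (box n A) = (\prod_(i < n) nu (A i))%E.
Proof.
move=> h mA; rewrite -(big_mkord xpredT (fun i => nu (A i))) /index_iota subn0.
rewrite -h ?iota_uniq//; congr (mu _).
by apply/seteqP; split=> z hz i; [rewrite mem_iota => /hz|move=> im; apply: hz; rewrite mem_iota].
Qed.

Definition reindex (s : nat -> nat) (z : S) : S := fun i => z (s i).

Lemma measurable_reindex s : measurable_fun [set: S] (reindex s).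
Proof. by apply: measurable_pathP => i; exact: measurable_eval. Qed.

Lemma iid_law_reindex mu s r : cancel s r -> iid_law mu ->
  forall B, measurable B -> mu (reindex s @^-1` B) = mu B.
Proof.
move=> sr h B mB.
apply: (@path_measure_unique (pushforward_measure mu (measurable_reindex s)) mu) => //.
  by rewrite /= /pushforward preimage_setT probability_setT ltry.
move=> n A mA /=; rewrite iid_law_box// /pushforward.
rewrite -(big_mkord xpredT (fun i => nu (A i))) /index_iota subn0.
have -> : (\prod_(i <- iota 0 n) nu (A i))%E = (\prod_(i <- map s (iota 0 n)) nu (A (r i)))%E.
  by rewrite big_map; apply: eq_bigr => i _; rewrite sr.
rewrite -(h _ (fun i => A (r i))) ?map_inj_uniq ?iota_uniq//; last exact: can_inj sr.
congr (mu _); apply/seteqP; split=> z hz i.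
  by move=> /mapP[j]; rewrite mem_iota => jn ->; rewrite sr; exact: hz.
move=> im; rewrite /reindex; have := hz (s i); rewrite sr; apply.
by apply/mapP; exists i => //; rewrite mem_iota.
Qed.

Definition append n (p : S * S) : S := fun i => if (i < n)%N then p.1 i else p.2 (i - n)%N.

Lemma measurable_append n : measurable_fun [set: S * S] (append n).
Proof.
apply: measurable_pathP => i; rewrite /append; case: (i < n)%N.
- exact: (measurableT_comp (measurable_eval i) measurable_fst).
- exact: (measurableT_comp (measurable_eval (i - n)%N) measurable_snd).
Qed.

(** Gluing the first [n] entries of a sequence to an independent copy gives the
same law again: this is how independence enters all the estimates. *)
Lemma iid_law_append mu n : iid_law mu ->
  forall B, measurable B -> (mu \x mu)%E (append n @^-1` B) = mu B.
Proof.
move=> h B mB.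
apply: (@path_measure_unique (pushforward_measure (mu \x mu)%E (measurable_append n)) mu) => //.
  rewrite /= /pushforward preimage_setT -setXTT product_measure1E//.
  apply: (@le_lt_trans _ _ (1 * 1)%E); last by rewrite mule1 ltry.
  by apply: lee_pmul => //; exact: probability_le1.
move=> m A mA /=; rewrite iid_law_box// /pushforward.
pose A1 i := if (i < m)%N then A i else setT.
have mA1 i : measurable (A1 i) by rewrite /A1; case: ifP.
have -> : append n @^-1` box m A = box n A1 `*` box (m - n) (fun i => A (n + i)%N).
  apply/seteqP; split=> [[z z'] hz|[z z'] [hz hz'] i im].
    split=> /= i ilt; first by rewrite /A1; case: ifP => // im; have := hz _ im; rewrite /append ilt.
    have /hz : (n + i < m)%N by rewrite addnC -ltn_subRL; move: ilt; rewrite ltn_subRL addnC ltn_subRL addnC.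
    by rewrite /append ltnNge leq_addr/= addKn.
  rewrite /append; case: ifPn => [ilt|]; first by have := hz i ilt; rewrite /A1 im.
  rewrite -leqNgt => ni; have := hz' (i - n)%N; rewrite subnKC//; apply.
  by rewrite ltn_sub2r// (leq_ltn_trans ni im).
rewrite product_measure1E; [|exact: measurable_box|exact: measurable_box].
rewrite [LHS](_ : _ = (\prod_(i < n) nu (A1 i)) * (\prod_(i < m - n) nu (A (n + i)%N)))%E; last first.
  by congr (_ * _)%E; exact: iid_law_box.
rewrite -(big_mkord xpredT (fun i => nu (A1 i))) -(big_mkord xpredT (fun i => nu (A (n + i)%N))).
rewrite -(big_mkord xpredT (fun i => nu (A i))).
have [mn|nm] := leqP m n.
  have -> : (m - n = 0)%N by apply/eqP; rewrite subn_eq0.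
  rewrite [X in (_ * X)%E]big_geq// mule1 (big_cat_nat (n := m))//=.
  rewrite [X in (_ * X)%E]big1_seq ?mule1.
    rewrite big_nat_cond [RHS]big_nat_cond; apply: eq_bigr => i /andP[/andP[_ im] _].
    by rewrite /A1 im.
  move=> i /=; rewrite mem_index_iota => /andP[mi _].
  by rewrite /A1 ltnNge mi/= probability_setT.
rewrite [RHS](big_cat_nat (n := n))//=; last exact: ltnW.
congr (_ * _)%E.
  rewrite big_nat_cond [RHS]big_nat_cond; apply: eq_bigr => i /andP[/andP[_ iln] _].
  by rewrite /A1 (ltn_trans iln nm).
rewrite -[X in index_iota X m]add0n big_addn.
by apply: eq_bigr => i _; rewrite addnC.
Qed.


End path_space_theory.

(** * Integrals of bounded measurable functions *)

Section bounded_measurable.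
Context {R : realType} {d : measure_display} {T : measurableType d}.
Implicit Types (f g : T -> R) (P : {measure set T -> \bar R}).

Definition bdd_measurable f :=
  measurable_fun [set: T] f /\ exists M, forall x, `|f x| <= M.

Lemma bdd_measurable_cst c : bdd_measurable (cst c).
Proof. by split; [exact: measurable_cst|exists `|c|]. Qed.

Lemma bdd_measurable_indic A : measurable A -> bdd_measurable \1_A.
Proof.
move=> mA; split; first exact: measurable_indic.
by exists 1 => x; rewrite indicE normr_nat lern1 leq_b1.
Qed.

Lemma bdd_measurableD f g :
  bdd_measurable f -> bdd_measurable g -> bdd_measurable (fun x => f x + g x).
Proof.
move=> [mf [M fM]] [mg [N gN]]; split; first exact: measurable_funD.
by exists (M + N) => x; rewrite (le_trans (ler_normD _ _))// lerD.
Qed.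

Lemma bdd_measurableN f : bdd_measurable f -> bdd_measurable (fun x => - f x).
Proof.
move=> [mf [M fM]]; split; first exact: measurableT_comp.
by exists M => x; rewrite normrN.
Qed.

Lemma bdd_measurableB f g :
  bdd_measurable f -> bdd_measurable g -> bdd_measurable (fun x => f x - g x).
Proof. by move=> bf bg; apply: bdd_measurableD => //; exact: bdd_measurableN. Qed.

Lemma bdd_measurableM f g :
  bdd_measurable f -> bdd_measurable g -> bdd_measurable (fun x => f x * g x).
Proof.
move=> [mf [M fM]] [mg [N gN]]; split; first exact: measurable_funM.
by exists (M * N) => x; rewrite normrM ler_pM.
Qed.

Lemma bdd_measurableX f n : bdd_measurable f -> bdd_measurable (fun x => f x ^+ n).
Proof.
move=> bf; elim: n => [|n IH]; first exact: bdd_measurable_cst.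
by under eq_fun do rewrite exprS; exact: bdd_measurableM.
Qed.

Lemma bdd_measurable_sum (I : Type) (s : seq I) (f : I -> T -> R) :
  (forall i, bdd_measurable (f i)) -> bdd_measurable (fun x => \sum_(i <- s) f i x).
Proof.
move=> bf; elim: s => [|i s IH].
  by under eq_fun do rewrite big_nil; exact: bdd_measurable_cst.
by under eq_fun do rewrite big_cons; exact: bdd_measurableD.
Qed.

Lemma bdd_measurable_prod (I : Type) (s : seq I) (f : I -> T -> R) :
  (forall i, bdd_measurable (f i)) -> bdd_measurable (fun x => \prod_(i <- s) f i x).
Proof.
move=> bf; elim: s => [|i s IH].
  by under eq_fun do rewrite big_nil; exact: bdd_measurable_cst.
by under eq_fun do rewrite big_cons; exact: bdd_measurableM.
Qed.

Variable (P : probability T R).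

Lemma bdd_measurable_integrable f : bdd_measurable f -> P.-integrable setT (EFin \o f).
Proof.
move=> [mf [M fM]]; apply: measurable_bounded_integrable => //.
  by rewrite [X in (X < _)%E](probability_setT P) ltry.
exists M; split; first exact: num_real.
by move=> x Mx t _; apply: (le_trans (fM t)); exact: ltW.
Qed.
Hint Resolve bdd_measurable_integrable : core.

Lemma expect_cst c : \int[P]_x (c : R) = c.
Proof. by rewrite Rintegral_cst// [X in fine X](probability_setT P) mulr1. Qed.

Lemma expectD f g : bdd_measurable f -> bdd_measurable g ->
  \int[P]_x (f x + g x) = \int[P]_x f x + \int[P]_x g x.
Proof. by move=> bf bg; rewrite RintegralD//; exact: bdd_measurable_integrable. Qed.

Lemma expectB f g : bdd_measurable f -> bdd_measurable g ->
  \int[P]_x (f x - g x) = \int[P]_x f x - \int[P]_x g x.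
Proof. by move=> bf bg; rewrite RintegralB//; exact: bdd_measurable_integrable. Qed.

Lemma expectZ c f : bdd_measurable f -> \int[P]_x (c * f x) = c * \int[P]_x f x.
Proof. by move=> bf; rewrite RintegralZl//; exact: bdd_measurable_integrable. Qed.

Lemma expect_sum (I : Type) (s : seq I) (f : I -> T -> R) :
  (forall i, bdd_measurable (f i)) ->
  \int[P]_x (\sum_(i <- s) f i x) = \sum_(i <- s) \int[P]_x f i x.
Proof.
move=> bf; elim: s => [|i s IH].
  by rewrite big_nil; under eq_Rintegral do rewrite big_nil; rewrite expect_cst.
rewrite big_cons -IH -expectD//; first by apply: eq_Rintegral => x _; rewrite big_cons.
exact: bdd_measurable_sum.
Qed.

Lemma le_expect f g : bdd_measurable f -> bdd_measurable g ->
  (forall x, f x <= g x) -> \int[P]_x f x <= \int[P]_x g x.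
Proof. by move=> bf bg fg; apply: le_Rintegral => //; exact: bdd_measurable_integrable. Qed.

Lemma expect_ge0 f : (forall x, 0 <= f x) -> 0 <= \int[P]_x f x.
Proof. by move=> f0; exact: Rintegral_ge0. Qed.

Lemma norm_expect_le f M : bdd_measurable f -> (forall x, `|f x| <= M) ->
  `|\int[P]_x f x| <= M.
Proof.
move=> bf fM; rewrite ler_norml; apply/andP; split.
  rewrite -[leLHS]expect_cst; apply: le_expect => //; first exact: bdd_measurable_cst.
  by move=> x; have := fM x; rewrite ler_norml => /andP[].
rewrite -[leRHS]expect_cst; apply: le_expect => //; first exact: bdd_measurable_cst.
by move=> x; have := fM x; rewrite ler_norml => /andP[].
Qed.

Lemma expect_indic A : measurable A -> \int[P]_x \1_A x = fine (P A).
Proof. by move=> mA; rewrite /Rintegral integral_indic// setIT. Qed.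

Lemma EFin_expect f : bdd_measurable f ->
  (\int[P]_x f x)%:E = (\int[P]_x (f x)%:E)%E.
Proof.
by move=> bf; rewrite /Rintegral fineK//; apply: integrable_fin_num => //; exact: bdd_measurable_integrable.
Qed.


End bounded_measurable.

Section bounded_transfer.
Context {R : realType} {d1 d2 : measure_display}
  {T1 : measurableType d1} {T2 : measurableType d2}.

Lemma bdd_measurable_comp (h : T1 -> T2) (f : T2 -> R) :
  measurable_fun [set: T1] h -> bdd_measurable f -> bdd_measurable (fun x => f (h x)).
Proof.
by move=> mh [mf [M fM]]; split; [exact: measurableT_comp|exists M => x; exact: fM].
Qed.

Lemma expect_pushforward (P1 : probability T1 R) (P2 : probability T2 R)
    (h : T1 -> T2) (f : T2 -> R) :
  measurable_fun [set: T1] h -> (forall A, measurable A -> P1 (h @^-1` A) = P2 A) ->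
  bdd_measurable f -> \int[P2]_x f x = \int[P1]_x f (h x).
Proof.
move=> mh hP bf; rewrite /Rintegral; congr fine.
rewrite (eq_measure_integral (pushforward_measure P1 mh)); last first.
  by move=> A mA _; rewrite /= /pushforward hP.
rewrite [LHS](integral_pushforward mh)//; first by apply/measurable_EFinP; case: bf.
apply: (@bdd_measurable_integrable _ _ _ P1 (f \o h)); exact: bdd_measurable_comp.
Qed.

End bounded_transfer.

Section bounded_fubini.
Context {R : realType} {d1 d2 : measure_display}
  {T1 : measurableType d1} {T2 : measurableType d2}.
Variables (P1 : probability T1 R) (P2 : probability T2 R).

Lemma product_probability_setT : (P1 \x P2)%E [set: T1 * T2] = 1%E.
Proof.
rewrite -setXTT product_measure1E//.
by rewrite [X in (X * _)%E](probability_setT P1) [X in (_ * X)%E](probability_setT P2) mule1.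
Qed.

Lemma bdd_measurable_integrable_prod (f : T1 * T2 -> R) : bdd_measurable f ->
  (P1 \x P2)%E.-integrable setT (EFin \o f).
Proof.
move=> [mf [M fM]]; apply: measurable_bounded_integrable => //.
  by rewrite [X in (X < _)%E]product_probability_setT ltry.
exists M; split; first exact: num_real.
by move=> x Mx t _; apply: (le_trans (fM t)); exact: ltW.
Qed.

Lemma bdd_measurable_pair (f : T1 * T2 -> R) x :
  bdd_measurable f -> bdd_measurable (fun y => f (x, y)).
Proof. exact: (bdd_measurable_comp (pair1_measurable x)). Qed.

Lemma bdd_measurable_expect (f : T1 * T2 -> R) :
  bdd_measurable f -> bdd_measurable (fun x => \int[P2]_y f (x, y)).
Proof.
move=> bf; have [mf [M fM]] := bf; split; last first.
  exists M => x; apply: norm_expect_le => //; exact: bdd_measurable_pair.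
apply: measurableT_comp => //.
exact: measurable_fubini_F (bdd_measurable_integrable_prod bf).
Qed.

Lemma expect_fubini (f : T1 * T2 -> R) : bdd_measurable f ->
  \int[(P1 \x P2)%E]_p f p = \int[P1]_x \int[P2]_y f (x, y).
Proof.
move=> bf; rewrite /Rintegral; congr fine.
rewrite -(integral12_prod_meas1 (bdd_measurable_integrable_prod bf)).
apply: eq_integral => x _; rewrite /fubini_F/= EFin_expect//.
exact: bdd_measurable_pair.
Qed.

End bounded_fubini.

Section path_expectation.
Context {d : measure_display} {T : measurableType d} {R : realType}.
Variables (nu : probability T R) (mu : probability (path_space T) R).
Hypothesis iid_mu : iid_law nu mu.

Lemma iid_law_eval i A : measurable A ->
  mu ((fun z : path_space T => z i) @^-1` A) = nu A.
Proof.
move=> mA; have := @iid_mu [:: i] (fun=> A) isT (fun=> mA).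
rewrite big_seq1 => <-; congr (mu _).
by apply/seteqP; split=> z /= h; [move=> j; rewrite inE => /eqP ->|apply: (h i); rewrite inE].
Qed.

Lemma bdd_measurable_eval (f : T -> R) i :
  bdd_measurable f -> bdd_measurable (fun z : path_space T => f (z i)).
Proof. exact: (bdd_measurable_comp (measurable_eval i)). Qed.

Lemma expect_eval (f : T -> R) i : bdd_measurable f ->
  \int[mu]_z f (z i) = \int[nu]_t f t.
Proof.
by move=> bf; rewrite (expect_pushforward (P1 := mu) (measurable_eval i) _ bf)//; exact: iid_law_eval.
Qed.

Lemma bdd_measurable_append n (f : path_space T -> R) :
  bdd_measurable f -> bdd_measurable (fun p => f (append n p)).
Proof. exact: (bdd_measurable_comp (measurable_append n)). Qed.

Lemma expect_append n (f : path_space T -> R) : bdd_measurable f ->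
  \int[mu]_z f z = \int[mu]_z \int[mu]_z' f (append n (z, z')).
Proof.
move=> bf; rewrite -(expect_fubini mu mu (bdd_measurable_append n bf)) /Rintegral; congr fine.
rewrite (eq_measure_integral (pushforward_measure (mu \x mu)%E (measurable_append n))); last first.
  by move=> A mA _; rewrite /= /pushforward (iid_law_append n iid_mu).
rewrite [LHS](integral_pushforward (measurable_append n))//.
  by apply/measurable_EFinP; case: bf.
exact: (bdd_measurable_integrable_prod mu mu (bdd_measurable_append n bf)).
Qed.

Lemma expect_prod n (f : T -> R) : bdd_measurable f ->
  \int[mu]_z \prod_(i < n) f (z i) = (\int[nu]_t f t) ^+ n.
Proof.
move=> bf; elim: n => [|n IH].
  by under eq_Rintegral do rewrite big_ord0; rewrite expect_cst.
have bp m : bdd_measurable (fun z : path_space T => \prod_(i < m) f (z i)).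
  by apply: bdd_measurable_prod => i; exact: bdd_measurable_eval.
rewrite (expect_append 1)//.
have E z z' : \prod_(i < n.+1) f (append 1 (z, z') i) = f (z 0%N) * \prod_(i < n) f (z' i).
  by rewrite big_ord_recl; congr (_ * _); apply: eq_bigr => i _; rewrite /append/= subn1.
under eq_Rintegral do under eq_Rintegral do rewrite E.
under eq_Rintegral do rewrite expectZ// IH mulrC.
rewrite expectZ; last exact: bdd_measurable_eval.
by rewrite expect_eval// mulrC exprS.
Qed.

Lemma expect_sum_sqr n (f : T -> R) : bdd_measurable f -> \int[nu]_t f t = 0 ->
  \int[mu]_z (\sum_(i < n) f (z i)) ^+ 2 = n%:R * \int[nu]_t f t ^+ 2.
Proof.
move=> bf f0; elim: n => [|n IH].
  by under eq_Rintegral do rewrite big_ord0 expr0n/=; rewrite expect_cst mul0r.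
have bs m : bdd_measurable (fun z : path_space T => \sum_(i < m) f (z i)).
  by apply: bdd_measurable_sum => i; exact: bdd_measurable_eval.
have bs2 m := bdd_measurableX 2 (bs m).
have bf0 := bdd_measurable_eval 0 bf; have bf2 := bdd_measurableX 2 bf0.
have s0 m : \int[mu]_z (\sum_(i < m) f (z i)) = 0.
  rewrite expect_sum; last by move=> i; exact: bdd_measurable_eval.
  by rewrite big1// => i _; rewrite expect_eval.
rewrite (expect_append 1)//.
have E z z' : (\sum_(i < n.+1) f (append 1 (z, z') i)) ^+ 2 =
    (f (z 0%N)) ^+ 2 + (2 * f (z 0%N) * (\sum_(i < n) f (z' i)) + (\sum_(i < n) f (z' i)) ^+ 2).
  rewrite big_ord_recl/= {1}/append/=.
  under eq_bigr do rewrite {1}/append/= subn1/=.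
  by ring.
under eq_Rintegral do under eq_Rintegral do rewrite E.
under eq_Rintegral => z _.
  rewrite expectD; [|exact: bdd_measurable_cst|]; last first.
    by apply: bdd_measurableD => //; apply: bdd_measurableM => //; exact: bdd_measurable_cst.
  rewrite expect_cst expectD//; last by apply: bdd_measurableM => //; exact: bdd_measurable_cst.
  rewrite expectZ// s0 mulr0 add0r IH.
  over.
rewrite expectD//; last exact: bdd_measurable_cst.
rewrite expect_cst (expect_eval 0 (bdd_measurableX 2 bf)).
by rewrite -[n.+1]addn1 natrD; ring.
Qed.

End path_expectation.

(** * Symmetrization *)

Section symmetrization.
Context {d : measure_display} {T : measurableType d} {R : realType}.
Variables (nu : probability T R) (mu : probability (path_space T) R).
Hypothesis iid_mu : iid_law nu mu.

Lemma expect_rexp (d' : measure_display) (X : measurableType d')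
    (P : probability X R) n (f : seq bool -> X -> R) :
  (forall s, bdd_measurable (f s)) ->
  bdd_measurable (fun x => rexp n (f^~ x)) /\
  \int[P]_x rexp n (f^~ x) = rexp n (fun s => \int[P]_x f s x).
Proof.
elim: n f => [|n IH] f bf /=; first by split => //; exact: bf.
have [b1 e1] := IH (fun s => f (true :: s)) (fun s => bf _).
have [b2 e2] := IH (fun s => f (false :: s)) (fun s => bf _).
rewrite -e1 -e2; split.
  by apply: bdd_measurableM; [exact: bdd_measurableD|exact: bdd_measurable_cst].
under eq_Rintegral do rewrite mulrC.
rewrite expectZ; last exact: bdd_measurableD.
by rewrite expectD// mulrC.
Qed.

Variables (phi : nat -> T -> R) (psi : T -> R) (tau v l : R) (n : nat).
Hypothesis mphi : forall k, measurable_fun [set: T] (phi k).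
Hypothesis mpsi : measurable_fun [set: T] psi.
Hypothesis phi_psi : forall k t, `|phi k t| <= `|psi t|.
Hypothesis tau0 : 0 < tau.
Hypothesis psi_tau : forall t, `|psi t| <= tau.
Hypothesis psi_v : \int[nu]_t psi t ^+ 2 <= v.

Let bpsi : bdd_measurable psi.
Proof. by split => //; exists tau. Qed.

Let bphi k : bdd_measurable (phi k).
Proof. by split => //; exists tau => x; exact: le_trans (psi_tau _). Qed.

Definition energy (z : path_space T) := \sum_(i < n) psi (z i) ^+ 2.

Lemma bdd_measurable_energy : bdd_measurable energy.
Proof.
apply: bdd_measurable_sum => i; apply: (bdd_measurable_eval i (f := fun t => psi t ^+ 2)).
exact: bdd_measurableX.
Qed.

Lemma measurable_gt (f : path_space T -> R) (c : R) : bdd_measurable f ->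
  measurable [set z | c < f z].
Proof.
move=> [mf _]; rewrite -[X in measurable X]setTI.
have -> : [set z | c < f z] = f @^-1` `]c, +oo[%classic.
  by apply/seteqP; split=> z /=; rewrite in_itv/= andbT.
exact: mf.
Qed.

Lemma energy_tail :
  fine (mu [set z | l < energy z]) <= expR ((n%:R * v - l / 2) / tau ^+ 2).
Proof.
pose g t := expR (psi t ^+ 2 / (2 * tau ^+ 2)).
have t2 : 0 < tau ^+ 2 by rewrite exprn_gt0.
have psi2 t : psi t ^+ 2 <= tau ^+ 2.
  by rewrite -real_normK ?num_real// lerXn2r// nnegrE// ltW.
have bg : bdd_measurable g.
  split.
    apply: measurableT_comp => //; apply: measurable_funM => //.
    exact: measurable_funX.
  exists (expR (2^-1)) => t; rewrite ger0_norm ?expR_ge0// ler_expR.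
  by rewrite ler_pdivrMr ?mulr_gt0// mulrA mulVf// mul1r.
have g1 t : g t <= 1 + psi t ^+ 2 / tau ^+ 2.
  have : psi t ^+ 2 / (2 * tau ^+ 2) <= 2^-1.
    by rewrite ler_pdivrMr ?mulr_gt0// mulrA mulVf// mul1r.
  have : 0 <= psi t ^+ 2 / (2 * tau ^+ 2) by rewrite divr_ge0 ?sqr_ge0// mulr_ge0// ltW.
  have -> : psi t ^+ 2 / tau ^+ 2 = 2 * (psi t ^+ 2 / (2 * tau ^+ 2)).
    by field; rewrite gt_eqF.
  rewrite /g; move: (psi t ^+ 2 / _) => x x0 x2.
  have : expR x <= (1 - x)^-1.
    rewrite -[X in X <= _]invrK lef_pV2 ?posrE ?invr_gt0 ?expR_gt0//; last by lra.
    by rewrite -expRN; exact: expR_ge1Dx.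
  move=> /le_trans; apply; rewrite -[leLHS]mul1r ler_pdivrMr; last by lra.
  by nra.
have Eg : \int[nu]_t g t <= expR (v / tau ^+ 2).
  apply: le_trans (expR_ge1Dx _).
  apply: (@le_trans _ _ (\int[nu]_t (1 + (tau ^+ 2)^-1 * psi t ^+ 2))).
    apply: le_expect => //.
      apply: bdd_measurableD; first exact: bdd_measurable_cst.
      by apply: bdd_measurableM; [exact: bdd_measurable_cst|exact: bdd_measurableX].
    by move=> t; rewrite mulrC; exact: g1.
  rewrite expectD; [|exact: bdd_measurable_cst|]; last first.
    by apply: bdd_measurableM; [exact: bdd_measurable_cst|exact: bdd_measurableX].
  rewrite expect_cst expectZ; last exact: bdd_measurableX.
  by rewrite lerD2l mulrC ler_pM2r ?invr_gt0.
have b1 := measurable_gt l bdd_measurable_energy.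
rewrite -expect_indic//.
apply: (@le_trans _ _ (\int[mu]_z (expR (- (l / (2 * tau ^+ 2))) * \prod_(i < n) g (z i)))).
  apply: le_expect; first exact: bdd_measurable_indic.
    apply: bdd_measurableM; first exact: bdd_measurable_cst.
    by apply: bdd_measurable_prod => i; exact: bdd_measurable_eval.
  move=> z; rewrite -expR_sum -expRD indicE.
  case: (boolP (_ \in _)) => [/set_mem/= lW|_]; last exact: expR_ge0.
  rewrite -[leLHS]expR0 ler_expR -mulr_suml addrC -mulrBl divr_ge0//.
    by rewrite subr_ge0 ltW.
  by rewrite mulr_ge0// ltW.
rewrite expectZ; last by apply: bdd_measurable_prod => i; exact: bdd_measurable_eval.
rewrite (expect_prod iid_mu)//.
apply: (@le_trans _ _ (expR (- (l / (2 * tau ^+ 2))) * expR (v / tau ^+ 2) ^+ n)).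
  rewrite ler_pM2l ?expR_gt0// lerXn2r// ?nnegrE ?expR_ge0//.
  by apply: expect_ge0 => t; exact: expR_ge0.
rewrite -expRM_natl -expRD ler_expR le_eqVlt; apply/orP; left; apply/eqP.
by field; rewrite gt_eqF.
Qed.

Definition centered_sum k m (z : path_space T) :=
  \sum_(i < m) (phi k (z i) - \int[nu]_t phi k t).

Lemma bdd_measurable_centered_sum k m : bdd_measurable (centered_sum k m).
Proof.
apply: bdd_measurable_sum => i.
apply: (bdd_measurable_eval i (f := fun t => phi k t - \int[nu]_t phi k t)).
by apply: bdd_measurableB => //; exact: bdd_measurable_cst.
Qed.

Lemma centered_sum_chebyshev k m t : 0 < t -> (m <= n)%N ->
  fine (mu [set z | t < `|centered_sum k m z|]) <= n%:R * v / t ^+ 2.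
Proof.
move=> t0 mn; have bS := bdd_measurable_centered_sum k m.
have bS' : bdd_measurable (fun z => `|centered_sum k m z|).
  have [mS [M SM]] := bS; split; first exact: measurableT_comp.
  by exists M => x; rewrite normr_id.
pose f t := phi k t - \int[nu]_t phi k t.
have bf : bdd_measurable f by apply: bdd_measurableB => //; exact: bdd_measurable_cst.
rewrite -expect_indic; last exact: measurable_gt.
rewrite ler_pdivlMr ?exprn_gt0// mulrC -expectZ; last first.
  by apply: bdd_measurable_indic; exact: measurable_gt.
apply: (@le_trans _ _ (\int[mu]_z centered_sum k m z ^+ 2)).
  apply: le_expect.
  - apply: bdd_measurableM; first exact: bdd_measurable_cst.
    by apply: bdd_measurable_indic; exact: measurable_gt.
  - exact: bdd_measurableX.
  - move=> z; rewrite indicE; case: (boolP (_ \in _)) => [/set_mem/= tS|_].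
      by rewrite mulr1 -[leRHS]real_normK ?num_real// lerXn2r ?nnegrE// ltW.
    by rewrite mulr0 sqr_ge0.
rewrite (expect_sum_sqr iid_mu m bf); last first.
  by rewrite expectB// ?expect_cst ?subrr//; exact: bdd_measurable_cst.
apply: (@le_trans _ _ (m%:R * v)).
  rewrite ler_wpM2l//; apply: le_trans psi_v.
  set e := \int[nu]_t phi k t.
  apply: (@le_trans _ _ (\int[nu]_t phi k t ^+ 2 - e ^+ 2)).
    rewrite (_ : (\int[nu]_t f t ^+ 2) = \int[nu]_t (phi k t ^+ 2 - (2 * e * phi k t - e ^+ 2))); last first.
      by apply: eq_Rintegral => t' _; rewrite /f -/e; ring.
    have be : bdd_measurable (fun t => 2 * e * phi k t).
      by apply: bdd_measurableM => //; exact: bdd_measurable_cst.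
    rewrite expectB; [|exact: bdd_measurableX|]; last first.
      by apply: bdd_measurableB => //; exact: bdd_measurable_cst.
    rewrite expectB//; last exact: bdd_measurable_cst.
    by rewrite expect_cst expectZ// -/e; lra.
  apply: (@le_trans _ _ (\int[nu]_t phi k t ^+ 2)); first by rewrite gerBl sqr_ge0.
  apply: le_expect; [exact: bdd_measurableX|exact: bdd_measurableX|].
  move=> t'; rewrite -[leLHS]real_normK ?num_real// -[leRHS]real_normK ?num_real//.
  by rewrite lerXn2r ?nnegrE.
rewrite ler_wpM2r ?ler_nat//.
by apply: le_trans psi_v; apply: expect_ge0 => t'; exact: sqr_ge0.
Qed.

Definition swap (s : seq bool) (i : nat) : nat :=
  if (i < n)%N then (if nth false s i then n + i else i)%N
  else if (i < n + n)%N then (if nth false s (i - n) then i - n else i)%N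
  else i.

Lemma swapK s : cancel (swap s) (swap s).
Proof.
move=> i; rewrite /swap.
case: (ltnP i n) => [iltn|ni].
  case si: (nth false s i); last by rewrite ?iltn ?si.
  by rewrite ltnNge leq_addr/= ltn_add2l iltn addKn si.
case: (ltnP i (n + n)) => [i2n|n2i]; last by rewrite ltnNge ni/= ltnNge n2i.
case si: (nth false s (i - n)); last by rewrite ltnNge ni/= i2n si.
have -> : (i - n < n)%N by rewrite ltn_subLR.
by rewrite si subnKC.
Qed.

Definition symmetrized (s : seq bool) t : set (path_space T) :=
  [set w | exists k m, (m <= n)%N /\
     t < `|signed_sum s (fun i => phi k (w i) - phi k (w (n + i)%N)) m|].

Lemma reindex_swap_symmetrized s t :
  reindex (swap s) @^-1` symmetrized [::] t = symmetrized s t.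
Proof.
have E w k m : (m <= n)%N ->
    signed_sum [::] (fun i => phi k (reindex (swap s) w i) - phi k (reindex (swap s) w (n + i)%N)) m =
    signed_sum s (fun i => phi k (w i) - phi k (w (n + i)%N)) m.
  move=> mn; apply: eq_bigr => i _; rewrite nth_nil expr0 mul1r /reindex /swap.
  have iltn : (i < n)%N by exact: leq_trans (ltn_ord i) mn.
  rewrite iltn ltnNge leq_addr/= ltn_add2l iltn addKn.
  by case: nth; rewrite ?expr1 ?expr0 ?mul1r// mulN1r opprB.
apply/seteqP; split=> w [k [m [mn]]] h; exists k, m; split => //; first by rewrite -E.
by rewrite E.
Qed.

Lemma measurable_symmetrized s t : measurable (symmetrized s t).
Proof.
have -> : symmetrized s t = \bigcup_k \bigcup_(m in [set m | (m <= n)%N])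
    [set w | t < `|signed_sum s (fun i => phi k (w i) - phi k (w (n + i)%N)) m|].
  apply/seteqP; split=> w /=; first by move=> [k [m [mn h]]]; exists k => //; exists m.
  by move=> [k _ [m mn h]]; exists k, m.
apply: bigcupT_measurable => k; apply: bigcup_measurable => m _.
have : bdd_measurable (fun w : path_space T => signed_sum s (fun i => phi k (w i) - phi k (w (n + i)%N)) m).
  apply: bdd_measurable_sum => i; apply: bdd_measurableM; first exact: bdd_measurable_cst.
  by apply: bdd_measurableB; exact: bdd_measurable_eval.
move=> [mS [M SM]]; apply: measurable_gt; split; first exact: measurableT_comp.
by exists M => x; rewrite normr_id.
Qed.

Definition large_deviation t : set (path_space T) :=
  [set z | exists k m, (m <= n)%N /\ t < `|centered_sum k m z|].

Lemma measurable_large_deviation t : measurable (large_deviation t).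
Proof.
have -> : large_deviation t = \bigcup_k \bigcup_(m in [set m | (m <= n)%N])
    [set w | t < `|centered_sum k m w|].
  apply/seteqP; split=> w /=; first by move=> [k [m [mn h]]]; exists k => //; exists m.
  by move=> [k _ [m mn h]]; exists k, m.
apply: bigcupT_measurable => k; apply: bigcup_measurable => m _.
have [mS [M SM]] := bdd_measurable_centered_sum k m.
apply: measurable_gt; split; first exact: measurableT_comp.
by exists M => x; rewrite normr_id.
Qed.

(** Entries [n, ..., 2 n - 1] serve as the ghost sample. *)
Lemma large_deviation_le_symmetrized t : 0 < t -> 8 * (n%:R * v) <= t ^+ 2 ->
  fine (mu (large_deviation t)) <= 2 * fine (mu (symmetrized [::] (t / 2))).
Proof.
move=> t0 tv; have mL := measurable_large_deviation t.
have mS := measurable_symmetrized [::] (t / 2).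
have bL := bdd_measurable_indic (R := R) mL; have bS := bdd_measurable_indic (R := R) mS.
rewrite -!expect_indic// (expect_append iid_mu n bS) -expectZ; last first.
  exact: bdd_measurable_expect (bdd_measurable_append n bS).
apply: le_expect => //.
  apply: bdd_measurableM; first exact: bdd_measurable_cst.
  exact: bdd_measurable_expect (bdd_measurable_append n bS).
move=> z; rewrite [leLHS]indicE; case: (boolP (z \in _)); last first.
  by move=> _; rewrite mulr_ge0//; apply: expect_ge0 => w; rewrite indicE.
move=> /set_mem[k [m [mn tS]]].
have t20 : 0 < t / 2 by rewrite divr_gt0.
have /= := centered_sum_chebyshev k t20 mn.
set G := [set z | _] => hG.
have mG : measurable G.
  have [mS' [M SM]] := bdd_measurable_centered_sum k m.
  apply: measurable_gt; split; first exact: measurableT_comp.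
  by exists M => x; rewrite normr_id.
have hG2 : fine (mu G) <= 2^-1.
  apply: (le_trans hG); rewrite ler_pdivrMr ?exprn_gt0//.
  have -> : (t / 2) ^+ 2 = t ^+ 2 / 4 by field.
  by lra.
rewrite -[leLHS](@mulVf _ 2)// mulrC ler_pM2l//.
apply: (@le_trans _ _ (\int[mu]_w (1 - \1_G w))).
  rewrite expectB; [|exact: bdd_measurable_cst|exact: bdd_measurable_indic].
  by rewrite expect_cst expect_indic//; lra.
apply: le_expect.
- by apply: bdd_measurableB; [exact: bdd_measurable_cst|exact: bdd_measurable_indic].
- exact: bdd_measurable_pair (bdd_measurable_append n bS).
- move=> w; rewrite !indicE; case: (boolP (w \in G)) => [_|/negP wG].
    by rewrite subrr.
  rewrite mem_set ?subr0//; exists k, m; split => //.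
  have wG' : `|centered_sum k m w| <= t / 2.
    by rewrite leNgt; apply/negP => h; apply: wG; rewrite inE.
  have -> : signed_sum [::] (fun i => phi k (append n (z, w) i) -
      phi k (append n (z, w) (n + i)%N)) m = centered_sum k m z - centered_sum k m w.
    rewrite /signed_sum /centered_sum -sumrB; apply: eq_bigr => i _.
    rewrite nth_nil expr0 mul1r /append (leq_trans (ltn_ord i) mn) ltnNge leq_addr/= addKn.
    by ring.
  rewrite (lt_le_trans _ (lerB_dist _ _))// ltrBrDr.
  by apply: le_lt_trans tS; lra.
Qed.

Variables (A A' u : R).
Hypothesis A1 : 1 <= A.
Hypothesis u1 : 1 <= u.
Hypothesis l0 : 0 < l.
Hypothesis l_large : n%:R * v <= l.
Hypothesis rademacher_bound : forall z : nat -> T,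
  rprob n [set s | exists m k, (m <= n)%N /\
     A * Num.sqrt (\sum_(i < n) psi (z i) ^+ 2) * u <
       `|signed_sum s (fun i => phi k (z i)) m|] <= A' * expR (- u ^+ 2).

Lemma symmetrized_tail :
  fine (mu (symmetrized [::] (2 * A * Num.sqrt l * u))) <=
  2 * (A' * expR (- u ^+ 2)) + 2 * expR ((n%:R * v - l / 2) / tau ^+ 2).
Proof.
set t := 2 * A * Num.sqrt l * u.
pose f s : path_space T -> R := \1_(symmetrized s t).
have bf s : bdd_measurable (f s).
  by apply: bdd_measurable_indic; exact: measurable_symmetrized.
have [brf Erf] := expect_rexp mu n bf.
have -> : fine (mu (symmetrized [::] t)) = rexp n (fun s => \int[mu]_w f s w).
  rewrite -[LHS](rexp_cst n); congr (rexp n _); apply/funext => s.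
  rewrite /f expect_indic; last exact: measurable_symmetrized.
  rewrite -(reindex_swap_symmetrized s); congr fine; symmetry.
  by apply: (iid_law_reindex (swapK s) iid_mu); exact: measurable_symmetrized.
rewrite -Erf.
have mW := measurable_gt l bdd_measurable_energy.
set W := [set z | l < energy z].
have mW' : measurable (reindex (addn n) @^-1` W).
  by rewrite -[X in measurable X]setTI; exact: measurable_reindex.
apply: (@le_trans _ _ (\int[mu]_w (2 * (A' * expR (- u ^+ 2)) + (\1_W w + \1_(reindex (addn n) @^-1` W) w)))).
  apply: le_expect => //.
    apply: bdd_measurableD; first exact: bdd_measurable_cst.
    by apply: bdd_measurableD; exact: bdd_measurable_indic.
  move=> w.
  have A'0 : 0 <= A' * expR (- u ^+ 2).
    apply: le_trans (rademacher_bound w); rewrite -(rexp_cst n 0).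
    by apply: le_rexp => s; rewrite indicE.
  have i0 (X : set (path_space T)) x : 0 <= \1_X x :> R by rewrite indicE.
  have [wW|wW] := boolP (w \in W).
    have -> : \1_W w = 1 :> R by rewrite indicE wW.
    apply: (@le_trans _ _ 1); last by have := i0 (reindex (addn n) @^-1` W) w; lra.
    by rewrite -(rexp_cst n 1); apply: le_rexp => s; rewrite /f indicE lern1 leq_b1.
  have [wW'|wW'] := boolP (w \in reindex (addn n) @^-1` W).
    have -> : \1_(reindex (addn n) @^-1` W) w = 1 :> R by rewrite indicE wW'.
    apply: (@le_trans _ _ 1); last by have := i0 W w; lra.
    by rewrite -(rexp_cst n 1); apply: le_rexp => s; rewrite /f indicE lern1 leq_b1.
  rewrite mulr2n mulrDl mul1r.
  apply: (@le_trans _ _ (A' * expR (- u ^+ 2) + A' * expR (- u ^+ 2))); last first.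
    by have := i0 W w; have := i0 (reindex (addn n) @^-1` W) w; lra.
  apply: (le_trans _ (lerD (rademacher_bound w) (rademacher_bound (fun i => w (n + i)%N)))).
  rewrite -rexpD; apply: le_rexp => s; rewrite /f !indicE.
  have bound (z : nat -> T) : ~ (l < \sum_(i < n) psi (z i) ^+ 2) ->
      A * Num.sqrt (\sum_(i < n) psi (z i) ^+ 2) * u <= t / 2.
    move/negP; rewrite -leNgt => zl; have -> : t / 2 = A * Num.sqrt l * u by rewrite /t; field.
    rewrite ler_wpM2r ?(le_trans ler01)// ler_wpM2l ?(le_trans ler01)//.
    exact: ler_wsqrtr.
  have B1 := bound w ltac:(move=> h; apply: (negP wW); exact: mem_set).
  have B2 := bound (fun i => w (n + i)%N) ltac:(move=> h; apply: (negP wW'); exact: mem_set).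
  case: (boolP (w \in _)) => [/set_mem[k [m [mn]]]|_]; last by rewrite -natrD.
  have -> : signed_sum s (fun i => phi k (w i) - phi k (w (n + i)%N)) m =
    signed_sum s (fun i => phi k (w i)) m - signed_sum s (fun i => phi k (w (n + i)%N)) m.
    by rewrite signed_sumD signed_sumN.
  set a := signed_sum s _ m; set b := signed_sum s _ m => tab.
  have [at2|at2] := ltP (t / 2) `|a|.
    rewrite [X in _ <= (nat_of_bool X)%:R + _](_ : _ = true) ?lerDl//; apply: mem_set.
    by exists m, k; split => //; exact: le_lt_trans at2.
  rewrite [X in _ <= _ + (nat_of_bool X)%:R](_ : _ = true) ?lerDr//; apply: mem_set.
  exists m, k; split => //; apply: (le_lt_trans B2).
  have := ler_normB a b; rewrite -/b; lra.
rewrite expectD; [|exact: bdd_measurable_cst|]; last by apply: bdd_measurableD; exact: bdd_measurable_indic.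
rewrite expect_cst lerD2l expectD; [|exact: bdd_measurable_indic..].
rewrite !expect_indic//.
have -> : fine (mu (reindex (addn n) @^-1` W)) = fine (mu W).
  by congr fine; apply: (@iid_law_reindex _ _ _ _ _ _ (subn^~ n) _ iid_mu) => // i; rewrite addKn.
by rewrite mulr2n mulrDl mul1r lerD// energy_tail.
Qed.

(** A maximal inequality for the partial sums, uniform over the class: the
sub-Gaussian term comes from the Rademacher average given the sample, the other
one from the event that the sample has more energy than [l]. *)
Lemma large_deviation_tail :
  fine (mu (large_deviation (4 * A * Num.sqrt l * u))) <=
  4 * (A' * expR (- u ^+ 2)) + 4 * expR ((n%:R * v - l / 2) / tau ^+ 2).
Proof.
have sl : 0 < Num.sqrt l by rewrite sqrtr_gt0.
have A0 : 0 < A by exact: lt_le_trans A1.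
have u0 : 0 < u by exact: lt_le_trans u1.
apply: (le_trans (@large_deviation_le_symmetrized _ _ _)).
- by rewrite !mulr_gt0.
- rewrite !exprMn sqr_sqrtr ?(ltW l0)//.
  have : 1 <= A ^+ 2 by rewrite exprn_ege1.
  have : 1 <= u ^+ 2 by rewrite exprn_ege1.
  move: (A ^+ 2) (u ^+ 2) => a b b1 a1.
  have : 1 <= a * b by rewrite mulr_ege1.
  move=> ab; apply: (@le_trans _ _ (8 * l)); first by rewrite ler_pM2l.
  have -> : 4 ^+ 2 * a * l * b = 16 * l * (a * b) by ring.
  by have l0' := l0; apply: (@le_trans _ _ (16 * l)); [lra|rewrite ler_peMr//; lra].
- have -> : 4 * A * Num.sqrt l * u / 2 = 2 * A * Num.sqrt l * u by field.
  have := symmetrized_tail; lra.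
Qed.

End symmetrization.

(** * The zero-one law for exchangeable events *)

Section completion.
Context {d : measure_display} {T : measurableType d} {R : realType}.
Variable P : probability T R.

(** Membership in the [P]-completion of the sigma-algebra. *)
Definition cmeasurable (A : set T) := exists B1 B2,
  [/\ measurable B1, measurable B2, B1 `<=` A, A `<=` B2 & P (B2 `\` B1) = 0%E].

Lemma measurable_cmeasurable A : measurable A -> cmeasurable A.
Proof. by move=> mA; exists A, A; split => //; rewrite setDv measure0. Qed.

Lemma cmeasurableC A : cmeasurable A -> cmeasurable (~` A).
Proof.
move=> [B1 [B2 [m1 m2 B1A AB2 P0]]]; exists (~` B2), (~` B1).
split; [exact: measurableC|exact: measurableC|exact: subsetC|exact: subsetC|].
by rewrite setDE setCK setIC -setDE.
Qed.

Lemma cmeasurable_bigcup (A : nat -> set T) :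
  (forall n, cmeasurable (A n)) -> cmeasurable (\bigcup_n A n).
Proof.
move=> /choice[B1 /choice[B2 h]]; exists (\bigcup_n B1 n), (\bigcup_n B2 n).
have m1 n : measurable (B1 n) by have [] := h n.
have m2 n : measurable (B2 n) by have [] := h n.
split; [exact: bigcupT_measurable|exact: bigcupT_measurable|..].
- by apply: subset_bigcup => n _; have [] := h n.
- by apply: subset_bigcup => n _; have [] := h n.
have : P.-negligible (\bigcup_n (B2 n `\` B1 n)).
  apply: negligible_bigcup => n; exists (B2 n `\` B1 n); split => //.
    exact: measurableD.
  by have [] := h n.
move=> [N [mN N0 sN]]; apply/eqP; rewrite eq_le measure_ge0 andbT -N0.
apply: le_measure; rewrite ?inE//.
  by apply: measurableD; exact: bigcupT_measurable.
apply: subset_trans sN => x [[n _ B2x] nB1]; exists n => //; split => // B1x.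
by apply: nB1; exists n.
Qed.

Lemma cmeasurable_bigcap (A : nat -> set T) :
  (forall n, cmeasurable (A n)) -> cmeasurable (\bigcap_n A n).
Proof.
move=> mA; rewrite -[X in cmeasurable X]setCK setC_bigcap.
by apply: cmeasurableC; apply: cmeasurable_bigcup => n; exact: cmeasurableC.
Qed.

End completion.

Section zero_one.
Context {d : measure_display} {T : measurableType d} {R : realType}.
Variables (nu : probability T R) (mu : probability (path_space T) R).
Hypothesis iid_mu : iid_law nu mu.
Local Notation S := (path_space T).

(** Averaging over [j]: the frequencies of [A] among the coordinates [n + j]
concentrate at [nu A], so an event that correlates equally with all of them is
uncorrelated with each. *)
Lemma equal_correlation_independent (C : set S) n (A : set T) :
  measurable C -> measurable A ->
  (forall j, mu (C `&` [set z | A (z (n + j)%N)]) = mu (C `&` [set z | A (z n)])) ->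
  fine (mu (C `&` [set z | A (z n)])) = fine (mu C) * fine (nu A).
Proof.
move=> mC mA eqC; pose f t : R := \1_A t - fine (nu A).
have bA := bdd_measurable_indic (R := R) mA.
have bf : bdd_measurable f by apply: bdd_measurableB => //; exact: bdd_measurable_cst.
have f0 : \int[nu]_t f t = 0.
  by rewrite expectB// ?expect_cst ?expect_indic ?subrr//; exact: bdd_measurable_cst.
have nuA01 : 0 <= fine (nu A) <= 1.
  by rewrite fine_ge0//= -lee_fin fineK ?probability_le1// fin_num_measure.
have f1 t : f t ^+ 2 <= 1.
  rewrite /f indicE; case: (t \in A) => /=; move: nuA01 => /andP[]; nra.
pose a := fine (mu (C `&` [set z | A (z n)])) - fine (mu C) * fine (nu A).
suff : a = 0 by move=> /eqP; rewrite subr_eq0 => /eqP.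
have bC := bdd_measurable_indic (R := R) mC.
have bfj j : bdd_measurable (fun z : S => f (z (n + j)%N)) by exact: bdd_measurable_eval.
have Ea j : \int[mu]_z (\1_C z * f (z (n + j)%N)) = a.
  have mAj : measurable ([set z | A (z (n + j)%N)] : set S).
    by rewrite -[X in measurable X]setTI; exact: measurable_eval.
  rewrite (_ : (\int[mu]_z _) = \int[mu]_z (\1_(C `&` [set z : S | A (z (n + j)%N)]) z - fine (nu A) * \1_C z)).
    rewrite expectB; [|by apply: bdd_measurable_indic; exact: measurableI|]; last first.
      by apply: bdd_measurableM => //; exact: bdd_measurable_cst.
    rewrite expectZ// !expect_indic//; last exact: measurableI.
    by rewrite eqC mulrC.
  apply: eq_Rintegral => z _; rewrite /f mulrBr [X in _ = _ - X]mulrC.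
  by rewrite !indicE in_setI -mulnb natrM.
have bound M : (0 < M)%N -> `|a| <= M%:R^-1.
  move=> M0; have M0' : 0 < M%:R :> R by rewrite ltr0n.
  pose N := (M * M)%N.
  have bS : bdd_measurable (fun z : S => \sum_(j < N) f (z (n + j)%N)) by exact: bdd_measurable_sum.
  have ES : \int[mu]_z (\1_C z * \sum_(j < N) f (z (n + j)%N)) = N%:R * a.
    under eq_Rintegral do rewrite mulr_sumr.
    rewrite expect_sum; last by move=> j; exact: bdd_measurableM.
    by under eq_bigr do rewrite Ea; rewrite sumr_const card_ord mulr_natl.
  have E2 : \int[mu]_z (\sum_(j < N) f (z (n + j)%N)) ^+ 2 <= N%:R.
    have bS0 : bdd_measurable (fun z : S => (\sum_(j < N) f (z j)) ^+ 2).
      apply: bdd_measurableX; apply: bdd_measurable_sum => j; exact: bdd_measurable_eval.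
    rewrite -(@expect_pushforward _ _ _ _ _ mu mu (reindex (addn n)) _ _ _ bS0).
    - rewrite (expect_sum_sqr iid_mu)// -[leRHS]mulr1 ler_wpM2l//.
      rewrite -[leRHS](expect_cst nu); apply: le_expect => //; first exact: bdd_measurableX.
      exact: bdd_measurable_cst.
    - exact: measurable_reindex.
    - by move=> B mB; apply: (@iid_law_reindex _ _ _ _ _ _ (subn^~ n) _ iid_mu) => // i; rewrite addKn.
  have : N%:R * `|a| <= M%:R.
    rewrite -[N%:R]ger0_norm// -normrM -ES.
    have key z : `|\1_C z * \sum_(j < N) f (z (n + j)%N)| <=
        2^-1 * (M%:R + M%:R^-1 * (\sum_(j < N) f (z (n + j)%N)) ^+ 2).
      have le1 : `|\1_C z| <= 1 :> R by rewrite indicE normr_nat lern1 leq_b1.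
      rewrite normrM; apply: (@le_trans _ _ `|\sum_(j < N) f (z (n + j)%N)|).
        by rewrite ler_piMl.
      rewrite -[X in _ * (_ + _ * X)]real_normK ?num_real//.
      move: `|_| (normr_ge0 (\sum_(j < N) f (z (n + j)%N))) => s s0.
      have -> : 2^-1 * (M%:R + M%:R^-1 * s ^+ 2) = s + 2^-1 * M%:R^-1 * (M%:R - s) ^+ 2.
        by field; rewrite gt_eqF.
      by rewrite lerDl mulr_ge0 ?sqr_ge0// mulr_ge0// invr_ge0 ltW.
    have bR : bdd_measurable (fun z : S => 2^-1 * (M%:R + M%:R^-1 * (\sum_(j < N) f (z (n + j)%N)) ^+ 2)).
      apply: bdd_measurableM; first exact: bdd_measurable_cst.
      apply: bdd_measurableD; first exact: bdd_measurable_cst.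
      by apply: bdd_measurableM; [exact: bdd_measurable_cst|exact: bdd_measurableX].
    apply: (@le_trans _ _ (\int[mu]_z (2^-1 * (M%:R + M%:R^-1 * (\sum_(j < N) f (z (n + j)%N)) ^+ 2)))).
      have b1 : bdd_measurable (fun z : S => \1_C z * \sum_(j < N) f (z (n + j)%N)) by exact: bdd_measurableM.
      rewrite ler_norml lerNl -mulN1r -expectZ//; apply/andP; split.
        apply: le_expect => //; first by apply: bdd_measurableM => //; exact: bdd_measurable_cst.
        by move=> z; rewrite mulN1r lerNl; have := key z; rewrite ler_norml => /andP[].
      by apply: le_expect => // z; have := key z; rewrite ler_norml => /andP[].
    rewrite expectZ; last first.
      apply: bdd_measurableD; first exact: bdd_measurable_cst.
      by apply: bdd_measurableM; [exact: bdd_measurable_cst|exact: bdd_measurableX].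
    rewrite expectD; [|exact: bdd_measurable_cst|]; last first.
      by apply: bdd_measurableM; [exact: bdd_measurable_cst|exact: bdd_measurableX].
    rewrite expect_cst expectZ; last exact: bdd_measurableX.
    have : M%:R^-1 * (\int[mu]_z (\sum_(j < N) f (z (n + j)%N)) ^+ 2) <= M%:R.
      by rewrite mulrC ler_pdivrMr// -natrM.
    lra.
  rewrite /N natrM -mulrA -[leRHS]mulr1 ler_pM2l// => h.
  by rewrite -div1r ler_pdivlMr// mulrC.
apply/eqP; rewrite -normr_le0 leNgt; apply/negP => a0.
have := bound (Num.trunc `|a|^-1).+1 isT; rewrite leNgt => /negP; apply.
rewrite invf_plt ?posrE//.
exact: truncnS_gt.
Qed.

Definition transposition n j i :=
  if i == n then (n + j)%N else if i == (n + j)%N then n else i.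

Lemma transpositionK n j : cancel (transposition n j) (transposition n j).
Proof.
move=> i; rewrite /transposition.
case: (eqVneq i n) => [->|iN].
  by rewrite eqxx; case: eqVneq => // ->.
case: (eqVneq i (n + j)%N) => [->|iNj]; first by rewrite eqxx.
by rewrite (negbTE iN) (negbTE iNj).
Qed.

Definition exchangeable_set (A : set S) := forall s, cancel s s ->
  (exists N, forall i, (N <= i)%N -> s i = i) -> reindex s @^-1` A = A.

Lemma measureI_null_diff (C D X : set S) : measurable C -> measurable D ->
  measurable X -> mu (C `\` D) = 0%E -> mu (D `\` C) = 0%E ->
  mu (C `&` X) = mu (D `&` X).
Proof.
move=> mC mD mX.
suff le C' D' : measurable C' -> measurable D' -> mu (C' `\` D') = 0%E ->
    (mu (C' `&` X) <= mu (D' `&` X))%E.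
  by move=> CD DC; apply/eqP; rewrite eq_le !le.
move=> mC' mD' CD; have mCD := measurableD mC' mD'; have mDX := measurableI _ _ mD' mX.
apply: (@le_trans _ _ (mu ((D' `&` X) `|` (C' `\` D')))).
  apply: le_measure; rewrite ?inE; [exact: measurableI|exact: measurableU|].
  by move=> z [Cz Xz]; have [Dz|nDz] := pselect (D' z); [left|right].
by rewrite -[leRHS]adde0 -CD; apply: measureU2.
Qed.

Lemma exchangeable_zero_one A : cmeasurable mu A -> exchangeable_set A ->
  mu.-negligible A \/ mu.-negligible (~` A).
Proof.
move=> [B1 [B [mB1 mB B1A AB B0]]] exA.
have fin X : measurable X -> mu X \is a fin_num by exact: fin_num_measure.
have ind n (E : nat -> set T) : (forall i, measurable (E i)) ->
    mu (B `&` box n E) = (mu B * mu (box n E))%E.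
  move=> mE; rewrite (iid_law_box n iid_mu mE).
  elim: n => [|n IH].
    by rewrite big_ord0 mule1; congr (mu _); apply/seteqP; split=> [z []//|z Bz]; split.
  have mbox := measurable_box n mE.
  have mC : measurable (B `&` box n E) by exact: measurableI.
  have boxS : B `&` box n.+1 E = (B `&` box n E) `&` [set z | E n (z n)].
    apply/seteqP; split=> [z [Bz h]|z [[Bz h] hn]].
      by split; [split => // i im; apply: h; exact: ltnW|apply: h].
    by split => // i; rewrite ltnS leq_eqVlt => /predU1P[->//|]; exact: h.
  have mev j : measurable ([set z | E n (z j)] : set S).
    by rewrite -[X in measurable X]setTI; exact: measurable_eval.
  rewrite boxS big_ord_recr/= muleA -IH -[LHS]fineK; last by apply: fin; exact: measurableI.
  rewrite (equal_correlation_independent mC (mE n)).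
    by rewrite EFinM !fineK ?fin// fin_num_measure.
  move=> j; pose s := transposition n j.
  have sK : cancel s s := @transpositionK n j.
  have exs : reindex s @^-1` A = A.
    apply: exA => //; exists (n + j).+1 => i ni.
    rewrite /s /transposition gtn_eqF; last by rewrite (leq_ltn_trans _ ni)// leq_addr.
    by rewrite gtn_eqF.
  have mr (D : set S) : measurable D -> measurable (reindex s @^-1` D).
    by move=> mD; rewrite -[X in measurable X]setTI; exact: measurable_reindex.
  rewrite -[RHS](iid_law_reindex sK iid_mu); last exact: measurableI.
  have -> : reindex s @^-1` (B `&` box n E `&` [set z | E n (z n)]) =
      reindex s @^-1` B `&` (box n E `&` [set z | E n (z (n + j)%N)]).
    rewrite -setIA; apply/seteqP; split=> z [Bz [bz ez]]; split=> //; split.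
    - move=> i im; have := bz i im; rewrite /reindex /s /transposition.
      by rewrite !ltn_eqF// (leq_trans im)// leq_addr.
    - by move: ez; rewrite /reindex/= /s /transposition eqxx.
    - move=> i im; have := bz i im; rewrite /reindex /s /transposition.
      by rewrite !ltn_eqF// (leq_trans im)// leq_addr.
    - by rewrite /reindex/= /s /transposition eqxx.
  rewrite -setIA; symmetry; apply: measureI_null_diff => //.
  - exact: mr.
  - exact: measurableI.
  - apply/eqP; rewrite eq_le measure_ge0 andbT -B0.
    rewrite -(iid_law_reindex sK iid_mu (measurableD mB mB1)); apply: le_measure; rewrite ?inE.
    + by apply: measurableD => //; exact: mr.
    + by apply: mr; exact: measurableD.
    + move=> z [Bz nB]; split => // B1z; apply: nB; apply: AB; rewrite -exs; exact: B1A.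
  - apply/eqP; rewrite eq_le measure_ge0 andbT -B0; apply: le_measure; rewrite ?inE.
    + by apply: measurableD => //; exact: mr.
    + exact: measurableD.
    + by move=> z [Bz nB]; split => // /B1A; rewrite -exs => /AB.
have p0 : 0 <= fine (mu B) by rewrite fine_ge0.
have BB : mu (B `&` B) = (mu B * mu B)%E.
  have := @path_measure_unique _ _ R (mrestr mu mB) (mscale (NngNum p0) mu) _ _ B mB.
  rewrite /= /mrestr /mscale/= fineK ?fin//; apply.
    by rewrite setTI ltey_eq fin.
  by move=> n E mE; rewrite setIC ind.
have {}BB : fine (mu B) = fine (mu B) * fine (mu B).
  by apply: EFin_inj; rewrite EFinM !fineK ?fin// -BB setIid.
have : fine (mu B) = 0 \/ fine (mu B) = 1.
  have /eqP : fine (mu B) * (1 - fine (mu B)) = 0 by rewrite mulrBr mulr1 -BB subrr.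
  by rewrite mulf_eq0 subr_eq0 => /orP[/eqP|/eqP]; [left|right].
move=> [B00|B11]; [left|right].
  by exists B; split => //; rewrite -[LHS]fineK ?fin// B00.
exists (~` B1); split; [exact: measurableC| |exact: subsetC].
rewrite probability_setC//.
have : (mu B <= mu (B1 `|` (B `\` B1)))%E.
  apply: le_measure; rewrite ?inE//; first by apply: measurableU => //; exact: measurableD.
  by move=> z Bz; have [|] := pselect (B1 z); [left|right].
move=> /le_trans /(_ (measureU2 _ mB1 (measurableD mB mB1))).
rewrite [X in (_ <= _ + X)%E -> _]B0 adde0 -[mu B]fineK ?fin// B11 => h.
have -> : mu B1 = 1%E by apply/eqP; rewrite eq_le h probability_le1.
by rewrite subee.
Qed.

Lemma ereal_rat_between (x y : \bar R) : (x < y)%E ->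
  exists r : rat, (x < (ratr r)%:E < y)%E.
Proof.
have real (a b : R) : a < b -> exists r : rat, a < ratr r < b.
  by move=> /rat_in_itvoo[r]; rewrite in_itv/= => h; exists r.
case: x => [x| |]; case: y => [y| |] //=; rewrite ?ltry ?ltNyr.
- by rewrite lte_fin => /real[r]; exists r; rewrite !lte_fin.
- have [r /andP[xr _]] := real x (x + 1) ltac:(by rewrite ltrDl).
  by exists r; rewrite lte_fin xr ltry.
- have [r /andP[_ xr]] := real (y - 1) y ltac:(by rewrite gtrBl).
  by exists r; rewrite lte_fin xr ltNyr.
- by exists 0; rewrite ltry ltNyr.
Qed.

Lemma limn_esup_le (u : nat -> \bar R) x k :
  (forall n, (k <= n)%N -> (u n <= x)%E) -> (limn_esup u <= x)%E.
Proof.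
move=> ux; rewrite /limn_esup /limf_esup.
apply: (@le_trans _ _ (ereal_sup (u @` [set n | (k <= n)%N]))).
  apply: ereal_inf_lbound; exists [set n | (k <= n)%N] => //.
  by exists k.
by apply: ge_ereal_sup => _ [n /= kn <-]; exact: ux.
Qed.

Lemma le_limn_esup (u : nat -> \bar R) x :
  (forall k, exists2 n, (k <= n)%N & (x < u n)%E) -> (x <= limn_esup u)%E.
Proof.
move=> ux; rewrite /limn_esup /limf_esup; apply: le_ereal_inf_tmp => _ [V [k _ kV] <-].
have [n kn xn] := ux k; apply: (le_trans (ltW xn)).
by apply: ereal_sup_ubound; exists n => //; exact: kV.
Qed.

(** A limit superior of functionals that ignore the order of the sample, up to
finitely many of them, is almost surely constant. *)
Lemma exchangeable_limn_esup_cst (D : nat -> S -> \bar R) :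
  (forall n (t : R), cmeasurable mu [set z | (t%:E < D n z)%E]) ->
  (forall s, cancel s s -> (exists N, forall i, (N <= i)%N -> s i = i) ->
     exists N, forall n, (N <= n)%N -> forall z, D n (reindex s z) = D n z) ->
  exists L : \bar R, {ae mu, forall z, limn_esup (D ^~ z) = L}.
Proof.
move=> mD exD.
pose V (q : R) := \bigcap_k \bigcup_n [set z : S | (k <= n)%N /\ (q%:E < D n z)%E].
have cV q : cmeasurable mu (V q).
  apply: cmeasurable_bigcap => k; apply: cmeasurable_bigcup => n.
  have [kn|kn] := boolP (k <= n)%N.
    rewrite (_ : mkset _ = [set z | (q%:E < D n z)%E])//.
    by apply/seteqP; split=> z // [].
  rewrite (_ : mkset _ = set0); first exact: measurable_cmeasurable.
  by apply/seteqP; split=> z // [].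
have exV q : exchangeable_set (V q).
  move=> s sK fs; have [N hN] := exD s sK fs.
  apply/seteqP; split=> z Vz k _; have [n _ [kn qn]] := Vz (maxn k N) I; exists n => //;
    move: kn; rewrite geq_max => /andP[kn Nn]; split => //.
    by rewrite -(hN n Nn).
  by rewrite hN.
pose Full q := mu.-negligible (~` V q).
pose L := ereal_sup [set q%:E | q in Full].
have aeV (r : rat) : {ae mu, forall z, (Full (ratr r) -> V (ratr r) z) /\ (~ Full (ratr r) -> ~ V (ratr r) z)}.
  have [F|nF] := pselect (Full (ratr r)).
    by apply: (negligibleS _ F) => z /=; apply: contra_not => Vz; split => // nF; case: nF.
  have : mu.-negligible (V (ratr r)).
    by have [//|F] := exchangeable_zero_one (cV (ratr r)) (@exV (ratr r)); case: nF.
  by apply: negligibleS => z /=; apply: contra_notP => nVz; split.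
exists L.
have : {ae mu, forall z, forall k : nat, if unpickle k is Some r then
   (Full (ratr r) -> V (ratr r) z) /\ (~ Full (ratr r) -> ~ V (ratr r) z) else True}.
  apply: ae_foralln => k; case: (unpickle k) => [r|]; first exact: aeV.
  exact: aeW.
apply: filterS => z hz.
have {}hz (r : rat) : (Full (ratr r) -> V (ratr r) z) /\ (~ Full (ratr r) -> ~ V (ratr r) z).
  by have := hz (pickle r); rewrite pickleK.
apply/eqP; rewrite eq_le; apply/andP; split; rewrite leNgt; apply/negP => /ereal_rat_between[r /andP[lr rl]].
- have nF : ~ Full (ratr r).
    by move=> F; move: lr; rewrite ltNge => /negP; apply; apply: ereal_sup_ubound; exists (ratr r).
  have [_ /(_ nF)] := hz r => nV.
  move: rl; rewrite ltNge => /negP; apply.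
  have [k hk] : exists k, forall n, (k <= n)%N -> (D n z <= (ratr r)%:E)%E.
    apply: contrapT => /forallNP h; apply: nV => k _.
    have /existsNP[n /not_implyP[kn /negP]] := h k; rewrite -ltNge => rn.
    by exists n.
  exact: limn_esup_le hk.
- have [_ [q Fq <-] rq] := ereal_sup_gt rl.
  have F : Full (ratr r).
    apply: negligibleS Fq; apply: subsetC => w Vw k _; have [n kn [kn' qn]] := Vw k I.
    by exists n => //; split => //; exact: lt_trans qn.
  have [/(_ F) Vz _] := hz r.
  move: lr; rewrite ltNge => /negP; apply; apply: le_limn_esup => k.
  by have [n _ [kn rn]] := Vz k I; exists n.
Qed.

End zero_one.

(** * Measurability of projections along a compact set *)

Section measurable_hull.
Context {d : measure_display} {T : measurableType d} {R : realType}.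
Variable P : probability T R.

Lemma measurable_hull (A : set T) : exists B, [/\ measurable B, A `<=` B &
  forall B', measurable B' -> A `<=` B' -> (P B <= P B')%E].
Proof.
pose V := [set x | exists B, [/\ measurable B, A `<=` B & x = P B]].
have /choice[B hB] : forall n : nat, exists B, [/\ measurable B, A `<=` B &
    (P B < ereal_inf V + n.+1%:R^-1%:E)%E].
  move=> n; have V0 : (0 <= ereal_inf V)%E.
    by apply: le_ereal_inf_tmp => _ [B [_ _ ->]]; exact: measure_ge0.
  have V1 : (ereal_inf V <= 1)%E.
    apply: ereal_inf_lbound; exists setT; split => //.
    by rewrite [RHS](probability_setT P).
  have Vfin : ereal_inf V \is a fin_num.
    by rewrite ge0_fin_numE// (le_lt_trans V1)// ltry.
  have : (ereal_inf V < ereal_inf V + n.+1%:R^-1%:E)%E.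
    by rewrite lteDl// lte_fin invr_gt0.
  by move=> /ereal_inf_lt[_ [B [mB AB ->]] h]; exists B.
have mI : measurable (\bigcap_n B n) by apply: bigcapT_measurable => n; have [] := hB n.
exists (\bigcap_n B n); split => //.
  by move=> x Ax n _; have [_ + _] := hB n; exact.
move=> B' mB' AB'; apply: (@le_trans _ _ (ereal_inf V)); last first.
  by apply: ereal_inf_lbound; exists B'.
apply/lee_addgt0Pr => e e0.
have [n ne] : exists n : nat, n.+1%:R^-1 < e.
  exists (Num.trunc e^-1); rewrite invf_plt ?posrE//; exact: truncnS_gt.
have [mBn _ PB] := hB n.
apply: (@le_trans _ _ (P (B n))).
  by apply: le_measure; rewrite ?inE// => x; exact.
apply: (le_trans (ltW PB)); apply: leeD => //; by rewrite lee_fin ltW.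
Qed.

Definition hull A := projT1 (cid (measurable_hull A)).

Lemma hullP A : [/\ measurable (hull A), A `<=` hull A &
  forall B', measurable B' -> A `<=` B' -> (P (hull A) <= P B')%E].
Proof. exact: projT2 (cid (measurable_hull A)). Qed.

Lemma hull_bigcup_lt (A : nat -> set T) (s : \bar R) :
  (forall n, A n `<=` A n.+1) -> (s < P (hull (\bigcup_n A n)))%E ->
  exists n, (s < P (hull (A n)))%E.
Proof.
move=> incA sA; apply: contrapT => /forallNP h.
have {}incA n m : (n <= m)%N -> A n `<=` A m.
  move=> /subnK <-; elim: (m - n)%N => [//|k IH]; rewrite addSn.
  exact: subset_trans (incA _).
pose B n := \bigcap_(m in [set m | (n <= m)%N]) hull (A m).
have mB n : measurable (B n).
  by apply: bigcap_measurable => [|m _]; [exists n => /=|have [] := hullP (A m)].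
have sB n : (P (B n) <= s)%E.
  apply: (@le_trans _ _ (P (hull (A n)))); last first.
    by rewrite leNgt; apply/negP; exact: h.
  have [mh _ _] := hullP (A n).
  by apply: le_measure; rewrite ?inE// => x; apply => /=.
have incB : {homo B : n m / (n <= m)%N >-> (n <= m)%O}.
  move=> n m nm; apply/subsetPset => x Bx k /= mk; apply: Bx => /=.
  exact: leq_trans mk.
have cB := nondecreasing_cvg_mu (mu := P) mB (bigcupT_measurable _ mB) incB.
have := sA; rewrite ltNge => /negP; apply.
have [mh sh hmin] := hullP (\bigcup_n A n).
apply: (@le_trans _ _ (P (\bigcup_n B n))).
  apply: hmin; first exact: bigcupT_measurable.
  move=> x [n _ Anx]; exists n => // m /= nm.
  by have [_ + _] := hullP (A m); apply; exact: incA Anx.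
rewrite -(cvg_lim _ cB)//; apply: lime_le; first by apply/cvg_ex; eexists; exact: cB.
by apply: nearW => n /=; exact: sB.
Qed.

End measurable_hull.

Section suslin.
Context {d : measure_display} {Omega : measurableType d} {E : topologicalType}.
Implicit Types (H : set (E * Omega)).

(** Sets whose sections are closed and depend on the second coordinate only
through a measurable discrete parameter. They replace the finite unions of
rectangles of the classical theory; their stability under finite unions and
intersections and the measurability of their projections are immediate. *)
Definition discrete_section H := exists (g : Omega -> nat) (F : nat -> set E),
  [/\ forall n, measurable (g @^-1` [set n]), forall n, closed (F n) &
      H = [set p | F (g p.2) p.1]].

Lemma discrete_section_closed (F : set E) :
  closed F -> discrete_section [set p | F p.1].
Proof.
move=> cF; exists (fun=> 0%N), (fun=> F); split => // n.
have [->|n0] := eqVneq n 0%N.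
  by rewrite (_ : _ @^-1` _ = setT)//; apply/seteqP; split.
rewrite (_ : _ @^-1` _ = set0)//; apply/seteqP; split=> // x /= /esym/eqP.
by rewrite (negbTE n0).
Qed.

Lemma discrete_section_measurable (A : set Omega) :
  measurable A -> discrete_section [set p | A p.2].
Proof.
move=> mA; exists (fun w => nat_of_bool (w \in A)),
  (fun n => if n == 1%N then setT else set0); split.
- case=> [|[|n]].
  + rewrite (_ : _ @^-1` _ = ~` A); first exact: measurableC.
    apply/seteqP; split=> w /=; last by move=> nA; rewrite memNset.
    by case: (boolP (w \in A)) => // /negP nA _ Aw; apply: nA; exact: mem_set.
  + rewrite (_ : _ @^-1` _ = A)//.
    apply/seteqP; split=> w /=; last by move=> Aw; rewrite mem_set.
    by case: (boolP (w \in A)) => // /set_mem.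
  + rewrite (_ : _ @^-1` _ = set0)//; apply/seteqP; split=> w //=; by case: (_ \in _).
- by move=> n; case: ifP => _; [exact: closedT|exact: closed0].
- apply/seteqP; split=> p /=; first by move=> Ap; rewrite mem_set.
  by case: (boolP (p.2 \in A)) => // /set_mem.
Qed.

Lemma discrete_section2 (op : set E -> set E -> set E) H1 H2 :
  (forall A B, closed A -> closed B -> closed (op A B)) ->
  discrete_section H1 -> discrete_section H2 ->
  discrete_section [set p | op [set c | H1 (c, p.2)] [set c | H2 (c, p.2)] p.1].
Proof.
move=> cop [g1 [F1 [m1 c1 ->]]] [g2 [F2 [m2 c2 ->]]].
exists (fun w => pickle (g1 w, g2 w)), 
  (fun n => if @pickle_inv (nat * nat)%type n is Some q then op (F1 q.1) (F2 q.2) else set0); split.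
- move=> n; case E1 : (@pickle_inv (nat * nat)%type n) => [[a b]|].
  + rewrite (_ : _ @^-1` _ = g1 @^-1` [set a] `&` g2 @^-1` [set b]); first exact: measurableI.
    have abn : pickle (a, b) = n by have := @pickle_invK (nat * nat)%type n; rewrite /oapp E1.
    apply/seteqP; split=> w /=; last by move=> [-> ->].
    by rewrite -abn => /(pcan_inj pickleK)[-> ->].
  + rewrite (_ : _ @^-1` _ = set0)//; apply/seteqP; split=> w //= wn.
    by move: E1; rewrite -wn pickleK_inv.
- move=> n; case: pickle_inv => [q|]; last exact: closed0.
  by apply: cop.
- by apply/seteqP; split=> p /=; rewrite pickleK_inv.
Qed.

Lemma discrete_sectionI H1 H2 : discrete_section H1 -> discrete_section H2 ->
  discrete_section (H1 `&` H2).
Proof.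
move=> s1 s2; have := discrete_section2 (@closedI E) s1 s2.
by congr discrete_section; apply/seteqP; split => -[].
Qed.

Lemma discrete_sectionU H1 H2 : discrete_section H1 -> discrete_section H2 ->
  discrete_section (H1 `|` H2).
Proof.
move=> s1 s2; have := discrete_section2 (@closedU E) s1 s2.
by congr discrete_section; apply/seteqP; split => -[].
Qed.

Lemma discrete_sectionT : discrete_section setT.
Proof.
by have := discrete_section_closed (@closedT E); congr discrete_section; apply/seteqP; split.
Qed.

Lemma discrete_section_forall n (H : nat -> set (E * Omega)) :
  (forall i, discrete_section (H i)) ->
  discrete_section [set p | forall i, (i < n)%N -> H i p].
Proof.
move=> sH; elim: n => [|n IH].
  by rewrite (_ : mkset _ = setT); [exact: discrete_sectionT|apply/seteqP; split].
rewrite (_ : mkset _ = [set p | forall i, (i < n)%N -> H i p] `&` H n).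
  exact: discrete_sectionI.
apply/seteqP; split=> [p h|p [h hn] i]; first by split=> [i im|]; apply: h => //; exact: ltnW.
by rewrite ltnS leq_eqVlt => /predU1P[->//|]; exact: h.
Qed.

Lemma discrete_section_exists n (H : nat -> set (E * Omega)) :
  (forall i, discrete_section (H i)) ->
  discrete_section [set p | exists2 i, (i <= n)%N & H i p].
Proof.
move=> sH; elim: n => [|n IH].
  rewrite (_ : mkset _ = H 0%N)//; apply/seteqP; split=> p /=; last by exists 0%N.
  by move=> [i]; rewrite leqn0 => /eqP ->.
rewrite (_ : mkset _ = [set p | exists2 i, (i <= n)%N & H i p] `|` H n.+1).
  exact: discrete_sectionU.
apply/seteqP; split=> p /=.
  by move=> [i]; rewrite leq_eqVlt => /predU1P[->|i_n Hi]; [right|left; exists i].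
by move=> [[i i_n Hi]|Hn]; [exists i => //; exact: leqW|exists n.+1].
Qed.

Lemma discrete_section_imply (Q : Prop) H :
  discrete_section H -> discrete_section [set p | Q -> H p].
Proof.
move=> sH; have [q|nq] := pselect Q.
  by rewrite (_ : mkset _ = H)//; apply/seteqP; split=> p //=; exact.
by rewrite (_ : mkset _ = setT); [exact: discrete_sectionT|apply/seteqP; split=> // p _ /= /nq].
Qed.

Definition suslin H := exists S : seq nat -> set (E * Omega),
  (forall s, discrete_section (S s)) /\
  H = [set p | exists sigma : nat -> nat, forall n, S (mkseq sigma n) p].

Lemma suslin_discrete_section H : discrete_section H -> suslin H.
Proof.
move=> sH; exists (fun=> H); split => //; apply/seteqP; split=> p /=.
  by move=> Hp; exists id.
by move=> [sigma /(_ 0%N)].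
Qed.

Lemma mkseqS_behead (sigma : nat -> nat) n :
  mkseq sigma n.+1 = sigma 0%N :: mkseq (fun i => sigma i.+1) n.
Proof. by rewrite /mkseq/= [iota 1 n](iotaDl 1 0) -map_comp. Qed.

Lemma suslin_bigcup (H : nat -> set (E * Omega)) :
  (forall i, suslin (H i)) -> suslin (\bigcup_i H i).
Proof.
move=> /choice[S hS].
exists (fun s => if s is i :: s' then S i s' else setT); split.
  by case=> [|i s]; [exact: discrete_sectionT|have [] := hS i].
apply/seteqP; split=> p /=.
  move=> [i _]; have [_ ->] := hS i => -[sigma hsigma].
  exists (fun k => if k is k'.+1 then sigma k' else i) => -[//|n].
  by rewrite mkseqS_behead.
move=> [sigma hsigma]; exists (sigma 0%N) => //; have [_ ->] := hS (sigma 0%N).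
by exists (fun i => sigma i.+1) => n; move: hsigma => /(_ n.+1); rewrite mkseqS_behead.
Qed.

(** One sequence [sigma] encodes countably many through a pairing of the
indices. *)
Lemma suslin_bigcap (H : nat -> set (E * Omega)) :
  (forall i, suslin (H i)) -> suslin (\bigcap_i H i).
Proof.
move=> /choice[S hS].
pose c (i j : nat) : nat := pickle (i, j).
exists (fun s => [set p | forall i, (i < size s)%N -> forall k, (k < size s)%N ->
  (forall j, (j < k)%N -> (c i j < size s)%N) ->
  S i (mkseq (fun j => nth 0%N s (c i j)) k) p]); split.
  move=> s; apply: discrete_section_forall => i; apply: discrete_section_forall => k.
  by apply: discrete_section_imply; have [] := hS i.
apply/seteqP; split=> p /=.
  move=> Hp; have /choice[sig hsig] : forall i, exists sigma : nat -> nat, forall n, S i (mkseq sigma n) p.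
    by move=> i; have := Hp i I; have [_ ->] := hS i.
  exists (fun q => if unpickle q is Some (i, j) then sig i j else 0%N) => n.
  rewrite size_mkseq => i iln k kn hk.
  have := hsig i k; congr (S i _ p); apply/eq_in_map => j.
  by rewrite mem_iota => /hk cn; rewrite nth_mkseq// pickleK.
move=> [sigma hsigma] i _; have [_ ->] := hS i.
exists (fun j => sigma (c i j)) => k.
pose n := (maxn i (maxn k (\max_(j < k) c i j))).+1.
have := hsigma n; rewrite size_mkseq => /(_ i) /(_ _ k).
have -> : (i < n)%N by rewrite ltnS leq_maxl.
have -> : (k < n)%N by rewrite ltnS !leq_max leqnn orbT.
have cn j : (j < k)%N -> (c i j < n)%N.
  move=> jk; rewrite ltnS !leq_max.
  by rewrite (@leq_bigmax _ (fun j : 'I_k => c i j) (Ordinal jk)) !orbT.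
move=> /(_ isT isT cn); congr (S i _ p); apply/eq_in_map => j.
by rewrite mem_iota => /cn jn; rewrite nth_mkseq.
Qed.

Lemma bisuslin_sigma_algebra : sigma_algebra setT [set H | suslin H /\ suslin (~` H)].
Proof.
split.
- split; apply: suslin_discrete_section; last by rewrite setC0; exact: discrete_sectionT.
  by have := discrete_section_closed (@closed0 E); congr discrete_section; apply/seteqP; split.
- by move=> H [sH sHC]; rewrite setTD; split => //=; rewrite setCK.
- move=> H sH; split => /=; first by apply: suslin_bigcup => i; have [] := sH i.
  by rewrite setC_bigcup; apply: suslin_bigcap => i; have [] := sH i.
Qed.

End suslin.

Section projection.
Context {d : measure_display} {Omega : measurableType d} {E : topologicalType}
  {R : realType}.
Variables (P : probability Omega R) (C : set E).
Hypothesis cptC : compact C.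
Implicit Types (H : set (E * Omega)).

Definition projection H : set Omega := [set w | exists2 c, C c & H (c, w)].

Lemma measurable_projection_discrete_section H :
  discrete_section H -> measurable (projection H).
Proof.
move=> [g [F [mg cF ->]]].
rewrite (_ : projection _ = \bigcup_(n in [set n | C `&` F n !=set0]) (g @^-1` [set n])).
  by apply: bigcup_measurable => n _; exact: mg.
apply/seteqP; split=> w /=; first by move=> [c Cc Fc]; exists (g w) => //; exists c.
by move=> [n [c [Cc Fc]] /= gwn]; exists c => //=; rewrite gwn.
Qed.

Lemma projection_bigcap (H : nat -> set (E * Omega)) :
  (forall n, discrete_section (H n)) -> (forall n, H n.+1 `<=` H n) ->
  projection (\bigcap_n H n) = \bigcap_n projection (H n).
Proof.
move=> sH decH; apply/seteqP; split=> w /=.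
  by move=> [c Cc Hc] n _; exists c => //; exact: Hc.
move=> pw; have /choice[c hc] : forall n, exists c, C c /\ H n (c, w).
  by move=> n; have [c Cc Hc] := pw n I; exists c.
have {}decH n m : (n <= m)%N -> H m `<=` H n.
  move=> /subnK <-; elim: (m - n)%N => [//|k IH]; rewrite addSn.
  exact: subset_trans IH.
have [x [Cx cx]] : C `&` cluster (c x @[x --> \oo]) !=set0.
  apply: cptC.
  by exists 0%N => // n _; have [] := hc n.
exists x => // n _.
have cl : closed [set e | H n (e, w)].
  by have [g [F [_ cF ->]]] := sH n; exact: (cF (g w)).
apply: cl => B nB; apply: cx => //.
exists n => // m /= nm; have [_ +] := hc m; exact: decH.
Qed.

Section capacity.
Variable S : seq nat -> set (E * Omega).
Hypothesis sS : forall s, discrete_section (S s).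

Definition bounded_branches (l : seq nat) : set (E * Omega) :=
  [set p | exists sigma : nat -> nat, (forall i, (i < size l)%N -> (sigma i <= nth 0%N l i)%N) /\
     forall n, S (mkseq sigma n) p].

Lemma bounded_branches_rcons l :
  bounded_branches l = \bigcup_m bounded_branches (rcons l m).
Proof.
apply/seteqP; split=> p /=.
  move=> [sigma [hl hS]]; exists (sigma (size l)) => //; exists sigma; split => // i.
  rewrite size_rcons ltnS leq_eqVlt nth_rcons => /predU1P[->|il]; first by rewrite ltnn eqxx.
  by rewrite il; exact: hl.
move=> [m _ [sigma [hl hS]]]; exists sigma; split => // i il.
by have := hl i; rewrite size_rcons ltnS nth_rcons il; apply; exact: ltnW.
Qed.

Lemma bounded_branches_incr l m :
  bounded_branches (rcons l m) `<=` bounded_branches (rcons l m.+1).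
Proof.
move=> p [sigma [hl hS]]; exists sigma; split => // i; have := hl i.
rewrite !size_rcons => h im; have := h im; rewrite !nth_rcons.
by case: ifP => // _; case: ifP => // _; exact: leqW.
Qed.

Fixpoint truncated_tree (m : nat -> nat) n l : set (E * Omega) :=
  if n is n'.+1 then
    S l `&` [set p | exists2 i, (i <= m (size l))%N & truncated_tree m n' (rcons l i) p]
  else S l.

Lemma discrete_section_truncated_tree m n l : discrete_section (truncated_tree m n l).
Proof.
elim: n l => [|n IH] l /=; first exact: sS.
apply: discrete_sectionI => //.
exact: (discrete_section_exists (m (size l)) (H := fun i => truncated_tree m n (rcons l i))).
Qed.

Lemma truncated_tree_decr m n l : truncated_tree m n.+1 l `<=` truncated_tree m n l.
Proof.
elim: n l => [|n IH] l p; first by case.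
by move=> [Sl [i im h]]; split => //; exists i => //; exact: IH.
Qed.

Lemma bounded_branches_truncated_tree m n :
  bounded_branches (mkseq m n) `<=` truncated_tree m n [::].
Proof.
move=> p [sigma [hl hS]].
suff : forall k j, (j + k <= n)%N -> truncated_tree m k (mkseq sigma j) p by move/(_ n 0%N); apply.
elim=> [|k IH] j jk /=; first exact: hS.
split; first exact: hS.
exists (sigma j); last by rewrite -mkseqS; apply: IH; rewrite addSnnS.
rewrite size_mkseq; have jn : (j < n)%N by apply: leq_trans jk; rewrite -addSnnS leq_addr.
by have := hl j; rewrite size_mkseq nth_mkseq// => /(_ jn).
Qed.

(** Koenig's lemma. *)
Lemma truncated_tree_branch m p : (forall n, truncated_tree m n [::] p) ->
  exists sigma : nat -> nat, forall n, S (mkseq sigma n) p.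
Proof.
pose good l := forall n, truncated_tree m n l p.
move=> good0.
have step l : good l -> exists i, good (rcons l i).
  move=> gl; apply: contrapT => /forallNP h.
  have /choice[N hN] : forall i, exists n, ~ truncated_tree m n (rcons l i) p.
    by move=> i; have /existsNP := h i.
  pose M := \max_(i < (m (size l)).+1) N i.
  have [_ [i im hi]] := gl M.+1.
  apply: (hN i).
  have NM : (N i <= M)%N.
    have im' : (i < (m (size l)).+1)%N by rewrite ltnS.
    exact: (@leq_bigmax _ (fun i : 'I_(m (size l)).+1 => N i) (Ordinal im')).
  move: hi; rewrite -(subnK NM); elim: (M - N i)%N => [//|k IH]; rewrite addSn.
  by move/truncated_tree_decr.
have /choice[nx hnx] : forall l, exists i, good l -> good (rcons l i).
  by move=> l; have [/step[i gi]|ng] := pselect (good l); [exists i|exists 0%N].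
pose L := fix L n := if n is n'.+1 then rcons (L n') (nx (L n')) else [::].
have gL n : good (L n) by elim: n => [//|n IH]; exact: hnx.
exists (fun n => nx (L n)) => n.
suff -> : mkseq (fun n => nx (L n)) n = L n by exact: (gL n 0%N).
by elim: n => [//|n IH]; rewrite mkseqS IH.
Qed.

Let pi := projection.

Lemma suslin_inner_approximation (s : \bar R) :
  (s < P (hull P (pi (bounded_branches [::]))))%E ->
  exists B, [/\ measurable B,
    B `<=` pi [set p | exists sigma : nat -> nat, forall n, S (mkseq sigma n) p] &
    (s <= P B)%E].
Proof.
move=> s0.
have /choice[nx hnx] : forall l, exists i, (s < P (hull P (pi (bounded_branches l))))%E ->
    (s < P (hull P (pi (bounded_branches (rcons l i)))))%E.
  move=> l; have [sl|nsl] := pselect (s < P (hull P (pi (bounded_branches l))))%E; last by exists 0%N.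
  pose A m := pi (bounded_branches (rcons l m)).
  have incA n : A n `<=` A n.+1.
    by move=> w [c Cc bc]; exists c => //; exact: bounded_branches_incr bc.
  have sA : (s < P (hull P (\bigcup_n A n)))%E.
    have -> : \bigcup_n A n = pi (bounded_branches l); last exact: sl.
    rewrite [in RHS]bounded_branches_rcons; apply/seteqP; split=> w /=.
      by move=> [n _ [c Cc bc]]; exists c => //; exists n.
    by move=> [c Cc [n _ bc]]; exists n => //; exists c.
  by have [n hn] := hull_bigcup_lt incA sA; exists n.
pose L := fix L n := if n is n'.+1 then rcons (L n') (nx (L n')) else [::].
have sL n : (s < P (hull P (pi (bounded_branches (L n)))))%E.
  by elim: n => [//|n IH]; exact: hnx.
pose m n := nx (L n).
have Lm n : L n = mkseq m n by elim: n => [//|n IH]; rewrite mkseqS -IH.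
pose T n := truncated_tree m n [::].
have mT n : measurable (pi (T n)).
  by apply: measurable_projection_discrete_section; exact: discrete_section_truncated_tree.
exists (\bigcap_n pi (T n)); split; first exact: bigcapT_measurable.
  rewrite -projection_bigcap.
  - move=> w [c Cc Tc]; exists c => //; apply: (truncated_tree_branch (m := m)) => n.
    exact: Tc.
  - by move=> n; exact: discrete_section_truncated_tree.
  - by move=> n; exact: truncated_tree_decr.
have decT : {homo (fun n => pi (T n)) : n m / (n <= m)%N >-> (m <= n)%O}.
  move=> i j ij; apply/subsetPset => w [c Cc Tc]; exists c => //.
  move: ij Tc => /subnK <-; elim: (j - i)%N => [//|k IH]; rewrite addSn.
  by move/truncated_tree_decr.
have cT := nonincreasing_cvg_mu (mu := P) (_ : (P (pi (T 0%N)) < +oo)%E) mT (bigcapT_measurable mT) decT.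
rewrite -(cvg_lim _ (cT _))//; last first.
  by rewrite (le_lt_trans (probability_le1 _ _))// ltry.
apply: lime_ge.
  by apply/cvg_ex; eexists; apply: cT; rewrite (le_lt_trans (probability_le1 _ _))// ltry.
apply: nearW => n /=; apply: (le_trans (ltW (sL n))).
have [_ _ hmin] := hullP P (pi (bounded_branches (L n))).
apply: hmin => // w [c Cc bc]; exists c => //.
by rewrite Lm in bc; exact: bounded_branches_truncated_tree bc.
Qed.

End capacity.

Lemma suslin_projection H : suslin H -> cmeasurable P (projection H).
Proof.
move=> [S [sS HE]].
have bb0 : bounded_branches S [::] = H.
  by rewrite HE; apply/seteqP; split=> p [sigma]; [move=> [_ h]; exists sigma|move=> h; exists sigma].
have := suslin_inner_approximation sS; rewrite bb0 -HE.
set X := projection H => approx.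
have [mh sh _] := hullP P X.
have PhE : P (hull P X) \is a fin_num by exact: fin_num_measure.
have /choice[B hB] : forall n : nat, exists B, [/\ measurable B, B `<=` X &
    (P (hull P X) - n.+1%:R^-1%:E <= P B)%E].
  move=> n; apply: approx.
  by rewrite lteBlDr// lteDl// lte_fin invr_gt0.
have mB : measurable (\bigcup_n B n) by apply: bigcupT_measurable => n; have [] := hB n.
exists (\bigcup_n B n), (hull P X); split => //.
  by move=> x [n _ Bx]; have [_ + _] := hB n; exact.
have sB : \bigcup_n B n `<=` hull P X.
  by move=> x [n _ Bx]; have [_ BX _] := hB n; exact/sh/BX.
have -> : P (hull P X `\` \bigcup_n B n) = (P (hull P X) - P (\bigcup_n B n))%E.
  by rewrite measureD// ?(setIidr sB)// -ge0_fin_numE.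
suff -> : P (hull P X) = P (\bigcup_n B n) by rewrite subee// fin_num_measure.
apply/eqP; rewrite eq_le [X in _ && X]le_measure ?inE// andbT.
apply/lee_addgt0Pr => e e0.
have [n ne] : exists n : nat, n.+1%:R^-1 < e.
  exists (Num.trunc e^-1); rewrite invf_plt ?posrE//; exact: truncnS_gt.
have [mBn _ PB] := hB n.
rewrite leeBlDr// in PB; apply: (le_trans PB); apply: leeD; last by rewrite lee_fin ltW.
by apply: le_measure; rewrite ?inE// => x Bx; exists n.
Qed.

End projection.

Section projection_rV.
Context {d : measure_display} {Omega : measurableType d} {R : realType} {n : nat}.
Variables (P : probability Omega R) (C : set ('rV[R]_n * R)%type).
Hypothesis cptC : compact C.

Let E : topologicalType := ('rV[R]_n * R)%type.

Lemma bisuslin_ge (u : E -> R) (a : R) : continuous u ->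
  suslin [set p : E * Omega | a <= u p.1] /\ suslin (~` [set p : E * Omega | a <= u p.1]).
Proof.
move=> cu; split.
  apply: suslin_discrete_section.
  apply: (@discrete_section_closed _ _ _ [set c | a <= u c]).
  by apply: (closed_comp (f := u) (D := [set x | a <= x])) => [c _|]; [exact: cu|exact: closed_ge].
rewrite (_ : ~` _ = \bigcup_k [set p : E * Omega | u p.1 <= a - k.+1%:R^-1]).
  apply: suslin_bigcup => k; apply: suslin_discrete_section.
  apply: (@discrete_section_closed _ _ _ [set c | u c <= a - k.+1%:R^-1]).
  by apply: (closed_comp (f := u) (D := [set x | x <= a - k.+1%:R^-1])) => [c _|]; [exact: cu|exact: closed_le].
apply/seteqP; split=> p /=.
  move/negP; rewrite -ltNge => ua; exists (Num.trunc (a - u p.1)^-1) => //=.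
  rewrite lerBrDr -lerBrDl ltW// invf_plt ?posrE ?subr_gt0//; exact: truncnS_gt.
move=> [k _ uk]; apply/negP; rewrite -ltNge (le_lt_trans uk)// gtrBl invr_gt0 ltr0n.
by [].
Qed.

(** Choquet's capacity argument: the projection of a Borel set along a compact
set of parameters is measurable for the completion of every probability. *)
Theorem measurable_projection (B : set (('rV[R]_n * R) * Omega)) :
  measurable B -> cmeasurable P [set w | exists2 c, C c & B (c, w)].
Proof.
move=> mB; apply: (@suslin_projection _ _ _ _ P C cptC).
pose G : set (set (E * Omega)) := [set H | suslin H /\ suslin (~` H)].
have sG : sigma_algebra setT G := bisuslin_sigma_algebra.
have mG (u : E -> R) : continuous u ->
    measurable_fun [set: g_sigma_algebraType G] (fun p : E * Omega => u p.1).
  move=> cu; apply: (measurability _ (RGenCInfty.measurableE R)).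
  move=> _ [_ [a ->] <-]; rewrite setTI; apply: sub_sigma_algebra.
  rewrite (_ : _ @^-1` _ = [set p : E * Omega | a <= u p.1]).
    exact: bisuslin_ge.
  by apply/seteqP; split=> p /=; rewrite in_itv/= andbT.
have mid : measurable_fun [set: g_sigma_algebraType G]
    (fun p : g_sigma_algebraType G => p : ('rV[R]_n * R) * Omega).
  apply/measurable_fun_pairP; split; [apply/measurable_fun_pairP; split|].
  - apply: measurable_rVP => i; apply: (mG (fun c => c.1 ord0 i)) => c.
    apply: (@continuous_comp _ _ _ fst (fun v : 'rV[R]_n => v ord0 i)); first exact: cvg_fst.
    exact: coord_continuous.
  - by apply: (mG snd) => c; exact: cvg_snd.
  - move=> _ A mA; rewrite setTI; apply: sub_sigma_algebra; split; apply: suslin_discrete_section.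
      exact: discrete_section_measurable.
    by apply: (@discrete_section_measurable _ _ _ (~` A)); exact: measurableC.
have := mid measurableT B mB; rewrite setTI => GB.
have [] : G B by exact: (@smallest_sub _ (sigma_algebra setT) G G sG (@subset_refl _ G) B GB).
by [].
Qed.

End projection_rV.

(** * Rademacher sums weighted by the kernel class *)

Section discrete_probability.
Context {d : measure_display} {T : measurableType d} {R : realType}.

Lemma discrete_probability n (w : nat -> R) (x : nat -> T) :
  (forall i, 0 <= w i) -> \sum_(i < n) w i = 1 ->
  exists Q : probability T R, forall f : T -> \bar R,
    measurable_fun [set: T] f -> (forall t, (0 <= f t)%E) ->
    (\int[Q]_t f t = \sum_(i < n) (w i)%:E * f (x i))%E.
Proof.
move=> w0 w1.
pose M : {measure set T -> \bar R} := msum (fun i => mscale (NngNum (w0 i)) \d_(x i)) n.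
have MT : M setT = 1%E.
  rewrite /= /msum/=; under eq_bigr do rewrite /mscale/= diracT mule1.
  by rewrite sumEFin w1.
exists (mnormalize M (dirac point)) => f mf f0.
rewrite (eq_measure_integral M); last first.
  move=> A mA _; rewrite /= /mnormalize [M _]MT/=.
  by rewrite onee_eq0/= invr1 mule1.
rewrite ge0_integral_measure_sum//; apply: eq_bigr => i _.
by rewrite ge0_integral_mscale// integral_dirac// diracT mul1e.
Qed.

Lemma Lnorm2_lt (Q : {measure set T -> \bar R}) (g : T -> R) (e : R) :
  ('N[Q]_2%:E[EFin \o g] < e%:E)%E -> (\int[Q]_t (g t ^+ 2)%:E < (e ^+ 2)%:E)%E.
Proof.
move=> ge; have N0 := Lnorm_ge0 Q 2%:E (EFin \o g).
have two0 : (2 : R) != 0 by rewrite pnatr_eq0.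
have := poweR_Lnorm Q (EFin \o g) two0.
under [X in _ = X -> _]eq_integral.
  move=> t _; rewrite /= powR_mulrn// real_normK ?num_real//; over.
move=> <-; move: N0 ge; case: ('N[Q]_2%:E[_]%E) => [r| |]//.
rewrite !lee_fin !lte_fin => r0 re.
by rewrite powR_mulrn// ltrXn2r.
Qed.

End discrete_probability.

Section kernel_rademacher.
Context {R : realType} {d : nat}.
Variable K : 'rV[R]_d -> R.
Hypotheses (mK : measurable_fun [set: 'rV[R]_d] K)
  (hK2 : kernel_cond_ii K) (hK3 : kernel_cond_iii K).
Local Notation kappa := (kernel_bound K).

Lemma kernel_le_bound y : `|K y| <= kappa.
Proof.
have le y' : (`|K y'|%:E <= sup_norm setT K)%E by apply: ereal_sup_ubound; exists y'.
rewrite -lee_fin fineK//; rewrite ge0_fin_numE//.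
by apply: le_trans (le 0); rewrite lee_fin.
Qed.

Lemma measurable_scaled_kernel x h : measurable_fun [set: 'rV[R]_d] (scaled_kernel K x h).
Proof.
apply: measurableT_comp => //; apply: measurable_rVP => i.
under eq_fun do rewrite !mxE.
apply: measurable_funM => //; apply: measurable_funB => //.
exact: measurable_coord_rV.
Qed.

Lemma kernel_rademacher : exists2 A : R, 1 <= A &
  forall n (y : nat -> R) (x : nat -> 'rV[R]_d) (u : R), 0 < kappa -> 1 <= u ->
  rprob n [set s | exists m g, [/\ (m <= n)%N, kernel_class K g &
     A * (kappa * Num.sqrt (\sum_(i < n) y i ^+ 2)) * u <
       `|signed_sum s (fun i => y i * g (x i)) m|]] <= 4 * expR (- u ^+ 2).
Proof.
have [C [nu [C0 nu0 cov]]] := hK3.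
have p1 : 1 <= (2 `^ nu : R) by rewrite -[leLHS](powRr0 2) ler_powR ?ler1n// ltW.
pose B := (C + 1) * 2 `^ nu.
have B1 : 1 <= B by rewrite mulr_ege1// lerDr ltW.
pose b : R := 80 * (1 + 2 * ln B).
have lnB0 : 0 <= ln B by exact: ln_ge0.
have b1 : 1 <= b by rewrite /b; lra.
have b0 : 0 <= b by exact: le_trans b1.
exists (2 * b + 1); first lra.
move=> n y x u kappa0 u1; set W := \sum_(i < n) y i ^+ 2.
have W0 : 0 <= W by apply: sumr_ge0 => i _; exact: sqr_ge0.
have expu : 0 <= 4 * expR (- u ^+ 2) by rewrite mulr_ge0// expR_ge0.
have [We|Wne] := eqVneq W 0.
  apply: le_trans expu; rewrite -(rexp_cst n 0); apply: le_rexp => s.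
  rewrite indicE memNset// => -[m [g [mn _]]].
  rewrite We sqrtr0 !(mulr0, mul0r) normr_gt0 => /eqP; apply.
  apply: big1 => i _; have iltn : (i < n)%N := leq_trans (ltn_ord i) mn.
  have /eqP : y i ^+ 2 = 0.
    apply/eqP; have /eqP := We; rewrite psumr_eq0; last by move=> *; exact: sqr_ge0.
    by move/allP => /(_ (Ordinal iltn)); rewrite mem_index_enum; exact.
  by rewrite sqrf_eq0 => /eqP ->; rewrite mul0r mulr0.
have {}W0 : 0 < W by rewrite lt_neqAle eq_sym Wne.
have [||Q hQ] := @discrete_probability _ 'rV[R]_d R n (fun i => y i ^+ 2 / W) x.
- by move=> i; rewrite divr_ge0 ?sqr_ge0// ltW.
- by rewrite -mulr_suml divff.
pose F : set (nat -> R) := [set v | exists2 g, kernel_class K g & v = fun i => y i * g (x i)].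
set D := kappa * Num.sqrt W.
have D0 : 0 < D by rewrite mulr_gt0// sqrtr_gt0.
have D2 : D ^+ 2 = kappa ^+ 2 * W by rewrite exprMn sqr_sqrtr// ltW.
apply: (le_trans _ (@rademacher_chaining _ B b D u n F B1 b0 _ D0 u1 _ _)).
- apply: rprob_subset => s [m [g [mn Kg h]]].
  by exists m, (fun i => y i * g (x i)); split => //; exists g.
- by rewrite -/b expr2 ler_peMr.
- move=> _ [g [x0 [h [_ ->]]] ->]; rewrite D2 mulr_sumr; apply: ler_sum => i _.
  rewrite exprMn mulrC ler_wpM2r ?sqr_ge0// -real_normK ?num_real//.
  by rewrite lerXn2r ?nnegrE ?(ltW kappa0)// kernel_le_bound.
- move=> l l0; pose e : R := 2 ^- l.
  have e01 : 0 < e < 1.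
    rewrite invr_gt0 exprn_gt0//= invf_lt1 ?exprn_gt0// exprn_egt1 ?ltr1n//.
    by rewrite -lt0n.
  have := cov e e01; set r := C * _ => Ur.
  have : (covering_number Q (kernel_class K) (kappa * e) < (r + 1)%:E)%E.
    apply: (@le_lt_trans _ _ r%:E); last by rewrite lte_fin ltrDl.
    by apply: le_trans Ur; apply: ereal_sup_ubound; exists Q.
  move=> /ereal_inf_lt[_ [N [c [mc hc]] <-]]; rewrite lte_fin => Nr.
  exists N, (fun j i => y i * c j (x i)); split.
    apply: (le_trans (ltW Nr)).
    have -> : r = C * (2 `^ nu) ^+ l.
      rewrite /r /e -powR_inv1 ?exprn_ge0// -powRrM mulN1r opprK.
      congr (C * _); rewrite -[2 ^+ l]powR_mulrn// -powRrM mulrC powRrM.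
      by rewrite powR_mulrn ?powR_ge0.
    rewrite exprMn.
    apply: (@le_trans _ _ ((C + 1) * (2 `^ nu) ^+ l)).
      by rewrite mulrDl mul1r lerD2l exprn_ege1.
    rewrite ler_wpM2r ?exprn_ge0 ?powR_ge0//.
    by rewrite -[leLHS]expr1 ler_weXn2l// lerDr ltW.
  move=> _ [g Kg ->]; have [j _ /= /Lnorm2_lt gc] := hc g Kg.
  have mg : measurable_fun setT g by have [x0 [h [_ ->]]] := Kg; exact: measurable_scaled_kernel.
  exists j; rewrite hQ in gc; last 2 first.
  + apply/measurable_EFinP; apply: measurable_funX; apply: measurable_funB => //; exact: mc.
  + by move=> t; rewrite lee_fin sqr_ge0.
  move: gc; rewrite /= sumEFin lte_fin => /ltW gc.
  have -> : (D / 2 ^+ l) ^+ 2 = W * (kappa * e) ^+ 2.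
    by rewrite -[D / _]/(D * e) (exprMn _ D) D2 (exprMn _ kappa); ring.
  apply: le_trans (ler_wpM2l (ltW W0) gc).
  rewrite mulr_sumr le_eqVlt; apply/orP; left; apply/eqP.
  by apply: eq_bigr => i _; field.
Qed.

End kernel_rademacher.

(** * Uniform deviations over dyadic blocks *)

Section borel_cantelli.
Context {d : measure_display} {T : measurableType d} {R : realType}.
Variable P : probability T R.

Lemma fine_measure_bigcup_le (I : finType) (A : I -> set T) :
  (forall i, measurable (A i)) ->
  fine (P (\bigcup_i A i)) <= \sum_i fine (P (A i)).
Proof.
move=> mA; have mU : measurable (\bigcup_i A i).
  by apply: fin_bigcup_measurable => // ; exact: finite_finset.
rewrite -expect_indic// (eq_bigr (fun i => \int[P]_x \1_(A i) x)); last first.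
  by move=> i _; rewrite expect_indic.
have bA i : bdd_measurable (\1_(A i) : T -> R) by exact: bdd_measurable_indic.
rewrite -expect_sum//; apply: le_expect.
- exact: bdd_measurable_indic.
- exact: bdd_measurable_sum.
- move=> x; rewrite indicE; case: (boolP (x \in _)) => [/set_mem[i _ Aix]|_]; last first.
    by apply: sumr_ge0 => i _; rewrite indicE.
  rewrite (bigD1 i)//= [X in _ <= X + _]indicE mem_set// lerDl.
  by apply: sumr_ge0 => k _; rewrite indicE.
Qed.

Lemma sum_inv_sqr_le n : \sum_(k < n) (k.+1%:R ^- 2) <= 2 :> R.
Proof.
suff : \sum_(k < n.+1) (k.+1%:R ^- 2) <= 2 - n.+1%:R^-1 :> R.
  rewrite big_ord_recr/= => h; apply: (@le_trans _ _ (2 - n.+1%:R^-1)); last first.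
    by rewrite gerBl invr_ge0.
  by apply: le_trans h; rewrite lerDl invr_ge0 exprn_ge0.
elim: n => [|n IH]; first by rewrite big_ord1 expr1n invr1; lra.
rewrite big_ord_recr/=; apply: (le_trans (lerD IH (lexx _))).
set m : R := n.+1%:R.
have m0 : 0 < m by rewrite ltr0n.
have -> : n.+2%:R = m + 1 by rewrite -[n.+2]addn1 natrD.
rewrite -subr_ge0.
have -> : 2 - (m + 1)^-1 - (2 - m^-1 + (m + 1) ^- 2) = (m * (m + 1) ^+ 2)^-1.
  by field; rewrite !gt_eqF// addr_gt0.
by rewrite invr_ge0 mulr_ge0 ?exprn_ge0 ?(ltW m0)// addr_ge0// ltW.
Qed.

Lemma borel_cantelli_fine (F : nat -> set T) (C : R) :
  (forall k, measurable (F k)) -> (forall n, \sum_(k < n) fine (P (F k)) <= C) ->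
  {ae P, forall x, exists k0, forall k, (k0 <= k)%N -> ~ F k x}.
Proof.
move=> mF FC; exists (lim_sup_set F); split.
- apply: bigcapT_measurable => n; apply: bigcup_measurable => k _; exact: mF.
- apply: (lim_sup_set_cvg0 mF).
  apply: (@le_lt_trans _ _ C%:E); last by rewrite ltry.
  apply: lime_le; first by apply: is_cvg_nneseries => k _ _; exact: measure_ge0.
  apply: nearW => n.
  rewrite (eq_bigr (fun k => (fine (P (F k)))%:E)); last first.
    by move=> k _; rewrite fineK// fin_num_measure.
  by rewrite sumEFin lee_fin big_mkord.
- move=> x /= /forallNP h n _; have /existsNP[k /not_implyP[nk /contrapT Fk]] := h n.
  by exists k.
Qed.

Lemma borel_cantelli_inv_sqr (F : nat -> set T) (C : R) :
  (forall k, measurable (F k)) -> (forall k, fine (P (F k)) <= C * k.+1%:R ^- 2) ->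
  {ae P, forall x, exists k0, forall k, (k0 <= k)%N -> ~ F k x}.
Proof.
move=> mF FC; have C0 : 0 <= C.
  have := FC 0%N; rewrite expr1n invr1 mulr1; apply: le_trans; exact: fine_ge0.
apply: (@borel_cantelli_fine F (C * 2) mF) => n.
apply: (@le_trans _ _ (\sum_(k < n) C * k.+1%:R ^- 2)).
  by apply: ler_sum => k _; exact: FC.
by rewrite -mulr_sumr ler_wpM2l// sum_inv_sqr_le.
Qed.

Lemma norm_lim_le (u : nat -> R) (l M : R) :
  (forall n, `|u n| <= M) -> u n @[n --> \oo] --> l -> `|l| <= M.
Proof.
move=> uM ul; have cn : `|u n| @[n --> \oo] --> `|l| by exact: cvg_norm.
rewrite -(cvg_lim _ cn)//; apply: limr_le; [exact: cvgP cn|exact: nearW].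
Qed.

Lemma bounded_convergence (f : nat -> T -> R) (g : T -> R) (M : R) :
  (forall n, measurable_fun setT (f n)) -> measurable_fun setT g ->
  (forall n x, `|f n x| <= M) -> (forall x, f n x @[n --> \oo] --> g x) ->
  \int[P]_x f n x @[n --> \oo] --> \int[P]_x g x.
Proof.
move=> mf mg fM fg.
have bg : bdd_measurable g.
  by split => //; exists M => x; apply: norm_lim_le (fg x) => n; exact: fM.
have bf n : bdd_measurable (f n) by split => //; exists M.
have h := @dominated_cvg _ _ _ P setT measurableT (fun n => EFin \o f n) (EFin \o g) (cst M%:E).
rewrite /Rintegral; apply: fine_cvg; rewrite fineK; last first.
  by apply: integrable_fin_num => //; exact: bdd_measurable_integrable.
apply: h => //.
- by move=> n; apply/measurable_EFinP.
- by move=> x _; apply: cvg_EFin; [exact: nearW|exact: fg].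
- exact: (bdd_measurable_integrable P (bdd_measurable_cst M)).
- by move=> n x _; rewrite lee_fin.
Qed.

End borel_cantelli.

Section cubes.
Context {R : realType} {d : nat}.
Hypothesis d0 : (0 < d)%N.

Definition cube (c : 'rV[R]_d) (rho : R) : set 'rV[R]_d :=
  [set y | forall i, `|y ord0 i - c ord0 i| <= rho].

Lemma measurable_cube c rho : measurable (cube c rho).
Proof.
rewrite (_ : cube c rho = \bigcap_(i in [set: 'I_d])
    ((fun y : 'rV[R]_d => y ord0 i) @^-1` [set r | `|r - c ord0 i| <= rho])).
  apply: fin_bigcap_measurable; first exact: finite_finset.
  move=> i _; rewrite -[X in measurable X]setTI; apply: measurable_coord_rV => //.
  rewrite (_ : mkset _ = `[c ord0 i - rho, c ord0 i + rho]%classic).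
    exact: measurable_itv.
  apply/seteqP; split=> r /=; rewrite in_itv/= ler_norml lerBlDl lerBrDr.
    by move=> /andP[h1 h2]; apply/andP; split; lra.
  by move=> /andP[h1 h2]; apply/andP; split; lra.
by apply/seteqP; split=> [y h i _|y h i]; [exact: h|exact: (h i I)].
Qed.

Definition root_d (h : R) : R := h `^ d%:R^-1.

Lemma root_dK h : 0 <= h -> root_d h ^+ d = h.
Proof.
move=> h0; rewrite /root_d -powR_mulrn ?powR_ge0// -powRrM mulVf ?powRr1//.
by rewrite pnatr_eq0 -lt0n.
Qed.

Lemma root_d_gt0 h : 0 < h -> 0 < root_d h.
Proof. by move=> h0; rewrite powR_gt0. Qed.

Lemma ler_root_d h h' : 0 < h -> h <= h' -> root_d h <= root_d h'.
Proof.
move=> h0 hh'; apply: ge0_ler_powR => //; rewrite ?nnegrE ?invr_ge0 ?(ltW h0)//.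
by rewrite ltW// (lt_le_trans h0).
Qed.

Lemma scaled_kernel_support (K : 'rV[R]_d -> R) x h y : kernel_support K -> 0 < h ->
  scaled_kernel K x h y != 0 -> cube x (root_d h / 2) y.
Proof.
move=> sK h0 /sK H i; have := H i; rewrite !mxE -/(root_d h).
have r0 := root_d_gt0 h0; move: (root_d h) r0 => r r0.
rewrite mulrC ler_pdivrMr// ler_pdivlMr// => /andP[h1 h2].
by rewrite ler_norml; apply/andP; split; lra.
Qed.

(** The centers form a grid of step [r] in [-D, D]^d. *)
Lemma lattice_cover (D r : R) : 0 <= D -> 0 < r <= 1 ->
  exists M (c : {ffun 'I_d -> 'I_M} -> 'rV[R]_d),
    M%:R ^+ d <= (2 * D + 1) ^+ d / r ^+ d /\
    forall x : 'rV[R]_d, (forall i, `|x ord0 i| <= D) ->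
      exists q, cube x (r / 2) `<=` cube (c q) (2 * r).
Proof.
move=> D0 /andP[r0 r1].
pose M := (Num.trunc (2 * D / r)).+1.
have q0 : 0 <= 2 * D / r by rewrite divr_ge0 ?mulr_ge0// ltW.
exists M, (fun q : {ffun 'I_d -> 'I_M} => \row_i (- D + (q i)%:R * r)); split.
  rewrite -expr_div_n lerXn2r ?nnegrE ?divr_ge0 ?(ltW r0)//; first lra.
  rewrite mulrDl mul1r /M -addn1 natrD lerD//.
    by have /andP[] := truncn_itv q0.
  by rewrite invf_ge1.
move=> x xD.
have x0 i : 0 <= (x ord0 i + D) / r.
  by rewrite divr_ge0 ?(ltW r0)//; have := xD i; rewrite ler_norml => /andP[]; lra.
have xM i : (Num.trunc ((x ord0 i + D) / r) < M)%N.
  rewrite ltnS; apply: le_truncn; rewrite ler_pM2r ?invr_gt0//.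
  by have := xD i; rewrite ler_norml => /andP[]; lra.
exists [ffun i => Ordinal (xM i)] => y xy i; rewrite !mxE ffunE/=.
have := xy i; have /andP[] := truncn_itv (x0 i).
rewrite ler_pdivlMr// ltr_pdivrMr//; move: (Num.trunc _) => k; rewrite -[k.+1%:R]natr1 mulrDl mul1r.
move: (_%:R * r) => t t1 t2; rewrite !ler_norml => /andP[y1 y2].
by apply/andP; split; lra.
Qed.

End cubes.
Arguments root_d {R} d h.

Section dyadic_blocks.
Context {R : realType} {d : nat}.
Hypothesis d0 : (0 < d)%N.
Variables (nu : probability (R * 'rV[R]_d)%type R)
  (mu : probability (path_space (R * 'rV[R]_d)%type) R).
Hypothesis iid_mu : iid_law nu mu.
Variable K : 'rV[R]_d -> R.
Hypotheses (mK : measurable_fun [set: 'rV[R]_d] K)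
  (hK2 : kernel_cond_ii K) (hK3 : kernel_cond_iii K) (hK4 : kernel_cond_iv K)
  (sK : kernel_support K).
Local Notation kappa := (kernel_bound K).
Hypothesis kappa0 : 0 < kappa.

Lemma kernel_enumeration : exists g : nat -> 'rV[R]_d -> R,
  (forall k, kernel_class K (g k)) /\ forall f, kernel_class K f ->
    exists a : nat -> nat, forall y, g (a m) y @[m --> \oo] --> f y.
Proof.
have [F0 [F0K cF0 F0d]] := hK4.
have [f0 [hf0 _]] := F0d _ (ex_intro _ 0 (ex_intro _ 1 (conj ltr01 erefl))
  : kernel_class K (scaled_kernel K 0 1)).
have /countable_injP[e einj] := cF0.
have /choice[g hg] : forall k, exists g, F0 g /\ forall g', F0 g' -> e g' = k -> g' = g.
  move=> k; have [[g [F0g ek]]|nk] := pselect (exists g, F0 g /\ e g = k).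
    by exists g; split => // g' F0g' ek'; apply: einj; rewrite ?inE// ek ek'.
  by exists (f0 0%N); split => // g' F0g' ek'; exfalso; apply: nk; exists g'.
exists g; split => [k|f Kf]; first by apply: F0K; have [] := hg k.
have [f_ [F0f_ cf]] := F0d f Kf.
exists (fun m => e (f_ m)) => y; rewrite (_ : (fun m => g (e (f_ m)) y) = f_ ^~ y)//.
apply/funext => m; have [_ h] := hg (e (f_ m)).
by rewrite -(h (f_ m)).
Qed.

Lemma block_tail : exists2 A : R, 1 <= A &
  forall (g : nat -> 'rV[R]_d -> R) (Psi : R * 'rV[R]_d -> R) (B : set 'rV[R]_d)
    (tau v l u : R) n,
  (forall k, kernel_class K (g k)) ->
  measurable_fun setT Psi -> (forall t, `|Psi t| <= tau) -> 0 < tau ->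
  measurable B -> kappa ^+ 2 * \int[nu]_t (Psi t ^+ 2 * \1_B t.2) <= v ->
  0 < l -> n%:R * v <= l -> 1 <= u ->
  fine (mu (large_deviation nu (fun k t => Psi t * \1_B t.2 * g k t.2) n (4 * A * Num.sqrt l * u)))
  <= 16 * expR (- u ^+ 2) + 4 * expR ((n%:R * v - l / 2) / (kappa * tau) ^+ 2).
Proof.
have [A A1 hA] := kernel_rademacher mK hK2 hK3.
exists A => // g Psi B tau v l u n gK mPsi Ptau tau0 mB Pv l0 nvl u1.
have mB2 : measurable_fun [set: R * 'rV[R]_d] (fun t => \1_B t.2 : R).
  by apply: (measurableT_comp (f := \1_B : 'rV[R]_d -> R)); [exact: measurable_indic|exact: measurable_snd].
have mPB := measurable_funM mPsi mB2.
have B01 y : 0 <= (\1_B y : R) <= 1 by rewrite indicE; case: (_ \in _); rewrite ?ler01 ?lexx.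
have Bsq y : (\1_B y) ^+ 2 = \1_B y :> R.
  by rewrite indicE; case: (_ \in _); rewrite /= ?expr1n ?expr0n.
pose psi t := kappa * (Psi t * \1_B t.2).
have -> : 16 * expR (- u ^+ 2) = 4 * (4 * expR (- u ^+ 2)) by rewrite mulrA -natrM.
apply: (@large_deviation_tail _ _ _ nu mu iid_mu _ psi (kappa * tau) v l n _ _ _ _ _ _ A 4 u A1 u1 l0 nvl).
- move=> k; apply: measurable_funM => //.
  have mg : measurable_fun setT (g k) by have [x [h [_ ->]]] := gK k; exact: measurable_scaled_kernel.
  by apply: (measurableT_comp mg); exact: measurable_snd.
- by apply: measurable_funM => //; exact: measurable_cst.
- move=> k t; rewrite /psi [in leRHS]normrM normrM mulrC ler_wpM2r//.
  rewrite (ger0_norm (ltW kappa0)); have [x [h [_ ->]]] := gK k.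
  rewrite /scaled_kernel; exact: (kernel_le_bound hK2).
- by rewrite mulr_gt0.
- move=> t; rewrite /psi normrM (ger0_norm (ltW kappa0)) ler_wpM2l ?(ltW kappa0)//.
  rewrite normrM -[leRHS]mulr1 ler_pM//.
  by have /andP[b0 b1] := B01 t.2; rewrite ger0_norm.
- apply: le_trans Pv; rewrite -expectZ; last first.
    apply: bdd_measurableM; first by apply: bdd_measurableX; split => //; exists tau.
    by split => //; exists 1 => t; have /andP[b0 b1] := B01 t.2; rewrite ger0_norm.
  rewrite [leLHS](_ : _ = \int[nu]_t (kappa ^+ 2 * (Psi t ^+ 2 * \1_B t.2)))//.
  by apply: eq_Rintegral => t _; rewrite /psi !exprMn Bsq.
- move=> z; apply: (le_trans _ (hA n (fun i => Psi (z i) * \1_B (z i).2) (fun i => (z i).2) u kappa0 u1)).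
  apply: rprob_subset => s [m [k [mn h]]]; exists m, (g k); split => //.
  move: h; congr (_ * _ * _ < _).
  rewrite /psi; under eq_bigr do rewrite exprMn.
  by rewrite -mulr_sumr sqrtrM ?sqr_ge0// sqrtr_sqr (ger0_norm (ltW kappa0)).
Qed.

Lemma ln2_le1 : ln 2 <= 1 :> R.
Proof. by rewrite -[leRHS]expRK ler_ln ?posrE ?expR_gt0//; apply: le_trans (expR_ge1Dx 1); lra. Qed.

(** On the block of sample sizes up to [2 ^+ k], for bandwidths of order
[2 ^- j] with enough observations per window ([c1 * k * tau k ^+ 2 <= 2 ^+ (k -
j)]), the weighted kernel sums deviate from their means by at most the square
root of the expected number of observations in a window times [1 + j + ln k].
The number of windows of this size is of order [2 ^+ j]; the sub-Gaussian tail
at a level with [u ^+ 2] above [2 * (j * ln 2 + ln k)] beats it and leaves a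
summable [k ^- 2]. *)
Lemma dyadic_uniform_bound (Psi : nat -> R * 'rV[R]_d -> R) (tau : nat -> R) (s D c1 : R) :
  (forall k, measurable_fun setT (Psi k)) -> (forall k t, `|Psi k t| <= tau k) ->
  (forall k, 0 < tau k) -> 0 <= D -> 0 < c1 -> 0 < s ->
  (forall k c rho, 0 < rho ->
     \int[nu]_t (Psi k t ^+ 2 * \1_(cube c rho) t.2) <= s * rho ^+ d) ->
  exists2 C : R, 0 <= C & {ae mu, forall z : path_space (R * 'rV[R]_d)%type, exists k0, forall k, (k0 <= k)%N ->
    forall j, (j <= k)%N -> c1 * k%:R * tau k ^+ 2 <= 2 ^+ k / 2 ^+ j ->
    forall (x : 'rV[R]_d) (h : R) m, (forall i, `|x ord0 i| <= D) -> 0 < h <= 2 ^- j -> (m <= 2 ^ k)%N ->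
    `|\sum_(i < m) (Psi k (z i) * scaled_kernel K x h (z i).2 -
        \int[nu]_t (Psi k t * scaled_kernel K x h t.2))| <=
    C * Num.sqrt (2 ^+ k / 2 ^+ j * (1 + j%:R + ln k.+1%:R))}.
Proof.
move=> mPsi Ptau tau0 D0 c10 s0 Ps.
have [A A1 hA] := block_tail.
have [g [gK gd]] := kernel_enumeration.
pose r j : R := root_d d (2 ^- j).
have p2 j : 0 < 2 ^- j :> R by rewrite invr_gt0 exprn_gt0.
have r0 j : 0 < r j by exact: root_d_gt0.
have rd j : r j ^+ d = 2 ^- j by rewrite root_dK// ltW.
have r01 j : 0 < r j <= 1.
  rewrite r0 -(@ler_pXn2r _ d) ?nnegrE ?(ltW (r0 _))// rd expr1n.
  by rewrite invf_le1 ?exprn_gt0// exprn_ege1// ler1n.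
have lat j : exists p : {M : nat & {ffun 'I_d -> 'I_M} -> 'rV[R]_d},
    (tag p)%:R ^+ d <= (2 * D + 1) ^+ d * 2 ^+ j /\
    forall x : 'rV[R]_d, (forall i, `|x ord0 i| <= D) ->
      exists q, cube x (r j / 2) `<=` cube (tagged p q) (2 * r j).
  have [M [c [h1 h2]]] := @lattice_cover R d D (r j) D0 (r01 j).
  exists (existT (fun M : nat => {ffun 'I_d -> 'I_M} -> 'rV[R]_d) M c); split => //=.
  by apply: (le_trans h1); rewrite rd invrK.
have {lat}/choice[p hp] := lat.
pose M j := tag (p j); pose ctr j : {ffun 'I_d -> 'I_(M j)} -> 'rV[R]_d := tagged (p j).
pose V0 := kappa ^+ 2 * (s * 2 ^+ d).
have V00 : 0 < V0 by rewrite !mulr_gt0// exprn_gt0.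
pose Lam := 2 * V0 + 8 * (kappa ^+ 2 / c1).
have k2c : 0 < kappa ^+ 2 / c1 by rewrite divr_gt0 ?exprn_gt0.
have Lam0 : 0 < Lam by rewrite /Lam; lra.
pose l k j : R := Lam * (2 ^+ k / 2 ^+ j).
pose u2 k j : R := 1 + 2 * (j%:R * ln 2 + ln k.+1%:R).
have lnk0 k : 0 <= ln k.+1%:R :> R by rewrite ln_ge0// ler1n.
have ln20 : 0 <= ln 2 :> R by rewrite ln_ge0// ler1n.
have u21 k j : 1 <= u2 k j by rewrite lerDl mulr_ge0// addr_ge0// mulr_ge0.
pose u k j : R := Num.sqrt (u2 k j).
have uE k j : u k j ^+ 2 = u2 k j by rewrite sqr_sqrtr// (le_trans ler01).
have u1 k j : 1 <= u k j by rewrite -[leLHS]sqrtr1 ler_wsqrtr.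
pose phi k j (q : {ffun 'I_d -> 'I_(M j)}) a (t : R * 'rV[R]_d) :=
  Psi k t * \1_(cube (ctr j q) (2 * r j)) t.2 * g a t.2.
pose lev k j := 4 * A * Num.sqrt (l k j) * u k j.
pose LD k j q := large_deviation nu (phi k j q) (2 ^ k) (lev k j).
pose adm k j := c1 * k%:R * tau k ^+ 2 <= 2 ^+ k / 2 ^+ j.
have B01 (B : set 'rV[R]_d) y : 0 <= (\1_B y : R) <= 1.
  by rewrite indicE; case: (_ \in _); rewrite ?ler01 ?lexx.
have mcube2 c rho : measurable_fun [set: R * 'rV[R]_d] (fun t => \1_(cube c rho) t.2 : R).
  apply: (measurableT_comp (f := \1_(cube c rho) : 'rV[R]_d -> R)) => //.
  by apply: measurable_indic; exact: measurable_cube.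
have mphi k j q a : measurable_fun setT (phi k j q a).
  apply: measurable_funM; first exact: measurable_funM.
  have mg : measurable_fun setT (g a) by have [x [h [_ ->]]] := gK a; exact: measurable_scaled_kernel.
  by apply: (measurableT_comp mg); exact: measurable_snd.
have phib k j q a t : `|phi k j q a t| <= tau k * kappa.
  rewrite !normrM ler_pM//.
    rewrite -[leRHS]mulr1 ler_pM//.
    by have /andP[b0 b1] := B01 (cube (ctr j q) (2 * r j)) t.2; rewrite ger0_norm.
  by have [x [h [_ ->]]] := gK a; rewrite /scaled_kernel; exact: (kernel_le_bound hK2).
have mLD k j q : measurable (LD k j q).
  apply: (@measurable_large_deviation _ _ _ nu (phi k j q)
    (fun=> tau k * kappa) (tau k * kappa)) => //.
  - by move=> a t; rewrite [leRHS]ger0_norm// mulr_ge0// ltW.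
  - by move=> t; rewrite ger0_norm// mulr_ge0// ltW.
pose E k := \bigcup_(j : 'I_k.+1) \bigcup_q (if adm k j then LD k j q else set0).
have mq k j q : measurable (if adm k j then LD k j q else set0) by case: ifP.
have mE2 k j : measurable (\bigcup_q (if adm k j then LD k j q else set0)).
  by apply: fin_bigcup_measurable => //; exact: finite_finset.
have mE k : measurable (E k).
  by apply: fin_bigcup_measurable => //; exact: finite_finset.
pose Cb : R := (2 * D + 1) ^+ d.
have Cb0 : 0 <= Cb by rewrite exprn_ge0// addr_ge0// mulr_ge0.
have tail k j q : fine (mu (if adm k j then LD k j q else set0)) <=
    16 * (2 ^- j ^+ 2 * k.+1%:R ^- 2) + 4 * 2 ^- k ^+ 4.
  have rhs0 : 0 <= 16 * (2 ^- j ^+ 2 * k.+1%:R ^- 2) + 4 * 2 ^- k ^+ 4 :> R.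
    by rewrite addr_ge0// ?mulr_ge0// ?exprn_ge0 ?invr_ge0 ?exprn_ge0.
  case: ifPn => [ad|_]; last by rewrite measure0.
  pose v := V0 * 2 ^- j.
  apply: (le_trans (hA g (Psi k) (cube (ctr j q) (2 * r j)) (tau k) v (l k j) (u k j) (2 ^ k)%N gK
    (mPsi k) (Ptau k) (tau0 k) (measurable_cube _ _) _ _ _ (u1 k j))).
  - rewrite /v /V0 -[leRHS]mulrA ler_pM2l ?exprn_gt0//.
    have r2 : 0 < 2 * r j by rewrite mulr_gt0.
    by apply: (le_trans (Ps k (ctr j q) _ r2)); rewrite exprMn rd mulrA.
  - by rewrite mulr_gt0// divr_gt0 ?exprn_gt0.
  - rewrite natrX /v /l mulrCA ler_wpM2r ?divr_ge0 ?exprn_ge0//.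
    by rewrite /Lam; lra.
  apply: lerD.
    rewrite ler_pM2l// uE /u2 opprD expRD.
    apply: (@le_trans _ _ (1 * expR (- (2 * (j%:R * ln 2 + ln k.+1%:R))))).
      by rewrite ler_wpM2r ?expR_ge0// -expR0 ler_expR lerN10.
    rewrite mul1r mulrDr opprD expRD !expRN.
    rewrite mulrA -(natrM _ 2 j) expRM_natl lnK ?posrE// expRM_natl lnK ?posrE ?ltr0n//.
    by rewrite mulnC exprM exprVn.
  rewrite ler_pM2l//.
  have -> : (2 ^ k)%:R * v - l k j / 2 = - (4 * (kappa ^+ 2 / c1)) * (2 ^+ k / 2 ^+ j).
    rewrite natrX /v /l /Lam; field.
    by rewrite expf_neq0 ?(gt_eqF c10)// pnatr_eq0.
  apply: (@le_trans _ _ (expR (4%:R * (k%:R * - 1)))); last first.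
    rewrite expRM_natl expRM_natl lerXn2r ?nnegrE ?exprn_ge0 ?invr_ge0 ?expR_ge0 ?exprn_ge0//.
    rewrite -exprVn lerXn2r ?nnegrE ?expR_ge0 ?invr_ge0//.
    rewrite expRN lef_pV2 ?posrE ?expR_gt0//.
    by apply: le_trans (expR_ge1Dx 1); lra.
  rewrite ler_expR ler_pdivrMr ?exprn_gt0 ?mulr_gt0//.
  have -> : 4%:R * (k%:R * -1) * (kappa * tau k) ^+ 2 =
     - (4 * (kappa ^+ 2 / c1)) * (c1 * k%:R * tau k ^+ 2).
    by field; rewrite gt_eqF.
  by rewrite ler_wnM2l// oppr_le0 mulr_ge0// ltW.
have cardq j : (#|{ffun 'I_d -> 'I_(M j)}|)%:R <= Cb * 2 ^+ j :> R.
  by rewrite card_ffun !card_ord natrX; have [] := hp j.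
have bound k : fine (mu (E k)) <= 40 * Cb * k.+1%:R ^- 2.
  apply: (le_trans (@fine_measure_bigcup_le _ _ _ mu 'I_k.+1 _ (fun j => mE2 k j))).
  apply: (@le_trans _ _ (\sum_(j < k.+1) (Cb * 2 ^+ j) * (16 * (2 ^- j ^+ 2 * k.+1%:R ^- 2) + 4 * 2 ^- k ^+ 4))).
    apply: ler_sum => j _; apply: (le_trans (fine_measure_bigcup_le mu (mq k j))).
    apply: (le_trans (ler_sum _ (fun q _ => tail k j q))).
    rewrite sumr_const -[leLHS]mulr_natl; apply: ler_wpM2r; last exact: cardq.
    by rewrite addr_ge0// ?mulr_ge0// ?exprn_ge0 ?invr_ge0 ?exprn_ge0.
  set X := k.+1%:R ^- 2.
  have X0 : 0 <= X by rewrite invr_ge0 exprn_ge0.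
  have k2k : k.+1%:R * 2 ^- k <= 1 :> R.
    by rewrite ler_pdivrMr ?exprn_gt0// mul1r -natrX ler_nat ltn_expl.
  have e0 : 0 <= 2 ^- k :> R by exact: ltW.
  have eX : (2 ^- k) ^+ 2 <= X.
    rewrite /X -[leRHS]exprVn lerXn2r ?nnegrE ?invr_ge0//.
    by rewrite -[leRHS]div1r ler_pdivlMr ?ltr0n// mulrC.
  apply: (@le_trans _ _ (\sum_(j < k.+1) (16 * Cb * X * 2 ^- j + 4 * Cb * (2 ^- k) ^+ 3))).
    apply: ler_sum => j _; rewrite mulrDr lerD//.
      rewrite le_eqVlt; apply/orP; left; apply/eqP.
      by field; rewrite expf_neq0//= expf_neq0// pnatr_eq0.
    have -> : Cb * 2 ^+ j * (4 * 2 ^- k ^+ 4) = 4 * Cb * (2 ^- k) ^+ 3 * (2 ^+ j * 2 ^- k) by ring.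
    apply: ler_piMr; first by rewrite !mulr_ge0// exprn_ge0.
    by rewrite ler_pdivrMr ?exprn_gt0// mul1r ler_weXn2l ?ler1n// -ltnS.
  rewrite big_split/= -mulr_sumr sumr_const card_ord -[X in _ + X <= _]mulr_natl.
  have h1 : 16 * Cb * X * (\sum_(j < k.+1) 2 ^- j) <= 16 * Cb * X * 2.
    by rewrite ler_wpM2l ?sum_half_le2// !mulr_ge0.
  have h2 : k.+1%:R * (4 * Cb * 2 ^- k ^+ 3) <= 4 * Cb * X.
    have -> : k.+1%:R * (4 * Cb * 2 ^- k ^+ 3) = 4 * Cb * ((2 ^- k) ^+ 2 * (k.+1%:R * 2 ^- k)) by ring.
    rewrite ler_wpM2l ?mulr_ge0//; apply: le_trans eX.
    by rewrite ler_piMr ?exprn_ge0.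
  apply: (le_trans (lerD h1 h2)).
  have : 0 <= Cb * X by exact: mulr_ge0.
  lra.
exists (4 * A * Num.sqrt (2 * Lam)).
  by rewrite !mulr_ge0// (le_trans ler01).
have := borel_cantelli_inv_sqr mE bound; apply: filterS => z [k0 hk0].
exists k0 => k k0k j jk ad x h m xD /andP[h0 hj] mk.
have [q hq] := (hp j).2 x xD.
have nLD : ~ LD k j q z.
  move=> LDz; apply: (hk0 k k0k); have jk1 : (j < k.+1)%N by rewrite ltnS.
  by exists (Ordinal jk1) => //; exists q => //=; rewrite /adm ad.
have [a ha] := gd (scaled_kernel K x h) (ex_intro _ x (ex_intro _ h (conj h0 erefl))).
pose phi' t := Psi k t * scaled_kernel K x h t.2.
have cubeK t : Psi k t * \1_(cube (ctr j q) (2 * r j)) t.2 * scaled_kernel K x h t.2 = phi' t.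
  rewrite /phi'; have [->|K0] := eqVneq (scaled_kernel K x h t.2) 0; first by rewrite !mulr0.
  rewrite indicE mem_set ?mulr1//; apply: hq => i.
  apply: le_trans (scaled_kernel_support sK h0 K0 i) _.
  by rewrite ler_pM2r// ler_root_d.
have cphi t : phi k j q (a n) t @[n --> \oo] --> phi' t.
  by rewrite -cubeK; apply: cvgM; [exact: cvg_cst|exact: ha].
have cint : \int[nu]_t phi k j q (a n) t @[n --> \oo] --> \int[nu]_t phi' t.
  apply: (@bounded_convergence _ _ _ nu _ phi' (tau k * kappa)) => //.
  by apply: measurable_funM => //; apply: (measurableT_comp (measurable_scaled_kernel mK x h)); exact: measurable_snd.
apply: (@le_trans _ _ (lev k j)).
  apply: (@norm_lim_le _ (fun n => centered_sum nu (phi k j q) (a n) m z)).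
    move=> n; rewrite leNgt; apply/negP => hn; apply: nLD.
    by exists (a n), m.
  rewrite /centered_sum; apply: cvg_big => [|i _]; first exact: add_continuous.
  by apply: cvgB; [exact: cphi|exact: cint].
rewrite /lev -[leLHS]mulrA -[leRHS]mulrA; apply: ler_wpM2l; first by rewrite mulr_ge0// (le_trans ler01).
rewrite -!sqrtrM ?mulr_ge0 ?(ltW Lam0) ?divr_ge0 ?exprn_ge0//.
apply: ler_wsqrtr; rewrite /l /u2.
have -> : 2 * Lam * (2 ^+ k / 2 ^+ j * (1 + j%:R + ln k.+1%:R)) =
  Lam * (2 ^+ k / 2 ^+ j) * (2 * (1 + j%:R + ln k.+1%:R)) by ring.
rewrite ler_wpM2l ?mulr_ge0 ?(ltW Lam0) ?divr_ge0 ?exprn_ge0//.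
have := ln2_le1; have : 0 <= j%:R :> R by []; move: (j%:R : R) (ln 2) => y w y0 w1.
have : y * w <= y by rewrite ler_piMr.
lra.
Qed.

End dyadic_blocks.

(** * The expected kernel sums *)

Section measure_comparison.
Context {d : measure_display} {T : measurableType d} {R : realType}.
Local Open Scope ereal_scope.
Import HBNNSimple.

Lemma ge0_le_integral_measure (m1 m2 : {measure set T -> \bar R}) (C : set T) (f : T -> \bar R) :
  (forall A, measurable A -> A `<=` C -> m1 A <= m2 A) -> (forall x, 0 <= f x) ->
  (forall x, ~ C x -> f x = 0) ->
  \int[m1]_x f x <= \int[m2]_x f x.
Proof.
move=> m12 f0 fC; rewrite !ge0_integralTE//.
apply: ge_ereal_sup => _ [h hf <-].
apply: (@le_trans _ _ (sintegral m2 h)); last first.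
  by apply: ereal_sup_ubound; exists h.
rewrite !sintegralE; apply: lee_fsum => // r [t _ <-].
have [->|ht0] := eqVneq (h t) 0%R; first by rewrite !mul0e.
apply: lee_wpmul2l; first by rewrite lee_fin.
apply: m12; first exact: measurable_sfunP.
move=> x /= hx; apply: contrapT => /fC fx0.
have := hf x; rewrite hx fx0 lee_fin => ht.
by move: ht0; rewrite eq_le ht fun_ge0.
Qed.

End measure_comparison.

Section lebesgue_rV_affine.
Context {R : realType} {d : nat}.
Local Notation lam := (lebesgue_rV d : {measure set 'rV[R]_d -> \bar R}).

Lemma lebesgue_measure_affine (x r : R) (A : set R) : 0 < r -> measurable A ->
  lebesgue_measure ((fun y : R => r^-1 * (x - y)) @^-1` A) = (r%:E * lebesgue_measure A)%E.
Proof.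
move=> r0 mA.
have mf : measurable_fun [set: measurableTypeR R] ((fun y : R => r^-1 * (x - y)) : measurableTypeR R -> measurableTypeR R).
  by apply: measurable_funM => //; apply: measurable_funB.
have r10 : 0 <= r^-1 by rewrite invr_ge0 ltW.
have := @lebesgue_measure_unique R (mscale (NngNum r10) (pushforward_measure lebesgue_measure mf)).
move=> /(_ _ A mA) ->; last first.
  move=> _ [[a b] /= ab <-].
  rewrite /mscale/= /pushforward.
  rewrite (_ : _ @^-1` _ = `[x - r * b, x - r * a[%classic); last first.
    have e y : (a < r^-1 * (x - y) <= b) = (x - r * b <= y < x - r * a).
      rewrite mulrC ltr_pdivlMr// ler_pdivrMr//.
      by apply/idP/idP => /andP[h1 h2]; apply/andP; split; lra.
    by apply/seteqP; split=> y; rewrite /= !in_itv/= e.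
  rewrite !lebesgue_measure_itv/= !lte_fin ltrD2l ltrN2 ltr_pM2l//.
  case: ifP => _; last by rewrite mule0.
  by rewrite -!EFinB -EFinM; congr EFin; field; rewrite gt_eqF.
by rewrite /mscale/= /pushforward muleA -EFinM divff ?mul1e// gt_eqF.
Qed.

Lemma measurable_rectangle (A : 'I_d -> set R) : (forall i, measurable (A i)) ->
  measurable [set v : 'rV[R]_d | forall i, A i (v ord0 i)].
Proof.
move=> mA; rewrite (_ : mkset _ = \bigcap_(i in [set: 'I_d]) ((fun y : 'rV[R]_d => y ord0 i) @^-1` A i)).
  apply: fin_bigcap_measurable; first exact: finite_finset.
  by move=> i _; rewrite -[X in measurable X]setTI; exact: measurable_coord_rV.
by apply/seteqP; split=> [y h i _|y h i]; [exact: h|exact: (h i I)].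
Qed.

Lemma measurable_affine_rV (x : 'rV[R]_d) (r : R) :
  measurable_fun [set: 'rV[R]_d] (fun y : 'rV[R]_d => r^-1 *: (x - y)).
Proof.
apply: measurable_rVP => i; under eq_fun do rewrite !mxE.
apply: measurable_funM => //; apply: measurable_funB => //.
exact: measurable_coord_rV.
Qed.

Lemma lebesgue_rV_affine (x : 'rV[R]_d) (r : R) (B : set 'rV[R]_d) : 0 < r -> measurable B ->
  lam ((fun y => r^-1 *: (x - y)) @^-1` B) = ((r ^+ d)%:E * lam B)%E.
Proof.
move=> r0 mB.
pose G : set (set 'rV[R]_d) := [set C | exists A : 'I_d -> set R,
  (forall i, measurable (A i)) /\ C = [set v : 'rV[R]_d | forall i, A i (v ord0 i)]].
have rd0 : 0 <= r ^+ d by rewrite exprn_ge0// ltW.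
have rect_pre (A : 'I_d -> set R) : (forall i, measurable (A i)) ->
    lam ((fun y => r^-1 *: (x - y)) @^-1` [set v : 'rV[R]_d | forall i, A i (v ord0 i)]) =
    ((r ^+ d)%:E * \prod_(i < d) lebesgue_measure (A i))%E.
  move=> mA.
  rewrite (_ : _ @^-1` _ = [set y : 'rV[R]_d | forall i,
     ((fun t => r^-1 * (x ord0 i - t)) @^-1` A i) (y ord0 i)]); last first.
    by apply/seteqP; split=> y /= h i; have := h i; rewrite !mxE.
  rewrite (@lebesgue_rV_rectangle R d (fun i => (fun t : R => r^-1 * (x ord0 i - t)) @^-1` A i)); last first.
    move=> i; rewrite -[X in measurable X]setTI.
    have mf : measurable_fun [set: R] (fun t : R => r^-1 * (x ord0 i - t)).
      by apply: measurable_funM => //; apply: measurable_funB.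
    exact: mf.
  rewrite (eq_bigr (fun i => r%:E * lebesgue_measure (A i))%E); last first.
    by move=> i _; rewrite lebesgue_measure_affine.
  by rewrite big_split/= prodEFin prodr_const card_ord.
apply: (measure_unique G (fun k => [set v : 'rV[R]_d | forall i, `[- k%:R, k%:R]%classic (v ord0 i)]) _ _ _ _
  (pushforward_measure lam (measurable_affine_rV x r)) (mscale (NngNum rd0) lam) _ _ B mB).
- apply/seteqP; split; last first.
    apply: smallest_sub; first exact: sigma_algebra_measurable.
    by move=> _ [A [mA ->]]; exact: measurable_rectangle.
  move=> C mC.
  have := @measurable_rVP R d _ (g_sigma_algebraType G) id _.
  move=> /(_ _ measurableT C mC); rewrite setTI preimage_id; apply.
  move=> i _ A mA; rewrite setTI; apply: sub_sigma_algebra.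
  exists (fun j => if j == i then A else setT); split; first by move=> j; case: ifP.
  apply/seteqP; split=> v /=; first by move=> Av j; case: eqP => // ->.
  by move/(_ i); rewrite eqxx.
- move=> _ _ [A1 [mA1 ->]] [A2 [mA2 ->]]; exists (fun i => A1 i `&` A2 i).
  split; first by move=> i; exact: measurableI.
  by apply/seteqP; split=> [v [h1 h2] i|v h]; [split|split=> i; have [] := h i].
- by move=> k; exists (fun=> `[- k%:R, k%:R]%classic); split => // i; exact: measurable_itv.
- apply/seteqP; split => // v _.
  exists (Num.trunc (\sum_i `|v ord0 i|)).+1 => // i /=; rewrite in_itv/= -ler_norml.
  apply: (@le_trans _ _ (\sum_i `|v ord0 i|)); last by rewrite ltW// truncnS_gt.
  by rewrite (bigD1 i)//= lerDl sumr_ge0.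
- move=> _ [A [mA ->]].
  transitivity ((r ^+ d)%:E * lam [set v : 'rV[R]_d | forall i, A i (v ord0 i)])%E; last by [].
  rewrite lebesgue_rV_rectangle// -rect_pre//.
- move=> k.
  have e := rect_pre (fun=> `[- k%:R, k%:R]%classic) (fun=> measurable_itv _).
  rewrite [X in (X < _)%E]e.
  rewrite (eq_bigr (fun i => (k%:R + k%:R)%:E)); last first.
    move=> i _; rewrite lebesgue_measure_itv/= lte_fin; case: ifP => [_|].
      by rewrite -EFinB opprK.
    move/negbT; rewrite -leNgt => kk.
    have -> : k%:R = 0 :> R by apply/eqP; rewrite eq_le ler0n andbT; have : 0 <= k%:R :> R by []; lra.
    by rewrite addr0.
  by rewrite prodEFin -EFinM ltry.
Qed.

Lemma lebesgue_rV_cube (c : 'rV[R]_d) (rho : R) : 0 < rho ->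
  lam (cube c rho) = ((2 * rho) ^+ d)%:E.
Proof.
move=> rho0.
rewrite (_ : cube c rho = [set y | forall i, `[c ord0 i - rho, c ord0 i + rho]%classic (y ord0 i)]); last first.
  by apply/seteqP; split=> y h i; have := h i; rewrite /= in_itv/= ler_distl.
rewrite (@lebesgue_rV_rectangle R d (fun i => `[c ord0 i - rho, c ord0 i + rho]%classic)); last first.
  by move=> i; exact: measurable_itv.
rewrite (eq_bigr (fun i => (2 * rho)%:E)); last first.
  move=> i _; rewrite lebesgue_measure_itv/= lte_fin ifT; last lra.
  by rewrite -EFinB; congr EFin; ring.
by rewrite prodEFin prodr_const card_ord.
Qed.

End lebesgue_rV_affine.

Section expected_kernel.
Context {R : realType} {d : nat}.
Hypothesis d0 : (0 < d)%N.
Local Notation lam := (lebesgue_rV d : {measure set 'rV[R]_d -> \bar R}).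
Variable K : 'rV[R]_d -> R.
Hypotheses (mK : measurable_fun [set: 'rV[R]_d] K)
  (hK1 : kernel_cond_i K) (hK2 : kernel_cond_ii K) (sK : kernel_support K).
Local Notation kappa := (kernel_bound K).

Lemma integrable_cube_support (g : 'rV[R]_d -> R) (c : 'rV[R]_d) (rho M : R) :
  0 < rho -> measurable_fun setT g -> (forall y, `|g y| <= M) ->
  (forall y, g y != 0 -> cube c rho y) -> lam.-integrable setT (EFin \o g).
Proof.
move=> rho0 mg gM sg.
have mC := measurable_cube c rho.
have -> : EFin \o g = (EFin \o g) \_ (cube c rho).
  apply/funext => y; rewrite patchE; case: ifPn => //= /negP yC.
  by congr EFin; apply/eqP; apply: contrapT => /negP /sg Cy; apply: yC; exact: mem_set.
apply: (integrable_mkcond (mu := lam) (EFin \o g) mC).1.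
apply: measurable_bounded_integrable => //.
- by rewrite [X in (X < _)%E]lebesgue_rV_cube// ltry.
- exact: measurable_funTS.
- exists M; split; first exact: num_real.
  by move=> x Mx t _; apply: (le_trans (gM t)); exact: ltW.
Qed.

Lemma kernel_cube_support y : K y != 0 -> cube 0 (2^-1) y.
Proof. by move=> /sK h i; rewrite mxE subr0 ler_norml h. Qed.

Lemma integral_scaled_kernel (x : 'rV[R]_d) (h : R) : 0 < h ->
  (\int[lam]_y (scaled_kernel K x h y)%:E = h%:E)%E.
Proof.
move=> h0; pose r := root_d d h.
have r0 : 0 < r by exact: root_d_gt0.
have rd : r ^+ d = h by rewrite /r root_dK// ltW.
have rd0 : 0 <= r ^+ d by rewrite rd ltW.
have iK : lam.-integrable setT (EFin \o K).
  by apply: (@integrable_cube_support K 0 (2^-1) kappa) => //; [exact: (kernel_le_bound hK2)|exact: kernel_cube_support].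
have isK : lam.-integrable setT (EFin \o scaled_kernel K x h).
  apply: (@integrable_cube_support _ x (r / 2) kappa).
  - by rewrite divr_gt0.
  - exact: measurable_scaled_kernel.
  - by move=> y; exact: (kernel_le_bound hK2).
  - by move=> y; exact: scaled_kernel_support.
have mf := measurable_affine_rV x r.
have -> : (\int[lam]_y (scaled_kernel K x h y)%:E = \int[pushforward_measure lam mf]_y (K y)%:E)%E.
  rewrite [RHS](integral_pushforward mf)//; first by apply/measurable_EFinP.
rewrite (eq_measure_integral (mscale (NngNum rd0) lam)); last first.
  by move=> B mB _; exact: lebesgue_rV_affine.
have mEK : measurable_fun setT (EFin \o K) by exact/measurable_EFinP.
rewrite integralE !ge0_integral_mscale//; [|exact: measurable_funeneg|exact: measurable_funepos].
have fp := integrable_pos_fin_num measurableT iK.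
have fn := integrable_neg_fin_num measurableT iK.
rewrite -muleBr//; last by rewrite fin_num_adde_defl// fin_numN.
have hK := hK1; rewrite /kernel_cond_i integralE in hK.
by rewrite [X in (_ * X)%E]hK mule1/= rd.
Qed.

(** Adding [kappa] times the indicator of the window makes the integrand
nonnegative, so that bounds on the density turn into bounds on the integral by
comparing measures. *)
Lemma expect_scaled_kernel_ge (rho : probability 'rV[R]_d R) (f : 'rV[R]_d -> R) x (h a w : R) :
  (forall B, measurable B -> rho B = \int[lam]_(y in B) (f y)%:E)%E ->
  measurable_fun setT f ->
  0 < h -> 0 <= w <= a ->
  (forall y, cube x (root_d d h / 2) y -> a - w <= f y <= a + w) ->
  h * (a - w - 2 * kappa * w) <= \int[rho]_y scaled_kernel K x h y.
Proof.
move=> rhoE mf h0 /andP[w0 wa] fa.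
pose r := root_d d h; pose C := cube x (r / 2); pose g := scaled_kernel K x h.
have r0 : 0 < r by exact: root_d_gt0.
have r20 : 0 < r / 2 by rewrite divr_gt0.
have mC : measurable C by exact: measurable_cube.
have lC : lam C = h%:E.
  by rewrite lebesgue_rV_cube// mulrCA divff// mulr1 root_dK// ltW.
have mg : measurable_fun setT g by exact: measurable_scaled_kernel.
have gk y : `|g y| <= kappa by exact: (kernel_le_bound hK2).
have k0 : 0 <= kappa by exact: le_trans (gk 0).
have bg : bdd_measurable g by split => //; exists kappa.
have bC : bdd_measurable (\1_C : 'rV[R]_d -> R) by exact: bdd_measurable_indic.
have sg y : g y != 0 -> C y by exact: scaled_kernel_support.
pose g' y := g y + kappa * \1_C y.
have g'0 y : 0 <= g' y.
  rewrite /g' indicE; case: (boolP (y \in C)) => [_|/negP yC].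
    by rewrite mulr1; have := gk y; rewrite ler_norml => /andP[]; lra.
  rewrite mulr0 addr0; have [->//|/sg Cy] := eqVneq (g y) 0.
  by exfalso; apply: yC; exact: mem_set.
have bg' : bdd_measurable g'.
  by apply: bdd_measurableD => //; apply: bdd_measurableM => //; exact: bdd_measurable_cst.
have aw0 : 0 <= a - w by rewrite subr_ge0.
have rho_le A : measurable A -> A `<=` C -> ((a - w)%:E * lam A <= rho A)%E.
  move=> mA AC; rewrite rhoE// -integral_cst//; apply: ge0_le_integral => //.
  - by apply/measurable_EFinP; exact: measurable_funTS.
  - by move=> y Ay; rewrite lee_fin; have /andP[] := fa y (AC y Ay).
have rho_ge : (rho C <= ((a + w) * h)%:E)%E.
  rewrite rhoE// EFinM -lC -integral_cst//; apply: ge0_le_integral => //.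
  - by move=> y Cy; rewrite lee_fin; have /andP[h1 _] := fa y Cy; exact: le_trans h1.
  - by apply/measurable_EFinP; exact: measurable_funTS.
  - by move=> y Cy; rewrite lee_fin; have /andP[] := fa y Cy.
have ig : lam.-integrable setT (EFin \o g) by exact: (integrable_cube_support r20 mg gk sg).
have iC : lam.-integrable setT (EFin \o (fun y => kappa * \1_C y)).
  apply: (integrable_cube_support (c := x) (rho := r / 2) (M := kappa) r20).
  - by apply: measurable_funM => //; exact: measurable_indic.
  - by move=> y; rewrite indicE; case: (_ \in _); rewrite ?mulr1 ?mulr0 ?normr0// ger0_norm.
  - by move=> y; rewrite indicE; case: (boolP (y \in C)) => [/set_mem//|_]; rewrite mulr0 eqxx.
have lamg' : (\int[lam]_y (g' y)%:E = (h + kappa * h)%:E)%E.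
  rewrite (eq_integral (fun y => (g y)%:E + (kappa * \1_C y)%:E)%E)//.
  rewrite integralD// integral_scaled_kernel// EFinD; congr (_ + _)%E.
  under eq_integral do rewrite EFinM.
  rewrite ge0_integralZl//; last by apply/measurable_EFinP; exact: measurable_indic.
  by rewrite integral_indic// setIT [X in (_ * X)%E]lC EFinM.
have key : ((a - w)%:E * (h + kappa * h)%:E <= \int[rho]_y (g' y)%:E)%E.
  rewrite -lamg' -(@ge0_integral_mscale _ _ _ lam _ _ (NngNum aw0))//; last 2 first.
  - by apply/measurable_EFinP; case: bg'.
  - by move=> y _; rewrite lee_fin.
  apply: (@ge0_le_integral_measure _ _ _ _ _ C) => //.
  move=> y Cy; congr EFin; rewrite /g' indicE memNset// mulr0 addr0.
  by apply/eqP; apply: contrapT => /negP/sg.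
have : (a - w) * (h + kappa * h) <= \int[rho]_y g' y.
  by rewrite -lee_fin EFin_expect// EFinM.
rewrite /g' expectD//; last by apply: bdd_measurableM => //; exact: bdd_measurable_cst.
rewrite expectZ// expect_indic//.
have : fine (rho C) <= (a + w) * h by rewrite -lee_fin fineK// fin_num_measure.
move: (fine _) => q q1 q2.
have : kappa * q <= kappa * ((a + w) * h) by rewrite ler_wpM2l.
move: (\int[rho]_y g y) q2 => t; lra.
Qed.

End expected_kernel.

(** * Averages of integrable variables *)

Section averages.
Context {d : measure_display} {T : measurableType d} {R : realType}.
Variables (nu : probability T R) (mu : probability (path_space T) R).
Hypothesis iid_mu : iid_law nu mu.

Lemma sum_pow2_lt_le (v : R) n : 0 <= v ->
  \sum_(k < n) (if 2 ^+ k < v then 2 ^+ k else 0) <= 2 * v.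
Proof.
move=> v0; elim: n => [|n IH]; first by rewrite big_ord0 mulr_ge0.
rewrite big_ord_recr/=; case: ifP => [nv|_]; last by rewrite addr0.
have le2 : \sum_(k < n) (if 2 ^+ k < v then 2 ^+ k else 0) <= 2 ^+ n :> R.
  elim: n {IH nv} => [|n IH]; first by rewrite big_ord0 expr0.
  rewrite big_ord_recr/= exprS mulr2n mulrDl mul1r lerD//.
  by case: ifP => // _; exact: exprn_ge0.
by lra.
Qed.

Lemma sum_pow2_ge_le (v : R) n : 0 <= v ->
  \sum_(k < n) (if v <= 2 ^+ k then v ^+ 2 / 2 ^+ k else 0) <= 2 * v.
Proof.
move=> v0; have [->|vn0] := eqVneq v 0.
  by rewrite mulr0 big1// => k _; case: ifP => //; rewrite expr0n/= mul0r.
have vpos : 0 < v by rewrite lt_neqAle eq_sym vn0.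
pose S m : R := \sum_(k < m) (if v <= 2 ^+ k then v ^+ 2 / 2 ^+ k else 0).
suff : (S n = 0) \/ (S n <= 2 * v - 2 * (v ^+ 2 / 2 ^+ n)).
  rewrite -/(S n).
  have p : 0 <= v ^+ 2 / 2 ^+ n by rewrite divr_ge0 ?sqr_ge0 ?exprn_ge0.
  by move=> [->|]; [rewrite mulr_ge0|lra].
have pS m : v ^+ 2 / 2 ^+ m.+1 = v ^+ 2 / 2 ^+ m / 2 by rewrite (exprS 2 m); field; rewrite expf_neq0.
elim: n => [|n IH]; first by left; rewrite /S big_ord0.
have p : 0 <= v ^+ 2 / 2 ^+ n by rewrite divr_ge0 ?sqr_ge0 ?exprn_ge0.
rewrite /S big_ord_recr/= pS -/(S n); case: ifP => [vn|_].
  right; have : v ^+ 2 / 2 ^+ n <= v by rewrite ler_pdivrMr ?exprn_gt0// expr2 ler_pM2l.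
  by case: IH => [->|]; lra.
by rewrite addr0; case: IH => [->|h]; [left|right; lra].
Qed.

(** Truncation at [2 ^+ k] on the [k]-th dyadic block, with Chebyshev's
inequality for the truncated part. *)
Lemma dyadic_average_bounded (V : T -> R) :
  measurable_fun setT V -> (forall t, 0 <= V t) -> nu.-integrable setT (EFin \o V) ->
  exists2 C : R, 0 <= C & {ae mu, forall z : path_space T, exists k0, forall k, (k0 <= k)%N ->
    \sum_(i < 2 ^ k) V (z i) <= C * 2 ^+ k}.
Proof.
move=> mV V0 iV.
pose EV := \int[nu]_t V t.
have EV0 : 0 <= EV by exact: expect_ge0.
pose W k t := if V t <= 2 ^+ k then V t else 0.
pose A k : set T := [set t | 2 ^+ k < V t].
have mA k : measurable (A k).
  rewrite -[X in measurable X]setTI (_ : A k = V @^-1` `]2 ^+ k, +oo[%classic).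
    exact: mV.
  by apply/seteqP; split=> t /=; rewrite in_itv/= andbT.
have WE k t : W k t = V t * (1 - \1_(A k) t).
  rewrite /W leNgt indicE; case: ifPn => [nA|/negPn At].
    by rewrite memNset ?subr0 ?mulr1//; apply/negP.
  by rewrite mem_set// subrr mulr0.
have W0 k t : 0 <= W k t by rewrite /W; case: ifP.
have W2k k t : `|W k t| <= 2 ^+ k.
  by rewrite ger0_norm// /W; case: ifP => // _; exact: exprn_ge0.
have mW k : measurable_fun setT (W k).
  rewrite (_ : W k = fun t => V t * (1 - \1_(A k) t)); last by apply/funext => t.
  by apply: measurable_funM => //; apply: measurable_funB => //; exact: measurable_indic.
have bW k : bdd_measurable (W k) by split => //; exists (2 ^+ k).
have bA k : bdd_measurable (\1_(A k) : T -> R) by exact: bdd_measurable_indic.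
have EWV k : \int[nu]_t W k t <= EV.
  apply: le_Rintegral => //; first exact: bdd_measurable_integrable.
  by move=> t _; rewrite /W; case: ifP.
pose B k : set (path_space T) := \bigcup_(i : 'I_(2 ^ k)) [set z | A k (z i)].
pose D k : set (path_space T) := [set z | 2 ^+ k < `|centered_sum nu (fun=> W k) 0 (2 ^ k) z|].
have mB1 k i : measurable ([set z | A k (z i)] : set (path_space T)).
  by rewrite -[X in measurable X]setTI; exact: measurable_eval.
have mB k : measurable (B k).
  by apply: fin_bigcup_measurable => [|i _]; [exact: finite_finset|exact: mB1].
have mD k : measurable (D k).
  apply: measurable_gt.
  have [mS [M SM]] : bdd_measurable (centered_sum nu (fun=> W k) 0 (2 ^ k)).
    by apply: (@bdd_measurable_centered_sum _ _ _ nu (fun=> W k) (W k) (2 ^+ k)).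
  by split; [exact: measurableT_comp|exists M => z; rewrite normr_id].
have pB k : fine (mu (B k)) <= 2 ^+ k * \int[nu]_t \1_(A k) t.
  apply: (le_trans (@fine_measure_bigcup_le _ _ _ mu _ (fun i : 'I_(2 ^ k) => [set z | A k (z i)]) (fun i => mB1 k i))).
  rewrite (eq_bigr (fun=> \int[nu]_t \1_(A k) t)).
    by rewrite sumr_const card_ord -[leLHS]mulr_natl natrX.
  by move=> i _; rewrite expect_indic//; congr fine; exact: (iid_law_eval iid_mu).
have pD k : fine (mu (D k)) <= (2 ^+ k)^-1 * \int[nu]_t W k t ^+ 2.
  have := @centered_sum_chebyshev _ _ _ nu mu iid_mu (fun=> W k) (W k) (2 ^+ k) (\int[nu]_t W k t ^+ 2) (2 ^ k)%N
    _ _ _ _ _ 0 (2 ^ k)%N (2 ^+ k).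
  move=> h; apply: (le_trans (h _ _ _ _ _ _ _)); rewrite ?exprn_gt0//.
  by rewrite natrX le_eqVlt; apply/orP; left; apply/eqP; field; rewrite expf_neq0.
exists (EV + 1); first by rewrite addr_ge0.
have mF k : measurable (B k `|` D k) by exact: measurableU.
have bWA k : bdd_measurable (fun t => 2 ^+ k * \1_(A k) t + (2 ^+ k)^-1 * W k t ^+ 2).
  apply: bdd_measurableD; apply: bdd_measurableM => //; [exact: bdd_measurable_cst..|exact: bdd_measurableX].
have pF k : fine (mu (B k `|` D k)) <= \int[nu]_t (2 ^+ k * \1_(A k) t + (2 ^+ k)^-1 * W k t ^+ 2).
  rewrite expectD; [|by apply: bdd_measurableM => //; exact: bdd_measurable_cst|]; last first.
    by apply: bdd_measurableM; [exact: bdd_measurable_cst|exact: bdd_measurableX].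
  rewrite !expectZ//; last exact: bdd_measurableX.
  apply: le_trans (lerD (pB k) (pD k)).
  rewrite -lee_fin EFinD !fineK ?fin_num_measure//.
  exact: measureU2.
have := @borel_cantelli_fine _ _ _ mu (fun k => B k `|` D k) (4 * EV) mF _.
have sumF n : \sum_(k < n) fine (mu (B k `|` D k)) <= 4 * EV.
  apply: (le_trans (ler_sum _ (fun (k : 'I_n) _ => pF k))).
  rewrite -(expect_sum nu (index_enum _) (fun k : 'I_n => bWA k)).
  rewrite /EV -RintegralZl//; apply: le_Rintegral => //.
  - apply: bdd_measurable_integrable; apply: bdd_measurable_sum => k; exact: bWA.
  - rewrite /comp; under eq_fun do rewrite EFinM; exact: integrableZl.
  - move=> t _; rewrite big_split/=.
    have -> : \sum_(k < n) 2 ^+ k * \1_(A k) t = \sum_(k < n) (if 2 ^+ k < V t then 2 ^+ k else 0) :> R.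
      apply: eq_bigr => k _; rewrite indicE; case: ifPn => [At|nA].
        by rewrite mem_set ?mulr1.
      by rewrite memNset ?mulr0//; apply/negP.
    have -> : \sum_(k < n) (2 ^+ k)^-1 * W k t ^+ 2 =
        \sum_(k < n) (if V t <= 2 ^+ k then V t ^+ 2 / 2 ^+ k else 0) :> R.
      apply: eq_bigr => k _; rewrite /W mulrC; case: ifP => // _.
      by rewrite expr0n/= mul0r.
    have := sum_pow2_lt_le n (V0 t); have := sum_pow2_ge_le n (V0 t); lra.
move=> /(_ sumF); apply: filterS => z [k0 hk0]; exists k0 => k k0k.
have /not_orP[nB nD] := hk0 k k0k.
have VW (i : 'I_(2 ^ k)) : V (z i) = W k (z i).
  rewrite /W; case: ifPn => //; rewrite -ltNge => Vi; exfalso; apply: nB.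
  by exists i.
rewrite (eq_bigr (fun i : 'I_(2 ^ k) => W k (z i))); last by move=> i _; exact: VW.
move: nD => /negP; rewrite -leNgt /centered_sum sumrB sumr_const card_ord -[X in _ - X]mulr_natl natrX.
move=> /ler_normlW; have : 2 ^+ k * \int[nu]_t W k t <= 2 ^+ k * EV by rewrite ler_wpM2l// exprn_ge0.
move: (\sum_(i < _) _) => s; rewrite mulrDl mul1r mulrC [EV * _]mulrC; lra.
Qed.

End averages.

(** * From dyadic blocks to all sample sizes and bandwidths *)

Section bandwidth.
Context {R : realType}.
Implicit Types (h : R) (n k j : nat).

Definition LL n h : R := Num.max (ln h^-1) (ln (ln n%:R)).

Lemma ln2_ge_half : 2^-1 <= ln 2 :> R.
Proof.
rewrite -[leLHS]expRK ler_ln ?posrE ?expR_gt0//.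
have h : expR (- 2^-1) >= 2^-1 :> R.
  by apply: le_trans (expR_ge1Dx _); lra.
rewrite -[leRHS]invrK -[X in X <= _]invrK lef_pV2 ?posrE ?invr_gt0 ?expR_gt0//.
by rewrite -expRN.
Qed.


Lemma dyadic_scale h : 0 < h <= 2^-1 ->
  exists j, [/\ (0 < j)%N, h <= 2 ^- j & 2 ^- j <= 2 * h].
Proof.
move=> /andP[h0 h2]; pose q := Num.trunc h^-1.
have hi0 : 0 <= h^-1 by rewrite invr_ge0 ltW.
have hi2 : 2 <= h^-1 by rewrite -[leLHS]invrK lef_pV2 ?posrE ?invr_gt0.
have q_gt1 : (1 < q)%N by rewrite /q truncn_gt_nat.
have /andP[q1 q2] := truncn_itv hi0; rewrite -/q in q1 q2.
have /andP[j1 j2] := trunc_log_bounds (isT : 1 < 2)%N (ltnW q_gt1).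
exists (trunc_log 2 q); split.
- rewrite lt0n; apply/eqP => j0; move: j2; rewrite j0 expn1 => j2.
  by have := leq_trans j2 q_gt1; rewrite ltnn.
- rewrite -[leLHS]invrK lef_pV2 ?posrE ?invr_gt0 ?exprn_gt0//.
  by apply: le_trans q1; rewrite -natrX ler_nat.
- rewrite -[X in _ <= X]invrK lef_pV2 ?posrE ?invr_gt0 ?exprn_gt0 ?mulr_gt0//.
  rewrite invfM ler_pdivrMl// -exprS; apply: le_trans (ltW q2) _.
  by rewrite -natrX ler_nat.
Qed.

(** The block of the sample size [n] is the [k] for which
    [2 ^ (k - 1) < n <= 2 ^ k]. *)
Definition block n := up_log 2 n.

Lemma le_block n : n%:R <= 2 ^+ block n :> R.
Proof. by rewrite -natrX ler_nat; exact: up_logP. Qed.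

Lemma block_le n : (1 < n)%N -> 2 ^+ block n <= 2 * n%:R :> R.
Proof.
move=> n1; have /andP[+ _] := up_log_bounds (isT : 1 < 2)%N n1.
have : (0 < block n)%N by rewrite up_log_gt0.
rewrite /block; case: (up_log 2 n) => // k _ /= /ltnW kn.
by rewrite exprS ler_pM2l// -natrX ler_nat.
Qed.

Lemma near_block (k0 : nat) : \forall n \near \oo, (k0 <= block n)%N.
Proof.
exists (2 ^ k0).+1 => // n /= kn; rewrite ltnW// -(@ltn_exp2l 2)//.
exact: leq_trans kn (up_logP _ _).
Qed.

Lemma block_ln n : (1 < n)%N -> (block n)%:R <= 1 + 2 * ln n%:R :> R.
Proof.
move=> n1; have /andP[+ _] := up_log_bounds (isT : 1 < 2)%N n1.
have : (0 < block n)%N by rewrite up_log_gt0.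
rewrite /block; case: (up_log 2 n) => // k _ /= /ltnW kn.
rewrite -natr1 addrC lerD2l -ler_pdivrMl// mulrC.
apply: (@le_trans _ _ (k%:R * ln 2)); first by rewrite ler_wpM2l// ln2_ge_half.
rewrite mulrC mulr_natr -lnXn// ler_ln ?posrE ?exprn_gt0 ?ltr0n ?(ltn_trans _ n1)//.
by rewrite -natrX ler_nat.
Qed.

Lemma near_ln (x : R) : \forall n \near \oo, x <= ln n%:R.
Proof.
exists (Num.trunc (expR x)).+1 => // n /= xn.
rewrite -[leLHS]expRK ler_ln ?posrE ?expR_gt0 ?ltr0n ?(leq_ltn_trans _ xn)//.
by apply: le_trans (ltW (truncnS_gt _)) _; rewrite ler_nat.
Qed.

Lemma ln_block n : 3 <= ln n%:R :> R -> ln (block n).+1%:R <= 2 * ln (ln n%:R) :> R.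
Proof.
move=> l3; have n1 : (1 < n)%N.
  by rewrite ltnNge; apply: contraPN l3; case: n => [|[|//]] _; rewrite ?ln1 ?ln0//; lra.
have l0 : 0 < ln n%:R :> R by lra.
rewrite mulr_natl -lnXn// ler_ln ?posrE ?exprn_gt0//.
by have := block_ln n1; rewrite -[X in _ -> X <= _]natr1; nra.
Qed.

Lemma block_scale_le (k j n : nat) h : k = block n -> 3 <= ln n%:R :> R -> 0 < h ->
  (0 < j)%N -> h <= 2 ^- j -> 2 ^- j <= 2 * h ->
  2 ^+ k / 2 ^+ j * (1 + j%:R + ln k.+1%:R) <= 24 * (n%:R * h * LL n h) :> R.
Proof.
move=> -> l3 h0 j0 hj jh.
have n1 : (1 < n)%N.
  by rewrite ltnNge; apply: contraPN l3; case: n => [|[|//]] _; rewrite ?ln1 ?ln0//; lra.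
have L1 : ln h^-1 <= LL n h by rewrite le_max lexx.
have L2 : ln (ln n%:R) <= LL n h by rewrite le_max lexx orbT.
have jL : j%:R <= 2 * ln h^-1 :> R.
  rewrite -ler_pdivrMl// mulrC; apply: (@le_trans _ _ (j%:R * ln 2)).
    by rewrite ler_wpM2l// ln2_ge_half.
  rewrite mulrC mulr_natr -lnXn// ler_ln ?posrE ?exprn_gt0 ?invr_gt0//.
  by rewrite -[leLHS]invrK lef_pV2 ?posrE ?invr_gt0 ?exprn_gt0.
have j1 : 1 <= j%:R :> R by rewrite ler1n.
have lk : 0 <= ln (block n).+1%:R :> R by rewrite ln_ge0// ler1n.
have lb := ln_block l3.
have n0 : 0 <= n%:R :> R by [].
rewrite [leRHS](_ : _ = (2 * n%:R * (2 * h)) * (6 * LL n h)); last by ring.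
apply: ler_pM.
- by rewrite divr_ge0 ?exprn_ge0.
- by rewrite !addr_ge0.
- by rewrite ler_pM ?exprn_ge0 ?invr_ge0 ?exprn_ge0 ?block_le.
- by lra.
Qed.

Lemma LL_ge0 n h : 3 <= ln n%:R :> R -> 0 <= LL n h.
Proof. by move=> l3; rewrite le_max (@ln_ge0 _ (ln n%:R)) ?orbT//; lra. Qed.

End bandwidth.

Section uniform_in_bandwidth.
Context {R : realType} {d : nat}.
Hypothesis d0 : (0 < d)%N.
Variables (nu : probability (R * 'rV[R]_d)%type R)
  (mu : probability (path_space (R * 'rV[R]_d)%type) R).
Hypothesis iid_mu : iid_law nu mu.
Variable K : 'rV[R]_d -> R.
Hypotheses (mK : measurable_fun [set: 'rV[R]_d] K)
  (hK2 : kernel_cond_ii K) (hK3 : kernel_cond_iii K) (hK4 : kernel_cond_iv K)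
  (sK : kernel_support K).
Hypothesis kappa0 : 0 < kernel_bound K.

(** A sample size [n] in block [k] and a bandwidth [h] with
    [2 ^- (j + 1) < h <= 2 ^- j] satisfy [2 ^ k / 2 ^ j <= 4 n h] and
    [1 + j + ln k = O (LL n h)], so that the bound of each dyadic cell is the
    wanted function of [n] and [h]. *)
Lemma uniform_in_bandwidth (Psi : nat -> R * 'rV[R]_d -> R) (tau : nat -> R) (s D c1 t0 : R)
    (a : nat -> R) :
  (forall k, measurable_fun setT (Psi k)) -> (forall k t, `|Psi k t| <= tau k) ->
  0 < t0 -> (forall k, t0 <= tau k) -> 0 <= D -> 0 < c1 -> 0 < s ->
  (forall k c rho, 0 < rho ->
     \int[nu]_t (Psi k t ^+ 2 * \1_(cube c rho) t.2) <= s * rho ^+ d) ->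
  (\forall n \near \oo, forall h, a n <= h ->
     c1 * (block n)%:R * tau (block n) ^+ 2 <= 2 ^+ block n * h) ->
  exists2 C : R, 0 <= C & {ae mu, forall z : path_space (R * 'rV[R]_d)%type,
    \forall n \near \oo, forall (x : 'rV[R]_d) (h : R),
    (forall i, `|x ord0 i| <= D) -> a n <= h <= 2^-1 ->
    `|\sum_(i < n) (Psi (block n) (z i) * scaled_kernel K x h (z i).2 -
        \int[nu]_t (Psi (block n) t * scaled_kernel K x h t.2))| <=
    C * Num.sqrt (n%:R * h * LL n h)}.
Proof.
move=> mPsi Ptau t00 ttau D0 c10 s0 Ps ha.
have tau0 k : 0 < tau k by exact: lt_le_trans (ttau k).
have [C C0 hC] := dyadic_uniform_bound d0 iid_mu mK hK2 hK3 hK4 sK kappa0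
  mPsi Ptau tau0 D0 c10 s0 Ps.
exists (C * Num.sqrt 24); first by rewrite mulr_ge0// sqrtr_ge0.
apply: filterS hC => z [k0 hk0].
pose k1 := (Num.trunc (c1 * t0 ^+ 2)^-1).+1.
near=> n => x h xD /andP[ah h2].
have l3 : 3 <= ln n%:R :> R by near: n; exact: near_ln.
have k1n : (k1 <= block n)%N by near: n; exact: near_block.
have han : c1 * (block n)%:R * tau (block n) ^+ 2 <= 2 ^+ block n * h.
  by move: h ah {h2}; near: n.
have ct : 0 < c1 * t0 ^+ 2 by rewrite mulr_gt0// exprn_gt0.
have kh1 : 1 <= 2 ^+ block n * h.
  apply: le_trans han; apply: (@le_trans _ _ (c1 * k1%:R * t0 ^+ 2)).
    rewrite mulrAC -ler_pdivrMl// mulr1; exact: ltW (truncnS_gt _).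
  apply: ler_pM; rewrite ?mulr_ge0 ?exprn_ge0 ?(ltW c10) ?(ltW t00)//.
    by rewrite ler_wpM2l ?(ltW c10)// ler_nat.
  by rewrite ler_pXn2r// ?nnegrE ltW.
have h0 : 0 < h by rewrite -(@pmulr_rgt0 _ (2 ^+ block n)) ?exprn_gt0// (lt_le_trans _ kh1).
have [|j [j0 hj jh]] := @dyadic_scale _ h; first by rewrite h0.
have jk : (j <= block n)%N.
  rewrite -(@leq_exp2l 2)// -(ler_nat R) !natrX.
  rewrite -[leLHS]mulr1; apply: le_trans (ler_wpM2l _ kh1) _; first by rewrite exprn_ge0.
  rewrite mulrCA ger_pMr ?exprn_gt0//.
  by rewrite -ler_pdivlMl ?exprn_gt0// mulr1.
apply: le_trans (hk0 (block n) _ j jk _ x h n xD _ _) _.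
- by near: n; exact: near_block.
- by apply: le_trans han _; rewrite ler_wpM2l// exprn_ge0.
- by rewrite h0.
- exact: up_logP.
rewrite -[leRHS]mulrA -sqrtrM// ler_wpM2l// ler_wsqrtr//.
exact: block_scale_le.
Unshelve. all: by end_near. Qed.

End uniform_in_bandwidth.

(** * Regularity of the density near a compact set *)

Section density_regularity.
Context {R : realType} {d : nat}.
Implicit Types (x y : 'rV[R]_d).

Lemma rV_norm_le x r : 0 <= r -> (forall i, `|x ord0 i| <= r) -> `|x| <= r.
Proof.
move=> r0 xr; rewrite -[leLHS]/(mx_norm x) mx_normrE; apply: bigmax_le => //.
by move=> [i j] _ /=; rewrite ord1.
Qed.

Lemma coord_le_rV_norm x i : `|x ord0 i| <= `|x|.
Proof.
rewrite -[leRHS]/(mx_norm x) mx_normrE.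
by apply: (@le_bigmax _ _ _ _ (fun ij => `|x ij.1 ij.2|) (ord0, i)).
Qed.

Variables (I : set 'rV[R]_d) (cptI : compact I) (eps : R) (eps0 : 0 < eps)
  (f : 'rV[R]_d -> R).
Local Notation J := (closed_nbhd I eps).
Hypotheses (fc : {within J, continuous f}) (fp : forall x, J x -> 0 < f x).

Lemma sub_closed_nbhd : I `<=` J.
Proof. by move=> x Ix; exists x => //; rewrite subrr normr0 ltW. Qed.

Lemma density_near x w : I x -> 0 < w ->
  exists2 r, 0 < r & forall y, J y -> `|x - y| < r -> `|f y - f x| < w.
Proof.
move=> Ix w0; have /subspace_continuousP/(_ x (sub_closed_nbhd Ix)) fx := fc.
have : within J (nbhs x) (f @^-1` ball (f x) w).
  by apply: fx; exact: nbhsx_ballx.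
rewrite /within /= => /nbhs_ballP[e /= e0 he].
exists e => // y Jy xy; have := he y.
by rewrite -!ball_normE /ball_ /= (distrC (f x)); exact.
Qed.

Lemma density_bounds : exists2 a : R, 0 < a & forall x, I x -> a <= f x <= a^-1.
Proof.
have := cptI; rewrite compact_near_coveringP.
move=> /(_ R 0^'+ (fun a x => I x -> 0 < a /\ a <= f x <= a^-1)) [|e /= e0 he].
- move=> x Ix; have fx0 : 0 < f x by apply: fp; exact: sub_closed_nbhd.
  have fx2 : 0 < f x / 2 by rewrite divr_gt0.
  have [r r0 hr] := density_near Ix fx2.
  exists (ball x r, [set a | 0 < a /\ a <= Num.min (f x / 2) (2 * f x)^-1]) => /=.
    split; first exact: nbhsx_ballx.
    apply: filterI; first exact: nbhs_right_gt.
    by apply: nbhs_right_le; rewrite lt_min fx2 invr_gt0 mulr_gt0.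
  move=> [x' a] [/= xx' [a0 am]] Ix'; move: am; rewrite le_min => /andP[a1 a2].
  have := hr x' (sub_closed_nbhd Ix'); move: xx'; rewrite -ball_normE /ball_/= => xx' /(_ xx').
  rewrite ltr_distl => /andP[h1 h2].
  have : 2 * f x <= a^-1 by rewrite -[leLHS]invrK lef_pV2 ?posrE ?invr_gt0 ?mulr_gt0.
  by move=> h3; split => //; apply/andP; split; lra.
exists (e / 2); first by rewrite divr_gt0.
move=> x Ix; have [||//] := he (e / 2) _ _ x Ix Ix; last by rewrite divr_gt0.
by rewrite /ball_/= sub0r normrN gtr0_norm ?divr_gt0// ltr_pdivrMr// ltr_pMr// ltr1n.
Qed.

(** The continuity of [f] is uniform up to the boundary of [I], from inside
    [J]. *)
Lemma density_uniform w : 0 < w -> exists2 r, 0 < r & forall x y, I x ->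
  `|x - y| <= r -> J y /\ `|f y - f x| <= w.
Proof.
move=> w0; have := cptI; rewrite compact_near_coveringP.
move=> /(_ R 0^'+ (fun r x => I x -> 0 < r <= eps /\ forall y, J y -> `|x - y| <= r -> `|f y - f x| <= w)) [|e /= e0 he].
- move=> x Ix; have w2 : 0 < w / 2 by rewrite divr_gt0.
  have [r r0 hr] := density_near Ix w2.
  have r2 : 0 < r / 2 by rewrite divr_gt0.
  exists (ball x (r / 2), [set a | 0 < a /\ a < Num.min (r / 2) eps]) => /=.
    split; first exact: nbhsx_ballx.
    apply: filterI; first exact: nbhs_right_gt.
    by apply: nbhs_right_lt; rewrite lt_min r2.
  move=> [x' a] [/= xx' [a0 am]] Ix'; move: am; rewrite lt_min => /andP[a1 a2].
  move: xx'; rewrite -ball_normE /ball_/= => xx'.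
  split=> [|y Jy x'y]; first by rewrite a0 ltW.
  have h1 : `|f x' - f x| < w / 2 by apply: hr => //; [exact: sub_closed_nbhd|lra].
  have h2 : `|f y - f x| < w / 2.
    apply: hr => //; rewrite -(subrKA x') (le_lt_trans (ler_normD _ _))//; lra.
  by rewrite -(subrKA (f x)) (le_trans (ler_normD _ _))// (distrC (f x)); lra.
have e2 : 0 < e / 2 by rewrite divr_gt0.
exists (e / 2) => // x y Ix xy.
have [||/andP[_ ee] h] := he (e / 2) _ _ x Ix Ix => //.
  by rewrite /ball_/= sub0r normrN gtr0_norm// ltr_pdivrMr// ltr_pMr// ltr1n.
have Jy : J y by exists x => //; rewrite distrC (le_trans xy).
by split => //; exact: h.
Qed.

(** Near [I] all that the proof uses of the density: a neighbourhood on which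
    it is bounded, a positive lower bound on [I], and uniform continuity. *)
Lemma regularity_near : exists (J0 : set 'rV[R]_d) (a F rho0 D : R),
  [/\ measurable J0, J0 `<=` J, 0 < a, 0 < F & 0 < rho0] /\
  [/\ forall y, J0 y -> f y <= F, forall x, I x -> a <= f x <= F,
    forall x, I x -> cube x rho0 `<=` J0,
    0 <= D /\ forall x, I x -> forall i, `|x ord0 i| <= D &
    forall w, 0 < w -> exists2 r, 0 < r & forall x y, I x -> cube x r y ->
      `|f y - f x| <= w].
Proof.
have [a a0 fa] := density_bounds.
have [r r0 hr] := density_uniform ltr01.
have [D [_ hD]] := compact_bounded cptI.
have cubeN x y t : 0 <= t -> cube x t y -> `|x - y| <= t.
  by move=> t0 xy; apply: rV_norm_le => // i; rewrite !mxE distrC; exact: xy.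
exists (\bigcup_(x in I) ball x r), a, (a^-1 + 1), (r / 2), (`|D| + 1).
have r2 : 0 < r / 2 by rewrite divr_gt0.
split; split => //.
- by apply: sub_sigma_algebra; apply: bigcup_open => x _; exact: ball_open.
- move=> y [x Ix]; rewrite -ball_normE /ball_/= => /ltW xy.
  by have [] := hr x y Ix xy.
- by rewrite addr_gt0// invr_gt0.
- move=> y [x Ix]; rewrite -ball_normE /ball_/= => /ltW xy.
  have [_ /ler_distlDr] := hr x y Ix xy.
  by have /andP[_ ?] := fa x Ix; move=> ?; lra.
- by move=> x /fa/andP[-> /=]; lra.
- move=> x Ix y /(cubeN _ _ _ (ltW r2)) xy; exists x => //.
  rewrite -ball_normE /ball_/=; apply: le_lt_trans xy _.
  by rewrite ltr_pdivrMr// ltr_pMr// ltr1n.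
- split=> [|x Ix i]; first by rewrite addr_ge0.
  apply: le_trans (coord_le_rV_norm x i) _; apply: (hD (`|D| + 1)) Ix.
  by rewrite (le_lt_trans (ler_norm _))// ltrDl.
- move=> w w0; have [t t0 ht] := density_uniform w0.
  by exists t => // x y Ix /(cubeN _ _ _ (ltW t0)) xy; have [] := ht x y Ix xy.
Qed.

End density_regularity.

(** * Moments of the response over small cubes *)

Section local_moments.
Context {R : realType} {d : nat}.
Hypothesis d0 : (0 < d)%N.
Variables (nu : probability (R * 'rV[R]_d)%type R) (f : 'rV[R]_d -> R)
  (J0 : set 'rV[R]_d) (F alpha p : R).
Hypotheses (mf : measurable_fun setT f) (f0 : forall x, 0 <= f x)
  (nuf : forall B, measurable B ->
    nu (snd @^-1` B) = (\int[lebesgue_rV d]_(x in B) (f x)%:E)%E)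
  (mJ0 : measurable J0) (fF : forall y, J0 y -> f y <= F) (F0 : 0 < F)
  (alpha0 : 0 <= alpha)
  (mom : forall B, measurable B -> B `<=` J0 ->
    (\int[nu]_(t in snd @^-1` B) (`|t.1| `^ p)%:E <= alpha%:E * nu (snd @^-1` B))%E).

Lemma measurable_fiber (B : set 'rV[R]_d) : measurable B ->
  measurable (snd @^-1` B : set (R * 'rV[R]_d)).
Proof. by move=> mB; rewrite -[X in measurable X]setTI; exact: measurable_snd. Qed.

Lemma measurable_moment : measurable_fun setT (fun t : R * 'rV[R]_d => `|t.1| `^ p).
Proof.
apply: (measurableT_comp (measurable_powR p)).
by apply: measurableT_comp => //; exact: measurable_fst.
Qed.

Lemma local_mass c rho : 0 < rho ->
  (nu (snd @^-1` (J0 `&` cube c rho)) <= (F * (2 * rho) ^+ d)%:E)%E.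
Proof.
move=> rho0; have mB : measurable (J0 `&` cube c rho).
  by apply: measurableI => //; exact: measurable_cube.
rewrite nuf//; apply: (@le_trans _ _ (\int[lebesgue_rV d]_(x in J0 `&` cube c rho) F%:E)%E).
  apply: ge0_le_integral => //.
  - by move=> x _; rewrite lee_fin.
  - by apply/measurable_EFinP; exact: measurable_funTS.
  - by move=> x [/fF]; rewrite lee_fin.
rewrite integral_cst// EFinM; apply: lee_wpmul2l; first by rewrite lee_fin ltW.
rewrite -(lebesgue_rV_cube c rho0); apply: le_measure; rewrite ?inE//.
exact: measurable_cube.
Qed.

Lemma local_moment_le c rho (Psi : R * 'rV[R]_d -> R) : 0 < rho ->
  measurable_fun setT Psi -> (forall t, 0 <= Psi t <= (1 + `|t.1| `^ p) * \1_J0 t.2) ->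
  (\int[nu]_t (Psi t * \1_(cube c rho) t.2)%:E <=
    ((1 + alpha) * (F * 2 ^+ d) * rho ^+ d)%:E)%E.
Proof.
move=> rho0 mPsi Psib; pose B := J0 `&` cube c rho.
have mB : measurable B by apply: measurableI => //; exact: measurable_cube.
have mfB := measurable_fiber mB.
have mfC : measurable_fun setT (fun t : R * 'rV[R]_d => (Psi t * \1_(cube c rho) t.2)%:E).
  apply/measurable_EFinP; apply: measurable_funM => //.
  apply: (measurableT_comp (f := \1_(cube c rho) : 'rV[R]_d -> R)); last exact: measurable_snd.
  by apply: measurable_indic; exact: measurable_cube.
rewrite (_ : integral _ _ _ = \int[nu]_(t in snd @^-1` B) (Psi t * \1_(cube c rho) t.2)%:E)%E; last first.
  rewrite [RHS]integral_mkcond; apply: eq_integral => t _; rewrite patchE.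
  case: ifPn => // /negP; rewrite inE/= => nB.
  have [Ct|nC] := pselect (cube c rho t.2); last by rewrite indicE memNset// mulr0.
  have nJ : ~ J0 t.2 by move=> Jt; apply: nB; split.
  have := Psib t; rewrite [X in _ * X]indicE memNset// mulr0 => h.
  have -> : Psi t = 0 by apply/eqP; rewrite eq_le andbC.
  by rewrite mul0r.
apply: (@le_trans _ _ (\int[nu]_(t in snd @^-1` B) (1%:E + (`|t.1| `^ p)%:E))%E).
  apply: ge0_le_integral => //.
  - by move=> t _; rewrite lee_fin mulr_ge0//; have /andP[] := Psib t.
  - exact: measurable_funTS.
  - apply: measurable_funTS; apply: emeasurable_funD => //.
    by apply/measurable_EFinP; exact: measurable_moment.
  - move=> t [Jt Ct]; rewrite -EFinD lee_fin indicE mem_set// mulr1.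
    by have /andP[_] := Psib t; rewrite indicE mem_set// mulr1.
rewrite ge0_integralD//; last first.
  by apply/measurable_EFinP; apply: measurable_funTS; exact: measurable_moment.
rewrite integral_cst// mul1e.
have h1 := local_mass c rho0; rewrite -/B in h1.
have h2 : (\int[nu]_(t in snd @^-1` B) (`|t.1| `^ p)%:E <= alpha%:E * (F * (2 * rho) ^+ d)%:E)%E.
  by apply: le_trans (mom mB _) _; [exact: subIsetl|rewrite lee_wpmul2l ?lee_fin].
apply: le_trans (leeD h1 h2) _; rewrite -EFinM -EFinD lee_fin exprMn.
by rewrite le_eqVlt; apply/orP; left; apply/eqP; ring.
Qed.

Lemma local_moment_expect_le c rho (Psi : R * 'rV[R]_d -> R) : 0 < rho ->
  measurable_fun setT Psi -> (forall t, 0 <= Psi t <= (1 + `|t.1| `^ p) * \1_J0 t.2) ->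
  \int[nu]_t (Psi t * \1_(cube c rho) t.2) <= (1 + alpha) * (F * 2 ^+ d) * rho ^+ d.
Proof.
move=> rho0 mPsi Psib; have h := local_moment_le c rho0 mPsi Psib.
have i0 : (0 <= \int[nu]_t (Psi t * \1_(cube c rho) t.2)%:E)%E.
  by apply: integral_ge0 => t _; rewrite lee_fin mulr_ge0//; have /andP[] := Psib t.
rewrite /Rintegral -lee_fin fineK// ge0_fin_numE//.
by apply: le_lt_trans h _; rewrite ltry.
Qed.

End local_moments.

(** * Truncation of the response *)

Lemma sqr_le_powR (R : realType) (p y : R) : 2 <= p -> y ^+ 2 <= 1 + `|y| `^ p.
Proof.
move=> p2; rewrite -real_normK ?num_real//.
have [y1|/ltW y1] := leP `|y| 1.
  by rewrite (@le_trans _ _ 1) ?expr_le1// lerDl powR_ge0.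
rewrite -powR_mulrn//; apply: (@le_trans _ _ (`|y| `^ p)); first exact: ler_powR.
by rewrite lerDr.
Qed.

Lemma norm_le_powR (R : realType) (p y : R) : 2 <= p -> `|y| <= 1 + `|y| `^ p.
Proof.
move=> p2; have [y1|/ltW y1] := leP `|y| 1.
  by rewrite (le_trans y1)// lerDl powR_ge0.
rewrite -[leLHS]powRr1//; apply: (@le_trans _ _ (`|y| `^ p)).
  by apply: ler_powR => //; lra.
by rewrite lerDr.
Qed.

Section truncation.
Context {R : realType} {d : nat}.
Hypothesis d0 : (0 < d)%N.
Variables (nu : probability (R * 'rV[R]_d)%type R)
  (mu : probability (path_space (R * 'rV[R]_d)%type) R).
Hypothesis iid_mu : iid_law nu mu.
Variable K : 'rV[R]_d -> R.
Hypotheses (mK : measurable_fun [set: 'rV[R]_d] K)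
  (hK2 : kernel_cond_ii K) (hK3 : kernel_cond_iii K) (hK4 : kernel_cond_iv K)
  (sK : kernel_support K).
Local Notation kappa := (kernel_bound K).
Hypothesis kappa0 : 0 < kappa.
Variables (J0 : set 'rV[R]_d) (mJ0 : measurable J0).

Definition truncated (tau : R) (t : R * 'rV[R]_d) : R :=
  if (`|t.1| <= tau) && (t.2 \in J0) then t.1 else 0.

Definition excess (tau : R) (t : R * 'rV[R]_d) : R :=
  if (tau < `|t.1|) && (t.2 \in J0) then `|t.1| else 0.

Lemma measurable_fun_inJ0 : measurable_fun setT (fun t : R * 'rV[R]_d => t.2 \in J0).
Proof.
apply: (measurable_fun_bool true) => //.
rewrite setTI (_ : _ @^-1` _ = snd @^-1` J0); first exact: measurable_fiber.
by apply/seteqP; split=> t /=; [exact: set_mem|exact: mem_set].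
Qed.

Let mnorm : measurable_fun setT (fun t : R * 'rV[R]_d => `|t.1|).
Proof. by apply: measurableT_comp => //; exact: measurable_fst. Qed.

Lemma measurable_truncated tau : measurable_fun setT (truncated tau).
Proof.
apply: measurable_fun_ifT => //.
by apply: measurable_and; [exact: measurable_fun_ler mnorm (measurable_cst _)|exact: measurable_fun_inJ0].
Qed.

Lemma measurable_excess tau : measurable_fun setT (excess tau).
Proof.
apply: measurable_fun_ifT => //.
by apply: measurable_and; [exact: measurable_fun_ltr (measurable_cst _) mnorm|exact: measurable_fun_inJ0].
Qed.

Lemma excess_ge0 tau t : 0 <= excess tau t.
Proof. by rewrite /excess; case: ifP. Qed.

Lemma truncated_le tau t : 0 <= tau -> `|truncated tau t| <= tau.
Proof. by move=> tau0; rewrite /truncated; case: ifPn => [/andP[]//|]; rewrite normr0. Qed.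

Lemma truncated_sqr_le tau p t : 2 <= p ->
  0 <= truncated tau t ^+ 2 <= (1 + `|t.1| `^ p) * \1_J0 t.2.
Proof.
move=> p2; rewrite sqr_ge0/= /truncated; case: ifPn => [/andP[_ tJ]|_].
  by rewrite indicE tJ mulr1; exact: sqr_le_powR.
by rewrite expr0n mulr_ge0// addr_ge0// powR_ge0.
Qed.

(** For a window inside [J0] truncating the response costs at most [kappa]
    times its excess. *)
Lemma truncation_error tau x h rho0 t : cube x rho0 `<=` J0 -> 0 < h ->
  root_d d h <= rho0 ->
  `|t.1 * scaled_kernel K x h t.2 - truncated tau t * scaled_kernel K x h t.2| <=
    kappa * excess tau t.
Proof.
move=> xJ h0 hr; have [->|/(scaled_kernel_support sK h0) g0] := eqVneq (scaled_kernel K x h t.2) 0.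
  by rewrite !mulr0 subrr normr0 mulr_ge0 ?excess_ge0// ltW.
have tJ : t.2 \in J0.
  rewrite inE; apply: xJ => i; apply: le_trans (g0 i) _; apply: le_trans hr.
  by rewrite ler_pdivrMr// ler_peMr ?ler1n// ltW// root_d_gt0.
rewrite -mulrBl normrM mulrC; apply: ler_pM => //; first exact: (kernel_le_bound hK2).
rewrite /truncated /excess tJ !andbT (leNgt _ tau); case: (tau < `|t.1|) => /=; first by rewrite subr0.
by rewrite subrr normr0.
Qed.

Hypothesis iY : nu.-integrable setT (fun t => (t.1)%:E).

Lemma integrable_excess tau : nu.-integrable setT (fun t => (excess tau t)%:E).
Proof.
apply: le_integrable iY => //; first by apply/measurable_EFinP; exact: measurable_excess.
move=> t _; rewrite !abse_EFin lee_fin ger0_norm ?excess_ge0//.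
by rewrite /excess; case: ifP.
Qed.

Lemma integrable_response x h :
  nu.-integrable setT (fun t => (t.1 * scaled_kernel K x h t.2)%:E).
Proof.
have := integrableZl measurableT kappa iY.
apply: le_integrable => //.
  apply/measurable_EFinP; apply: measurable_funM; first exact: measurable_fst.
  by apply: (measurableT_comp (f := scaled_kernel K x h)); [exact: measurable_scaled_kernel|exact: measurable_snd].
move=> t _; rewrite -EFinM !abse_EFin lee_fin !normrM mulrC ler_wpM2r//.
by rewrite (ger0_norm (ltW kappa0)); exact: (kernel_le_bound hK2).
Qed.

Lemma bdd_measurable_truncated tau x h : 0 <= tau ->
  bdd_measurable (fun t => truncated tau t * scaled_kernel K x h t.2).
Proof.
move=> tau0; apply: bdd_measurableM.
  by split; [exact: measurable_truncated|exists tau => t; exact: truncated_le].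
apply: (@bdd_measurable_comp _ _ _ _ _ snd (scaled_kernel K x h)); first exact: measurable_snd.
by split; [apply: measurable_scaled_kernel|exists kappa => y; exact: (kernel_le_bound hK2)].
Qed.

Lemma expected_truncation_error tau x h rho0 : 0 <= tau -> cube x rho0 `<=` J0 -> 0 < h ->
  root_d d h <= rho0 ->
  `|\int[nu]_t (t.1 * scaled_kernel K x h t.2) -
    \int[nu]_t (truncated tau t * scaled_kernel K x h t.2)| <=
  kappa * \int[nu]_t excess tau t.
Proof.
move=> tau0 xJ h0 hr.
have bt := bdd_measurable_integrable nu (bdd_measurable_truncated x h tau0).
have iB := integrableB measurableT (integrable_response x h) bt.
have iB' : nu.-integrable setT (EFin \o (fun t => t.1 * scaled_kernel K x h t.2 - truncated tau t * scaled_kernel K x h t.2)).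
  by apply: eq_integrable iB.
rewrite -RintegralB//; last exact: integrable_response.
apply: le_trans (le_normr_Rintegral measurableT iB') _.
rewrite -RintegralZl//; last exact: integrable_excess.
apply: le_Rintegral => //.
- by have := integrable_norm iB'; apply: eq_integrable.
- by have := integrableZl measurableT kappa (integrable_excess tau); apply: eq_integrable.
- by move=> t _; exact: truncation_error xJ h0 hr.
Qed.

Variables (f : 'rV[R]_d -> R) (F alpha p : R).
Hypotheses (mf : measurable_fun setT f) (f0 : forall x, 0 <= f x)
  (nuf : forall B, measurable B ->
    nu (snd @^-1` B) = (\int[lebesgue_rV d]_(x in B) (f x)%:E)%E)
  (fF : forall y, J0 y -> f y <= F) (F0 : 0 < F)
  (alpha0 : 0 <= alpha) (p2 : 2 <= p)
  (mom : forall B, measurable B -> B `<=` J0 ->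
    (\int[nu]_(t in snd @^-1` B) (`|t.1| `^ p)%:E <= alpha%:E * nu (snd @^-1` B))%E).

Local Notation S0 := ((1 + alpha) * (F * 2 ^+ d)).

Lemma numerator_deviation (tau a : nat -> R) (t0 c1 D Cr rho0 : R) :
  0 < t0 -> (forall k, t0 <= tau k) -> 0 <= D -> 0 < c1 ->
  (\forall n \near \oo, forall h, a n <= h ->
     c1 * (block n)%:R * tau (block n) ^+ 2 <= 2 ^+ block n * h) ->
  0 <= Cr ->
  {ae mu, forall z : path_space (R * 'rV[R]_d)%type, \forall n \near \oo, forall h, a n <= h <= 2^-1 ->
    \sum_(i < n) excess (tau (block n)) (z i) + n%:R * \int[nu]_t excess (tau (block n)) t <=
    Cr * Num.sqrt (n%:R * h * LL n h)} ->
  exists2 C : R, 0 <= C & {ae mu, forall z : path_space (R * 'rV[R]_d)%type,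
    \forall n \near \oo, forall (x : 'rV[R]_d) (h : R),
    (forall i, `|x ord0 i| <= D) -> cube x rho0 `<=` J0 -> 0 < h ->
    root_d d h <= rho0 -> a n <= h <= 2^-1 ->
    `|\sum_(i < n) (z i).1 * scaled_kernel K x h (z i).2 -
        n%:R * \int[nu]_t (t.1 * scaled_kernel K x h t.2)| <=
    C * Num.sqrt (n%:R * h * LL n h)}.
Proof.
move=> t00 ttau D0 c10 ha Cr0 hex.
have tau0 k : 0 <= tau k by rewrite (le_trans (ltW t00)).
have s0 : 0 < S0.
  by apply: mulr_gt0; [exact: ltr_pwDl|rewrite mulr_gt0 ?exprn_gt0].
have [|C C0 hC] := @uniform_in_bandwidth R d d0 nu mu iid_mu K mK hK2 hK3 hK4 sK kappa0
  (fun k => truncated (tau k)) tau S0 D c1 t0 a (fun k => measurable_truncated (tau k))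
  (fun k t => truncated_le t (tau0 k)) t00 ttau D0 c10 s0 _ ha.
  move=> k c rho rho0'; apply: (local_moment_expect_le mf f0 nuf mJ0 fF F0 alpha0 mom) => //.
    by apply: measurable_funX; exact: measurable_truncated.
  by move=> t; exact: truncated_sqr_le.
exists (C + kappa * Cr); first by rewrite addr_ge0// mulr_ge0// ltW.
apply: filterS2 hC hex => z hCz hez.
near=> n => x h xD xJ h0 hr ah.
have h1 : `|\sum_(i < n) (truncated (tau (block n)) (z i) * scaled_kernel K x h (z i).2 -
    \int[nu]_t (truncated (tau (block n)) t * scaled_kernel K x h t.2))| <=
    C * Num.sqrt (n%:R * h * LL n h).
  by move: x h xD ah {h0 hr xJ}; near: n.
have h2 : \sum_(i < n) excess (tau (block n)) (z i) + n%:R * \int[nu]_t excess (tau (block n)) t <=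
    Cr * Num.sqrt (n%:R * h * LL n h).
  by move: h ah {h1 h0 hr}; near: n.
set q := Num.sqrt _ in h1 h2 *.
set T := truncated _ in h1; set e := excess _ in h2.
pose g := scaled_kernel K x h.
rewrite -/g.
have -> : \sum_(i < n) (z i).1 * g (z i).2 - n%:R * \int[nu]_t (t.1 * g t.2) =
  \sum_(i < n) (T (z i) * g (z i).2 - \int[nu]_t (T t * g t.2)) +
  (\sum_(i < n) ((z i).1 * g (z i).2 - T (z i) * g (z i).2) -
   n%:R * (\int[nu]_t (t.1 * g t.2) - \int[nu]_t (T t * g t.2))).
  rewrite !sumrB sumr_const card_ord -[_ *+ n]mulr_natl; ring.
rewrite mulrDl (le_trans (ler_normD _ _))// lerD//.
rewrite (le_trans (ler_normB _ _))// -mulrA.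
apply: le_trans (ler_wpM2l (ltW kappa0) h2); rewrite [leRHS]mulrDr lerD//.
  rewrite (le_trans (ler_norm_sum _ _ _))// mulr_sumr ler_sum// => i _.
  exact: truncation_error xJ h0 hr.
rewrite normrM ger0_norm// mulrCA ler_wpM2l//.
exact: expected_truncation_error xJ h0 hr.
Unshelve. all: by end_near. Qed.

End truncation.

(** * Truncation levels and bandwidths *)

Section truncation_levels.
Context {R : realType}.
Implicit Types (n k : nat) (h p : R).

Lemma ln_le_natr n : ln n%:R <= n%:R :> R.
Proof.
case: n => [|n]; first by rewrite ln0.
by have := @ln_sublinear R n.+1%:R; rewrite ltr0n => /(_ isT)/ltW.
Qed.

Lemma ln_ge1_gt1 n : 1 <= ln n%:R :> R -> (1 < n)%N.
Proof. by case: n => [|[|//]]; rewrite ?ln1 ?ln0// ler10. Qed.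

Lemma near_block_le_ln : \forall n \near \oo, (block n).+1%:R <= 8 * ln n%:R :> R.
Proof.
near=> n; have l1 : 1 <= ln n%:R :> R by near: n; exact: near_ln.
have n1 := ln_ge1_gt1 l1.
by have := @block_ln R n n1; rewrite -[X in _ -> X <= _]natr1; lra.
Unshelve. all: by end_near. Qed.

Lemma near_nat_gt0 : \forall n \near \oo, (0 < n%:R :> R).
Proof. by exists 1%N => // n /=; rewrite ltr0n. Qed.

(** With [h >= ln n / n] a block of [2 ^ k] points puts order [k] of them into
    a window. *)
Lemma near_block_le_bandwidth : \forall n \near \oo, forall h, ln n%:R / n%:R <= h ->
  8^-1 * (block n).+1%:R <= 2 ^+ block n * h :> R.
Proof.
near=> n => h nh.
have n0 : 0 < n%:R :> R by near: n; exact: near_nat_gt0.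
have l1 : 1 <= ln n%:R :> R by near: n; exact: near_ln.
have bl : (block n).+1%:R <= 8 * ln n%:R :> R by near: n; exact: near_block_le_ln.
rewrite ler_pdivrMl//; apply: le_trans bl _; rewrite ler_wpM2l//.
rewrite ler_pdivrMr// in nh.
have h0 : 0 <= h by rewrite -(pmulr_lge0 _ n0) (le_trans _ nh)// (le_trans _ l1).
apply: le_trans nh _.
by rewrite mulrC ler_wpM2r// le_block.
Unshelve. all: by end_near. Qed.

Lemma near_LL_le (a : nat -> R) : (\forall n \near \oo, n%:R^-1 <= a n) ->
  \forall n \near \oo, forall h, a n <= h -> LL n h <= ln n%:R.
Proof.
move=> ha; near=> n => h ah.
have n0 : 0 < n%:R :> R by near: n; exact: near_nat_gt0.
have l1 : 1 <= ln n%:R :> R by near: n; exact: near_ln.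
have na : n%:R^-1 <= h by apply: le_trans ah; near: n.
have h0 : 0 < h by apply: lt_le_trans na; rewrite invr_gt0.
rewrite ge_max; apply/andP; split.
  by rewrite ler_ln ?posrE ?invr_gt0// -[leRHS]invrK lef_pV2 ?posrE ?invr_gt0.
apply: ltW; apply: ln_sublinear; lra.
Unshelve. all: by end_near. Qed.

Lemma near_LL_ge1 : \forall n \near \oo, forall h, 1 <= LL n h.
Proof.
near=> n => h; rewrite le_max; apply/orP; right.
have : expR 1 <= ln n%:R :> R by near: n; exact: near_ln.
move=> le1; rewrite -[leLHS]expRK ler_ln ?posrE ?expR_gt0//.
exact: lt_le_trans (expR_gt0 _) le1.
Unshelve. all: by end_near. Qed.

Variable p : R.
Hypothesis p2 : 2 < p.
Local Notation gamma := (1 - 2 / p).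

Definition level k : R := (2 ^+ k / k.+1%:R) `^ p^-1.

Let p0 : 0 < p. Proof. by apply: lt_trans p2. Qed.

Let gamma01 : 0 < gamma <= 1.
Proof.
rewrite subr_gt0 ltr_pdivrMr// mul1r p2/= lerBlDr lerDl.
by rewrite divr_ge0// ltW.
Qed.

Let r k : R := 2 ^+ k / k.+1%:R.

Let r_ge1 k : 1 <= r k.
Proof.
by rewrite /r ler_pdivlMr ?ltr0n// mul1r -natrX ler_nat; exact: ltn_expl.
Qed.

Let r_gt0 k : 0 < r k. Proof. by apply: lt_le_trans (r_ge1 k). Qed.

Lemma level_ge1 k : 1 <= level k.
Proof.
rewrite -[leLHS](powRr0 (r k)); apply: ler_powR; first exact: r_ge1.
by rewrite invr_ge0 ltW.
Qed.

Lemma levelXp k : level k `^ p * k.+1%:R = 2 ^+ k.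
Proof.
rewrite -powRrM mulVf ?gt_eqF// powRr1 ?(ltW (r_gt0 k))//.
by rewrite divfK// pnatr_eq0.
Qed.

(** The choice of the level: [(k + 1) tau ^ 2] is [2 ^ k] times the smallest
    admissible bandwidth of the block, up to a constant. *)
Lemma level_sqr k : k.+1%:R * level k ^+ 2 = 2 ^+ k / r k `^ gamma.
Proof.
rewrite -powR_mulrn ?powR_ge0// -powRrM.
have -> : p^-1 * 2 = 1 - gamma by ring.
rewrite powRB; last by rewrite (gt_eqF (r_gt0 k)) implybT.
rewrite powRr1 ?(ltW (r_gt0 k))// mulrA; congr (_ / _).
by rewrite mulrC divfK// pnatr_eq0.
Qed.

Let powR_inv (x y : R) : 0 <= x -> x^-1 `^ y = (x `^ y)^-1.
Proof. by move=> x0; rewrite -powR_inv1// powRAC powR_inv1// powR_ge0. Qed.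

Lemma near_level_le_bandwidth c : 0 < c -> \forall n \near \oo, forall h,
  c * (ln n%:R / n%:R) `^ gamma <= h ->
  c / 8 * (block n).+1%:R * level (block n) ^+ 2 <= 2 ^+ block n * h.
Proof.
move=> c0; near=> n => h ch.
have n0 : 0 < n%:R :> R by near: n; exact: near_nat_gt0.
have bl : (block n).+1%:R <= 8 * ln n%:R :> R by near: n; exact: near_block_le_ln.
have l1 : 1 <= ln n%:R :> R by near: n; exact: near_ln.
have /andP[g0 g1] := gamma01.
rewrite -mulrA level_sqr mulrCA ler_wpM2l ?exprn_ge0//.
apply: le_trans ch; rewrite -mulrA ler_wpM2l ?(ltW c0)//.
apply: (@le_trans _ _ ((8^-1 / r (block n)) `^ gamma)).
  rewrite (@powRM _ 8^-1 (r _)^-1) ?invr_ge0// ?(ltW (r_gt0 _))// (@powR_inv (r _)) ?(ltW (r_gt0 _))//.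
  rewrite ler_wpM2r ?invr_ge0 ?powR_ge0//.
  by apply: ger1_powR g1; apply/andP; split; lra.
have r0 := r_gt0 (block n).
apply: ge0_ler_powR; rewrite ?nnegrE ?(ltW g0) ?divr_ge0 ?invr_ge0 ?(ltW r0) ?(ltW n0)//; first lra.
rewrite /r invf_div mulrA ler_pdivrMr ?exprn_gt0//.
apply: (@le_trans _ _ (ln n%:R)); first lra.
rewrite mulrAC ler_pdivlMr// ler_wpM2l//; first lra.
exact: le_block.
Unshelve. all: by end_near. Qed.

(** Either [LL n h] has order [k], or [h] exceeds a small power of [2 ^ - k],
    and then [n h] exceeds [k ^ 2 tau ^ 2] with room to spare. *)
Lemma near_level_le c : 0 < c -> exists2 C : R, 0 <= C & \forall n \near \oo, forall h,
  c * (ln n%:R / n%:R) `^ gamma <= h ->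
  (block n).+1%:R * level (block n) <= C * Num.sqrt (n%:R * h * LL n h).
Proof.
move=> c0; have /andP[g0 g1] := gamma01.
pose th := gamma * ln 2 / 2 : R.
have ln20 : 0 < ln 2 :> R by rewrite ln_gt0// ltr1n.
have th0 : 0 < th by rewrite !mulr_gt0.
pose C1 := 16 / (c * th); pose C2 := 8 / th ^+ 2 * expR (2 * th).
have C10 : 0 <= C1 by rewrite divr_ge0// mulr_ge0// ltW.
have C20 : 0 <= C2 by rewrite mulr_ge0 ?expR_ge0// divr_ge0// exprn_ge0// ltW.
exists (Num.sqrt (C1 + C2)); first exact: sqrtr_ge0.
near=> n => h ch.
have n0 : 0 < n%:R :> R by near: n; exact: near_nat_gt0.
have L1 : 1 <= LL n h by move: h {ch}; near: n; exact: near_LL_ge1.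
have kh : c / 8 * (block n).+1%:R * level (block n) ^+ 2 <= 2 ^+ block n * h.
  by move: h ch {L1}; near: n; exact: near_level_le_bandwidth.
have l1 : 1 <= ln n%:R :> R by near: n; exact: near_ln.
have n1 := ln_ge1_gt1 l1.
have := @block_le R n n1; move: kh; set k := block n => kh kn.
have k0 : 0 < k.+1%:R :> R by rewrite ltr0n.
have t1 := level_ge1 k.
have h0 : 0 < h.
  rewrite -(@pmulr_rgt0 _ (2 ^+ k)) ?exprn_gt0//; apply: lt_le_trans kh.
  by rewrite !mulr_gt0 ?exprn_gt0//; lra.
have nh0 : 0 <= n%:R * h by rewrite mulr_ge0 ?ltW.
have knh : 2 ^+ k * h <= 2 * (n%:R * h) by rewrite mulrA ler_wpM2r// ltW.
rewrite -sqrtrM ?addr_ge0//.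
rewrite -[leLHS]ger0_norm ?mulr_ge0 ?(le_trans _ t1)// -sqrtr_sqr ler_wsqrtr//.
have [Lk|kL] := leP (th * k.+1%:R) (LL n h).
  apply: (@le_trans _ _ (C1 * (n%:R * h * LL n h))); last first.
    by rewrite ler_wpM2r ?lerDl// mulr_ge0//; lra.
  have ct : 0 < c * th by rewrite mulr_gt0.
  rewrite /C1 mulrAC ler_pdivlMr//.
  have -> : (k.+1%:R * level k) ^+ 2 * (c * th) =
    8 * ((c / 8 * k.+1%:R * level k ^+ 2) * (th * k.+1%:R)) by field.
  have -> : 16 * (n%:R * h * LL n h) = 8 * ((2 * (n%:R * h)) * LL n h) by ring.
  rewrite ler_wpM2l//; apply: ler_pM => //.
  - by rewrite !mulr_ge0 ?exprn_ge0 ?(le_trans _ t1) ?invr_ge0// ltW.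
  - by rewrite mulr_ge0 ?ltW.
  - exact: le_trans kh knh.
apply: (@le_trans _ _ (C2 * (n%:R * h))); last first.
  rewrite [leLHS]mulrC [leRHS](_ : _ = (n%:R * h) * ((C1 + C2) * LL n h)); last by ring.
  rewrite ler_wpM2l// -[leLHS]mulr1; apply: ler_pM => //.
  by rewrite lerDr.
have hx : expR (- (th * k.+1%:R)) <= h.
  rewrite -[leRHS]lnK ?posrE// ler_expR.
  have : ln h^-1 <= LL n h by rewrite le_max lexx.
  by rewrite lnV ?posrE//; lra.
pose x := th * k.+1%:R.
have x0 : 0 < x by rewrite mulr_gt0.
have ex : x ^+ 2 / 4 <= expR x.
  have -> : expR x = expR (x / 2) ^+ 2.
    by rewrite expr2 -expRD; congr expR; field.
  have h2 : x / 2 <= expR (x / 2) by have := expR_ge1Dx (x / 2); lra.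
  have -> : x ^+ 2 / 4 = (x / 2) ^+ 2 by field.
  by rewrite ler_pXn2r ?nnegrE ?expR_ge0//; lra.
have rg : expR (2 * x - 2 * th) / k.+1%:R <= r k `^ gamma.
  have -> : r k `^ gamma = expR (gamma * ln (r k)).
    by rewrite -ln_powR lnK// posrE powR_gt0.
  rewrite /r lnM ?posrE ?invr_gt0 ?exprn_gt0// lnV ?posrE// lnXn//.
  rewrite ler_pdivrMr// -[X in _ <= _ * X](@lnK _ k.+1%:R) ?posrE// -expRD ler_expR.
  have l0 : 0 <= ln k.+1%:R :> R by rewrite ln_ge0// ler1n.
  rewrite /x /th -[ln 2 *+ k]mulr_natl; set l := ln k.+1%:R in l0 *; have -> : k.+1%:R = k%:R + 1 :> R by rewrite natr1.
  have : 0 <= (1 - gamma) * l by rewrite mulr_ge0// subr_ge0.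
  by move: (ln 2) (k%:R) => u v; lra.
have rg0 : 0 < r k `^ gamma by rewrite powR_gt0.
have E0 := expR_gt0 (2 * x - 2 * th).
rewrite exprMn expr2 -mulrA level_sqr mulrCA.
apply: (@le_trans _ _ (2 ^+ k * (C2 / 2 * h))); last first.
  rewrite mulrCA -[leRHS]mulr1; have := ler_wpM2l C20 knh; lra.
rewrite ler_wpM2l ?exprn_ge0//.
apply: (@le_trans _ _ (C2 / 2 * expR (- x))); last first.
  by rewrite ler_wpM2l// divr_ge0.
rewrite ler_pdivrMr//.
apply: (@le_trans _ _ (C2 / 2 * expR (- x) * (expR (2 * x - 2 * th) / k.+1%:R))); last first.
  by rewrite ler_wpM2l// mulr_ge0 ?expR_ge0// divr_ge0.
rewrite mulrA ler_pdivlMr// -mulrA -expRD /C2.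
rewrite [leRHS](_ : _ = 4 / th ^+ 2 * (expR (2 * th) * expR (- x + (2 * x - 2 * th)))); last by field; rewrite gt_eqF.
rewrite -expRD (_ : 2 * th + _ = x); last by ring.
rewrite mulrAC ler_pdivlMr ?exprn_gt0// -ler_pdivrMl//.
apply: le_trans ex; rewrite le_eqVlt /x; apply/orP; left; apply/eqP; field.
Unshelve. all: by end_near. Qed.
Lemma level_ratio_ge k : k.+1%:R / 16 <= r k.
Proof.
rewrite /r ler_pdivlMr ?ltr0n// mulrAC ler_pdivrMr//.
have k0 : 0 <= k%:R :> R by [].
have e1 : 1 + k%:R / 4 <= expR (k%:R / 4) :> R by exact: expR_ge1Dx.
have e2 : expR (k%:R / 4) ^+ 2 <= 2 ^+ k :> R.
  rewrite -(@lnK _ (2 ^+ k)) ?posrE ?exprn_gt0// lnXn// expr2 -expRD ler_expR -[_ *+ k]mulr_natl.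
  by have := @ln2_ge_half R; move: (ln 2) => l; nra.
have -> : k.+1%:R = k%:R + 1 :> R by rewrite natr1.
move: e1 e2; move: (expR _) (2 ^+ k) => u v; nra.
Qed.

Lemma near_level_ge B : 0 <= B -> \forall n \near \oo, B <= level (block n).
Proof.
move=> B0; pose M := Num.trunc (16 * B `^ p).
near=> n; have Mn : (M <= block n)%N by near: n; exact: near_block.
rewrite -[leLHS](powRr1 B0) -(@divff _ p) ?gt_eqF// powRrM.
apply: ge0_ler_powR; rewrite ?nnegrE ?invr_ge0 ?powR_ge0 ?(ltW p0) ?(ltW (r_gt0 _))//.
apply: le_trans (level_ratio_ge _); rewrite ler_pdivlMr// mulrC.
by apply: le_trans (ltW (truncnS_gt _)) _; rewrite ler_nat ltnS.
Unshelve. all: by end_near. Qed.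

Lemma near_LL_le_window (c B : R) : 0 < c -> 0 <= B -> \forall n \near \oo, forall h,
  c * (ln n%:R / n%:R) `^ gamma <= h -> B * LL n h <= n%:R * h.
Proof.
move=> c0 B0.
have hl : \forall n \near \oo, forall h, c * (ln n%:R / n%:R) `^ gamma <= h ->
    c / 16 * (block n).+1%:R * level (block n) ^+ 2 <= n%:R * h.
  near=> n => h ch.
  have l1 : 1 <= ln n%:R :> R by near: n; exact: near_ln.
  have kh : c / 8 * (block n).+1%:R * level (block n) ^+ 2 <= 2 ^+ block n * h.
    by move: h ch; near: n; exact: near_level_le_bandwidth.
  have h0 : 0 <= h by apply: le_trans ch; rewrite mulr_ge0 ?powR_ge0// ltW.
  have := ler_wpM2r h0 (@block_le R n (ln_ge1_gt1 l1)); lra.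
have hL := @near_LL_le (fun n => c * (ln n%:R / n%:R) `^ gamma) _.
near=> n => h ch.
have l1 : 1 <= ln n%:R :> R by near: n; exact: near_ln.
have : c / 16 * (block n).+1%:R * level (block n) ^+ 2 <= n%:R * h.
  by move: h ch; near: n.
apply: le_trans.
have L1 : LL n h <= ln n%:R.
  move: h ch; near: n; apply: hL.
  near=> n; have n0 : 0 < n%:R :> R by near: n; exact: near_nat_gt0.
  have h1 : c / 16 * (block n).+1%:R * level (block n) ^+ 2 <= n%:R * (c * (ln n%:R / n%:R) `^ gamma).
    by near: n; apply: filterS hl => n; exact.
  rewrite -(ler_pM2l n0) divff ?gt_eqF//; apply: le_trans h1.
  have k1 : (Num.trunc (16 / c) <= block n)%N by near: n; exact: near_block.
  have k2 : 16 / c <= (block n).+1%:R.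
    by apply: le_trans (ltW (truncnS_gt _)) _; rewrite ler_nat ltnS.
  have t1 : 1 <= level (block n) ^+ 2 by rewrite exprn_ege1// level_ge1.
  rewrite ler_pdivrMr// in k2; nra.
have lk : ln n%:R <= (block n).+1%:R :> R.
  apply: (@le_trans _ _ (ln (2 ^+ block n))).
    by rewrite ler_ln ?posrE ?exprn_gt0 ?le_block//; near: n; exact: near_nat_gt0.
  rewrite lnXn// -[_ *+ _]mulr_natl -[X in _ <= X]natr1.
  by have := @ln2_le1 R; have : 0 <= (block n)%:R :> R by []; move: (ln 2) => l; nra.
have tB : 16 * (B + 1) / c + 1 <= level (block n).
  by near: n; apply: near_level_ge; rewrite addr_ge0// divr_ge0 ?(ltW c0)// mulr_ge0// addr_ge0.
have tB2 : 16 * B / c <= level (block n) ^+ 2.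
  have b0 : 0 <= 16 / c * 1 by rewrite mulr1 divr_ge0// ltW.
  have : 16 * (B + 1) / c = 16 * B / c + 16 / c * 1 by ring.
  have : 0 <= 16 * B / c by rewrite divr_ge0 ?mulr_ge0 ?(ltW c0).
  move: (16 * B / c) (16 / c * 1) (16 * (B + 1) / c) b0 tB => u v w; nra.
rewrite ler_pdivrMr// in tB2.
apply: (@le_trans _ _ (B * (block n).+1%:R)).
  by rewrite ler_wpM2l// (le_trans L1).
have : 0 <= (block n).+1%:R * (level (block n) ^+ 2 * c - 16 * B) by rewrite mulr_ge0// subr_ge0.
by lra.
Unshelve. all: by end_near. Qed.

End truncation_levels.

(** * The normalized deviation is eventually bounded *)

Lemma ratio_deviation (R : realType) (N L S s E F C1 C2 B a : R) :
  0 < N -> 0 < a -> 0 <= L -> 0 <= C1 -> 0 <= C2 -> 0 <= B ->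
  `|S - E| <= C1 * Num.sqrt (N * L) -> `|s - F| <= C2 * Num.sqrt (N * L) ->
  16 * C2 ^+ 2 * L <= a ^+ 2 * N -> N * (a / 2) <= F -> `|E| <= N * B ->
  `|S / s - E / F| <= (4 * C1 / a + 8 * B * C2 / a ^+ 2) * (Num.sqrt (N * L) / N).
Proof.
move=> N0 a0 L0 C10 C20 B0; set q := Num.sqrt _ => hS hs hL hF hE.
have q0 : 0 <= q by exact: sqrtr_ge0.
have q2 : q ^+ 2 = N * L by rewrite sqr_sqrtr// mulr_ge0// ltW.
have Na : 0 < N * a by rewrite mulr_gt0.
have Cq : C2 * q <= N * a / 4.
  rewrite -(@ler_pXn2r _ 2)// ?nnegrE ?(mulr_ge0 C20 q0) ?(divr_ge0 (ltW Na))//.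
  rewrite exprMn q2; have := ler_wpM2l (ltW N0) hL; lra.
have s0 : N * a / 4 <= s by move: hs; rewrite ler_distl => /andP[h _]; lra.
have s1 : 0 < s by apply: lt_le_trans s0; rewrite divr_gt0.
have F1 : 0 < F by apply: lt_le_trans hF; rewrite mulr_gt0// divr_gt0.
have -> : S / s - E / F = (S - E) / s + E * (F - s) / (s * F).
  by field; rewrite !gt_eqF.
apply: le_trans (ler_normD _ _) _; rewrite [leRHS]mulrDl; apply: lerD.
  rewrite normrM normfV (gtr0_norm s1) ler_pdivrMr//.
  apply: le_trans hS _.
  apply: (@le_trans _ _ (4 * C1 / a * (q / N) * (N * a / 4))).
    by rewrite le_eqVlt; apply/orP; left; apply/eqP; field; rewrite !gt_eqF.
  by rewrite ler_wpM2l// !mulr_ge0 ?invr_ge0// ltW.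
rewrite normrM normfV (gtr0_norm (mulr_gt0 s1 F1)) ler_pdivrMr ?mulr_gt0// normrM distrC.
apply: (@le_trans _ _ ((N * B) * (C2 * q))); first by apply: ler_pM.
apply: (@le_trans _ _ (8 * B * C2 / a ^+ 2 * (q / N) * ((N * a / 4) * (N * (a / 2))))).
  by rewrite le_eqVlt; apply/orP; left; apply/eqP; field; rewrite !gt_eqF.
apply: ler_wpM2l; first by rewrite !mulr_ge0 ?invr_ge0 ?exprn_ge0 ?(ltW a0) ?(ltW N0)//.
by apply: ler_pM; rewrite // ?divr_ge0 ?mulr_ge0 ?divr_ge0 ?(ltW a0) ?(ltW N0).
Qed.

Section residuals.
Context {R : realType} {d : nat}.
Variables (nu : probability (R * 'rV[R]_d)%type R)
  (mu : probability (path_space (R * 'rV[R]_d)%type) R).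
Hypothesis iid_mu : iid_law nu mu.
Variables (J0 : set 'rV[R]_d) (mJ0 : measurable J0).

Lemma ae_path (Q : R * 'rV[R]_d -> Prop) : {ae nu, forall t, Q t} ->
  {ae mu, forall z : path_space (R * 'rV[R]_d)%type, forall i, Q (z i)}.
Proof.
move=> [N [mN N0 QN]]; apply/ae_foralln => i.
exists ((fun z : path_space (R * 'rV[R]_d)%type => z i) @^-1` N); split.
- by rewrite -[X in measurable X]setTI; exact: measurable_eval.
- by apply: etrans N0; exact: iid_law_eval.
- by move=> z /= Qz; exact: QN.
Qed.

Lemma excess_eq0 M t : `|t.1| * \1_J0 t.2 <= M -> excess J0 M t = 0.
Proof.
rewrite /excess indicE; case: ifPn => // /andP[tM ->]; rewrite mulr1 => /(lt_le_trans tM).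
by rewrite ltxx.
Qed.

Lemma expected_excess_eq0 M : {ae nu, forall t, `|t.1| * \1_J0 t.2 <= M} ->
  \int[nu]_t excess J0 M t = 0.
Proof.
move=> h; rewrite /Rintegral.
suff -> : (\int[nu]_t (excess J0 M t)%:E = 0)%E by [].
rewrite -(integral0 nu setT); apply: ae_eq_integral => //.
  by apply/measurable_EFinP; exact: measurable_excess.
by apply: filterS h => t /excess_eq0 ->.
Qed.

Lemma excess_le_moment p M t : 1 <= p -> 0 < M ->
  excess J0 M t <= M / M `^ p * (`|t.1| `^ p * \1_J0 t.2).
Proof.
move=> p1 M0; rewrite /excess indicE; case: ifPn => [/andP[tM ->]|_]; last first.
  by rewrite !mulr_ge0 ?invr_ge0 ?powR_ge0// ltW.
rewrite mulr1; have y0 := lt_trans M0 tM.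
have -> : M / M `^ p = (M `^ (p - 1))^-1.
  rewrite -[X in X / _](powRr1 (ltW M0)) -powRN -powRB ?(gt_eqF M0) ?implybT//; congr (_ `^ _); ring.
rewrite -(mulr_powRB1 (ltW y0))//; last lra.
rewrite mulrCA ler_peMr// mulrC ler_pdivlMr ?powR_gt0// mul1r.
by apply: ge0_ler_powR; rewrite ?nnegrE ?(ltW M0) ?(ltW y0) ?(ltW tM)//; lra.
Qed.

Variables (alpha p : R).
Hypotheses (alpha0 : 0 <= alpha) (p2 : 2 < p)
  (mom : forall B, measurable B -> B `<=` J0 ->
    (\int[nu]_(t in snd @^-1` B) (`|t.1| `^ p)%:E <= alpha%:E * nu (snd @^-1` B))%E).

Let V (t : R * 'rV[R]_d) : R := `|t.1| `^ p * \1_J0 t.2.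

Let mV : measurable_fun setT V.
Proof.
apply: measurable_funM; first exact: measurable_moment.
apply: (measurableT_comp (f := \1_J0 : 'rV[R]_d -> R)); last exact: measurable_snd.
exact: measurable_indic.
Qed.

Let V0 t : 0 <= V t. Proof. by rewrite mulr_ge0// powR_ge0. Qed.

Let integral_V : (\int[nu]_t (V t)%:E <= alpha%:E)%E.
Proof.
rewrite (_ : integral _ _ _ = \int[nu]_(t in snd @^-1` J0) (`|t.1| `^ p)%:E)%E; last first.
  rewrite [RHS]integral_mkcond; apply: eq_integral => t _; rewrite patchE /V indicE.
  rewrite (_ : (t \in snd @^-1` J0) = (t.2 \in J0)); last by apply/idP/idP => /set_mem h; apply/mem_set.
  by case: ifP => _; rewrite ?mulr1 ?mulr0.
apply: le_trans (mom mJ0 (@subset_refl _ _)) _.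
rewrite -[leRHS]mule1; apply: lee_wpmul2l; first by rewrite lee_fin.
by apply: probability_le1; exact: measurable_fiber.
Qed.

Let iV : nu.-integrable setT (EFin \o V).
Proof.
apply/integrableP; split; first exact/measurable_EFinP.
under eq_integral => t _ do rewrite /= ger0_norm//.
by apply: le_lt_trans integral_V _; rewrite ltry.
Qed.

Hypothesis iY : nu.-integrable setT (fun t => (t.1)%:E).

(** Markov's inequality at the level [tau], for the sample by the dyadic bound
    on averages of [|Y| ^ p], turns both the excess of the sample and its mean
    into multiples of [2 ^ k tau ^ (1 - p) = (k + 1) tau]. *)
Lemma power_residual c : 0 < c -> exists2 C : R, 0 <= C &
  {ae mu, forall z : path_space (R * 'rV[R]_d)%type, \forall n \near \oo, forall h,
    c * (ln n%:R / n%:R) `^ (1 - 2 / p) <= h ->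
    \sum_(i < n) excess J0 (level p (block n)) (z i) +
      n%:R * \int[nu]_t excess J0 (level p (block n)) t <=
    C * Num.sqrt (n%:R * h * LL n h)}.
Proof.
move=> c0; have [A A0 hA] := dyadic_average_bounded iid_mu mV V0 iV.
have [B B0 hB] := near_level_le p2 c0.
exists ((A + alpha) * B); first by rewrite mulr_ge0// addr_ge0.
apply: filterS hA => z [k0 hk]; near=> n => h ch.
have kn : (k0 <= block n)%N by near: n; exact: near_block.
have lB : (block n).+1%:R * level p (block n) <= B * Num.sqrt (n%:R * h * LL n h).
  by move: h ch; near: n.
rewrite -mulrA; apply: le_trans (ler_wpM2l (addr_ge0 A0 alpha0) lB).
set k := block n in kn *; set t := level p k.
have t0 : 0 < t by apply: lt_le_trans (level_ge1 p2 k).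
have tp : 0 < t `^ p by rewrite powR_gt0.
have e1 : t / t `^ p * 2 ^+ k = k.+1%:R * t.
  by rewrite -(levelXp p2 k) -/t mulrA divfK ?gt_eqF// mulrC.
have p1 : 1 <= p by apply: ltW; apply: lt_trans p2; rewrite ltr1n.
have tt0 : 0 <= t / t `^ p by rewrite divr_ge0// ltW.
rewrite mulrDl; apply: lerD.
  apply: (@le_trans _ _ (t / t `^ p * \sum_(i < n) V (z i))).
    by rewrite mulr_sumr ler_sum// => i _; exact: excess_le_moment.
  rewrite -e1 [leRHS]mulrCA ler_wpM2l//; apply: le_trans (hk k kn).
  rewrite -(big_mkord predT (fun i => V (z i))) -(big_mkord predT (fun i => V (z i))).
  by rewrite [leRHS](big_cat_nat (n := n))//= ?lerDl ?sumr_ge0//; exact: up_logP.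
apply: (@le_trans _ _ (2 ^+ k * (t / t `^ p * alpha))); last first.
  by rewrite -e1 le_eqVlt; apply/orP; left; apply/eqP; ring.
apply: ler_pM => //; first by apply: Rintegral_ge0 => u _; exact: excess_ge0.
  exact: le_block.
apply: (@le_trans _ _ (\int[nu]_u (t / t `^ p * V u))).
  apply: le_Rintegral => //; first exact: integrable_excess.
    by have := integrableZl measurableT (t / t `^ p) iV; apply: eq_integrable.
  by move=> u _; exact: excess_le_moment.
rewrite RintegralZl// ler_wpM2l// /Rintegral -lee_fin fineK//.
exact: integrable_fin_num iV.
Unshelve. all: by end_near. Qed.

End residuals.

Section deviation.
Context {R : realType} {d : nat}.
Hypothesis d0 : (0 < d)%N.
Variables (nu : probability (R * 'rV[R]_d)%type R)
  (mu : probability (path_space (R * 'rV[R]_d)%type) R).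
Hypothesis iid_mu : iid_law nu mu.
Variable K : 'rV[R]_d -> R.
Hypotheses (mK : measurable_fun [set: 'rV[R]_d] K) (hK1 : kernel_cond_i K)
  (hK2 : kernel_cond_ii K) (hK3 : kernel_cond_iii K) (hK4 : kernel_cond_iv K)
  (sK : kernel_support K).
Local Notation kappa := (kernel_bound K).
Hypothesis kappa0 : 0 < kappa.
Variable f : 'rV[R]_d -> R.
Hypotheses (mf : measurable_fun setT f) (f0 : forall x, 0 <= f x)
  (nuf : forall B, measurable B ->
    nu (snd @^-1` B) = (\int[lebesgue_rV d]_(x in B) (f x)%:E)%E)
  (iY : nu.-integrable setT (fun t => (t.1)%:E)).

Lemma marginal_law : exists2 rho : probability 'rV[R]_d R,
  (forall B, measurable B -> nu (snd @^-1` B) = rho B) &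
  (forall B, measurable B -> rho B = \int[lebesgue_rV d]_(x in B) (f x)%:E)%E.
Proof.
pose X : {RV nu >-> 'rV[R]_d} := mfun_Sub (mem_set (@measurable_snd _ _ R 'rV[R]_d)).
exists (distribution nu X) => B mB; first by [].
by rewrite -nuf.
Qed.

Variables (I J0 : set 'rV[R]_d) (a F rho0 D : R).
Hypotheses (mJ0 : measurable J0) (a0 : 0 < a) (F0 : 0 < F) (rho00 : 0 < rho0)
  (fF : forall y, J0 y -> f y <= F) (fa : forall x, I x -> a <= f x <= F)
  (IJ0 : forall x, I x -> cube x rho0 `<=` J0)
  (D0 : 0 <= D) (ID : forall x, I x -> forall i, `|x ord0 i| <= D)
  (fu : forall w, 0 < w -> exists2 r, 0 < r & forall x y, I x -> cube x r y ->
      `|f y - f x| <= w).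

Lemma root_d_le (r h : R) : 0 < r -> 0 < h <= r ^+ d -> root_d d h <= r.
Proof.
move=> r0 /andP[h0 hr].
by rewrite -(ler_pXn2r d0) ?nnegrE ?(ltW r0) ?(ltW (root_d_gt0 h0))// root_dK// ltW.
Qed.

Lemma bdd_measurable_kernel x h : bdd_measurable (scaled_kernel K x h).
Proof.
by split; [exact: measurable_scaled_kernel|exists kappa => y; exact: (kernel_le_bound hK2)].
Qed.

Lemma kernel_mean_ge : exists2 h1, 0 < h1 & forall x h, I x -> 0 < h <= h1 ->
  h * (a / 2) <= \int[nu]_t scaled_kernel K x h t.2.
Proof.
have [rho nurho rhof] := marginal_law.
pose w := a / (2 * (1 + 2 * kappa)).
have k1 : 0 < 1 + 2 * kappa by rewrite addr_gt0// mulr_gt0.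
have w0 : 0 < w by rewrite divr_gt0// mulr_gt0.
have wa : w * (1 + 2 * kappa) = a / 2 by rewrite /w; field; rewrite gt_eqF.
have kw : 0 < w * kappa by rewrite mulr_gt0.
have [r r0 hr] := fu w0.
exists (r ^+ d); first by rewrite exprn_gt0.
move=> x h Ix hh; have /andP[h0 _] := hh.
have rr := root_d_le r0 hh.
rewrite -(expect_pushforward measurable_snd nurho (bdd_measurable_kernel x h)).
have /andP[afx _] := fa Ix.
apply: le_trans (expect_scaled_kernel_ge d0 mK hK1 hK2 sK (a := f x) (w := w) rhof mf h0 _ _).
- by rewrite ler_wpM2l ?(ltW h0)//; lra.
- by apply/andP; split; lra.
- move=> y xy; rewrite -ler_distl; apply: hr Ix _ => i; apply: le_trans (xy i) _.
  by apply: le_trans rr; rewrite ler_pdivrMr// ler_peMr ?ler1n// ltW// root_d_gt0.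
Qed.

Variables (alpha p : R).
Hypotheses (alpha0 : 0 <= alpha) (p2 : 2 <= p)
  (mom : forall B, measurable B -> B `<=` J0 ->
    (\int[nu]_(t in snd @^-1` B) (`|t.1| `^ p)%:E <= alpha%:E * nu (snd @^-1` B))%E).
Local Notation S0 := ((1 + alpha) * (F * 2 ^+ d)).

Let S00 : 0 < S0.
Proof. by apply: mulr_gt0; [exact: ltr_pwDl|rewrite mulr_gt0 ?exprn_gt0]. Qed.

Lemma window_cube x h t : 0 < h <= rho0 ^+ d ->
  scaled_kernel K x h t != 0 -> cube x rho0 t /\ cube x (root_d d h / 2) t.
Proof.
move=> hh g0; have /andP[h0 _] := hh; have gx := scaled_kernel_support sK h0 g0.
split => // i; apply: le_trans (gx i) _; apply: le_trans (root_d_le rho00 hh).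
by rewrite ler_pdivrMr// ler_peMr ?ler1n// ltW// root_d_gt0.
Qed.

Lemma response_mean_le x h : I x -> 0 < h <= rho0 ^+ d ->
  `|\int[nu]_t (t.1 * scaled_kernel K x h t.2)| <= h * (kappa * S0).
Proof.
move=> Ix hh; have /andP[h0 _] := hh.
pose Psi (t : R * 'rV[R]_d) := `|t.1| * \1_J0 t.2.
pose C := cube x (root_d d h / 2).
have r0 : 0 < root_d d h by exact: root_d_gt0.
have mPsi : measurable_fun setT Psi.
  apply: measurable_funM; first by apply: measurableT_comp => //; exact: measurable_fst.
  apply: (measurableT_comp (f := \1_J0 : 'rV[R]_d -> R)); last exact: measurable_snd.
  exact: measurable_indic.
have PsiC : \int[nu]_t (Psi t * \1_C t.2) <= S0 * (root_d d h / 2) ^+ d.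
  apply: (local_moment_expect_le mf f0 nuf mJ0 fF F0 alpha0 mom) => //; first by rewrite divr_gt0.
  by move=> t; rewrite /Psi mulr_ge0//= ler_wpM2r//; exact: norm_le_powR.
have ig := integrable_response mK hK2 kappa0 iY x h.
have iPC : nu.-integrable setT (fun t => (Psi t * \1_C t.2)%:E).
  apply: le_integrable iY => //.
    apply/measurable_EFinP; apply: measurable_funM => //.
    apply: (measurableT_comp (f := \1_C : 'rV[R]_d -> R)); last exact: measurable_snd.
    by apply: measurable_indic; exact: measurable_cube.
  move=> t _; rewrite !abse_EFin lee_fin /Psi !normrM normr_id !indicE.
  by case: (_ \in _); case: (_ \in _); rewrite ?normr1 ?normr0 ?mulr1 ?mulr0.
apply: le_trans (le_normr_Rintegral measurableT ig) _.
apply: (@le_trans _ _ (\int[nu]_t (kappa * (Psi t * \1_C t.2)))).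
  apply: le_Rintegral => //.
  - by have := integrable_norm ig; apply: eq_integrable.
  - by have := integrableZl measurableT kappa iPC; apply: eq_integrable.
  move=> t _; have [->|/(window_cube hh)[xt Ct]] := eqVneq (scaled_kernel K x h t.2) 0.
    by rewrite mulr0 normr0 !mulr_ge0// ltW.
  rewrite normrM mulrC /Psi !indicE (mem_set Ct) (mem_set (IJ0 Ix xt)) !mulr1.
  by rewrite ler_wpM2r//; exact: (kernel_le_bound hK2).
rewrite RintegralZl// mulrCA ler_wpM2l ?(ltW kappa0)//.
apply: le_trans PsiC _; rewrite mulrC ler_wpM2r ?(ltW S00)//.
rewrite -[leRHS](@root_dK R d d0 h) ?(ltW h0)// lerXn2r ?nnegrE ?divr_ge0 ?(ltW r0)//.
by rewrite ler_pdivrMr// ler_peMr ?ler1n// ltW.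
Qed.

Lemma denominator_deviation (an : nat -> R) (c1 : R) : 0 < c1 ->
  (\forall n \near \oo, forall h, an n <= h -> c1 * (block n)%:R <= 2 ^+ block n * h) ->
  exists2 C : R, 0 <= C & {ae mu, forall z : path_space (R * 'rV[R]_d)%type,
    \forall n \near \oo, forall (x : 'rV[R]_d) (h : R), I x -> 0 < h <= rho0 ^+ d ->
    an n <= h <= 2^-1 ->
    `|\sum_(i < n) scaled_kernel K x h (z i).2 -
        n%:R * \int[nu]_t scaled_kernel K x h t.2| <=
    C * Num.sqrt (n%:R * h * LL n h)}.
Proof.
move=> c10 ha; pose Psi (t : R * 'rV[R]_d) : R := \1_J0 t.2.
have mPsi : measurable_fun setT Psi.
  apply: (measurableT_comp (f := \1_J0 : 'rV[R]_d -> R)); last exact: measurable_snd.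
  exact: measurable_indic.
have Psi1 t : `|Psi t| <= 1 by rewrite /Psi indicE; case: (_ \in _); rewrite ?normr1 ?normr0.
have [||C C0 hC] := @uniform_in_bandwidth R d d0 nu mu iid_mu K mK hK2 hK3 hK4 sK kappa0
  (fun=> Psi) (fun=> 1) S0 D c1 1 an (fun=> mPsi) (fun=> Psi1) ltr01 (fun=> lexx _) D0 c10 S00.
- move=> _ c rho r0; apply: (local_moment_expect_le mf f0 nuf mJ0 fF F0 alpha0 mom) => //.
    exact: measurable_funX.
  move=> t; rewrite sqr_ge0/= /Psi indicE; case: (_ \in _); last by rewrite expr0n mulr0.
  by rewrite expr1n mulr1 lerDl powR_ge0.
- by apply: filterS ha => n h y /h; rewrite expr1n mulr1.
exists C => //; apply: filterS hC => z; apply: filterS => n h x y Ix hh ah.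
have := h x y (ID Ix) ah; congr (_ <= _); congr `|_|.
have e t : Psi t * scaled_kernel K x y t.2 = scaled_kernel K x y t.2.
  have [->|/(window_cube hh)[xt _]] := eqVneq (scaled_kernel K x y t.2) 0; first by rewrite mulr0.
  by rewrite /Psi indicE (mem_set (IJ0 Ix xt)) mul1r.
have -> : \int[nu]_t (Psi t * scaled_kernel K x y t.2) = \int[nu]_t scaled_kernel K x y t.2.
  by apply: eq_Rintegral => t _; exact: e.
rewrite sumrB sumr_const card_ord -[_ *+ n]mulr_natl; congr (_ - _).
by apply: eq_bigr => i _; exact: e.
Qed.

(** All the quantities of the ratio have order [n h]; the deviations of its
    two terms have order [sqrt (n h LL n h)]. *)
Lemma deviation_bounded (an bn : nat -> R) (C1 C2 : R) : 0 <= C1 -> 0 <= C2 ->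
  (\forall n \near \oo, 0 < an n) -> (bn n @[n --> \oo] --> (0 : R)) ->
  (\forall n \near \oo, forall h, an n <= h -> 16 * C2 ^+ 2 / a ^+ 2 * LL n h <= n%:R * h) ->
  {ae mu, forall z : path_space (R * 'rV[R]_d)%type, \forall n \near \oo, forall (x : 'rV[R]_d) (h : R),
    (forall i, `|x ord0 i| <= D) -> cube x rho0 `<=` J0 -> 0 < h ->
    root_d d h <= rho0 -> an n <= h <= 2^-1 ->
    `|\sum_(i < n) (z i).1 * scaled_kernel K x h (z i).2 -
        n%:R * \int[nu]_t (t.1 * scaled_kernel K x h t.2)| <=
    C1 * Num.sqrt (n%:R * h * LL n h)} ->
  {ae mu, forall z : path_space (R * 'rV[R]_d)%type, \forall n \near \oo, forall (x : 'rV[R]_d) (h : R),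
    I x -> 0 < h <= rho0 ^+ d -> an n <= h <= 2^-1 ->
    `|\sum_(i < n) scaled_kernel K x h (z i).2 - n%:R * \int[nu]_t scaled_kernel K x h t.2| <=
    C2 * Num.sqrt (n%:R * h * LL n h)} ->
  exists2 C : R, 0 <= C & {ae mu, forall z : path_space (R * 'rV[R]_d)%type,
    \forall n \near \oo, forall h x, an n <= h <= bn n -> I x ->
    Num.sqrt (n%:R * h) *
      `|(\sum_(i < n) (z i).1 * scaled_kernel K x h (z i).2) /
          (\sum_(i < n) scaled_kernel K x h (z i).2) -
        (\int[nu]_t (t.1 * scaled_kernel K x h t.2) / h) /
          (\int[nu]_t scaled_kernel K x h t.2 / h)| * (Num.sqrt (LL n h))^-1 <= C}.
Proof.
move=> C10 C20 ha hb hL h1 h2.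
have [hk hk0 hk1] := kernel_mean_ge.
have kS : 0 <= kappa * S0 by apply: mulr_ge0; exact: ltW.
have C0 : 0 <= 4 * C1 / a + 8 * (kappa * S0) * C2 / a ^+ 2.
  apply: addr_ge0; apply: divr_ge0; rewrite ?exprn_ge0 ?(ltW a0)//; first exact: mulr_ge0.
  by apply: mulr_ge0 => //; exact: mulr_ge0.
exists (4 * C1 / a + 8 * (kappa * S0) * C2 / a ^+ 2) => //.
apply: filterS2 h1 h2 => z h1 h2; near=> n => h x /andP[anh hbn] Ix.
have an0 : 0 < an n by near: n.
have h0 : 0 < h by apply: lt_le_trans anh.
have bm : bn n < Num.min hk (Num.min (rho0 ^+ d) 2^-1).
  near: n; apply: (cvgr_lt (0 : R) hb).
  by rewrite !lt_min hk0 exprn_gt0//= invr_gt0.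
move: bm; rewrite !lt_min => /and3P[b1 b2 b3].
have L1 : 1 <= LL n h by move: h {x Ix anh hbn h0}; near: n; exact: near_LL_ge1.
have n0 : 0 < n%:R :> R by near: n; exact: near_nat_gt0.
have hh : 0 < h <= rho0 ^+ d by rewrite h0 (le_trans hbn)// ltW.
have ah : an n <= h <= 2^-1 by rewrite anh (le_trans hbn)// ltW.
have N0 : 0 < n%:R * h by rewrite mulr_gt0.
have L0 : 0 < LL n h by apply: lt_le_trans L1.
have LN : 16 * C2 ^+ 2 / a ^+ 2 * LL n h <= n%:R * h.
  by move: h anh {x Ix hbn h0 L1 hh ah N0 L0}; near: n.
have hS : `|\sum_(i < n) (z i).1 * scaled_kernel K x h (z i).2 -
        n%:R * \int[nu]_t (t.1 * scaled_kernel K x h t.2)| <=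
    C1 * Num.sqrt (n%:R * h * LL n h).
  have rr := root_d_le rho00 hh; have xD := ID Ix; have xJ := IJ0 Ix.
  by move: x h xD xJ h0 rr ah {Ix anh hbn L1 hh N0 L0 LN}; near: n.
have hs : `|\sum_(i < n) scaled_kernel K x h (z i).2 - n%:R * \int[nu]_t scaled_kernel K x h t.2| <=
    C2 * Num.sqrt (n%:R * h * LL n h).
  by move: x h Ix hh ah {anh hbn L1 h0 N0 L0 LN hS}; near: n.
have hF : n%:R * h * (a / 2) <= n%:R * \int[nu]_t scaled_kernel K x h t.2.
  by rewrite -mulrA ler_wpM2l// hk1// h0 (le_trans hbn)// ltW.
have hE : `|n%:R * \int[nu]_t (t.1 * scaled_kernel K x h t.2)| <= n%:R * h * (kappa * S0).
  by rewrite normrM (gtr0_norm n0) -mulrA ler_wpM2l//; exact: response_mean_le.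
have hL2 : 16 * C2 ^+ 2 * LL n h <= a ^+ 2 * (n%:R * h).
  by rewrite -ler_pdivrMl ?exprn_gt0//; apply: le_trans LN; rewrite mulrC mulrAC.
have := ratio_deviation N0 a0 (ltW L0) C10 C20 kS hS hs hL2 hF hE.
set E := \int[nu]_t (t.1 * _); set G := \int[nu]_t scaled_kernel _ _ _ _.
have a2 : 0 < a / 2 by rewrite divr_gt0.
have G0 : 0 < G by have := lt_le_trans (mulr_gt0 N0 a2) hF; rewrite pmulr_rgt0.
have -> : n%:R * E / (n%:R * G) = E / h / (G / h) by field; rewrite !gt_eqF.
move=> hr; rewrite -[leRHS]mulr1 mulrAC.
set q1 := Num.sqrt (n%:R * h); set q2 := Num.sqrt (LL n h).
have q10 : 0 < q1 by rewrite sqrtr_gt0.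
have q20 : 0 < q2 by rewrite sqrtr_gt0.
apply: le_trans (ler_wpM2l _ hr) _; first by rewrite divr_ge0// ltW.
rewrite mulrCA ler_wpM2l// sqrtrM ?(ltW N0)// -/q1 -/q2.
have -> : n%:R * h = q1 ^+ 2 by rewrite sqr_sqrtr// ltW.
by rewrite le_eqVlt; apply/orP; left; apply/eqP; field; rewrite !gt_eqF.
Unshelve. all: by end_near. Qed.

End deviation.

Section two_regimes.
Context {R : realType} {d : nat}.
Hypothesis d0 : (0 < d)%N.
Variables (nu : probability (R * 'rV[R]_d)%type R)
  (mu : probability (path_space (R * 'rV[R]_d)%type) R).
Hypothesis iid_mu : iid_law nu mu.
Variable K : 'rV[R]_d -> R.
Hypotheses (mK : measurable_fun [set: 'rV[R]_d] K) (hK1 : kernel_cond_i K)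
  (hK2 : kernel_cond_ii K) (hK3 : kernel_cond_iii K) (hK4 : kernel_cond_iv K)
  (sK : kernel_support K).
Hypothesis kappa0 : 0 < kernel_bound K.
Variable f : 'rV[R]_d -> R.
Hypotheses (mf : measurable_fun setT f) (f0 : forall x, 0 <= f x)
  (nuf : forall B, measurable B ->
    nu (snd @^-1` B) = (\int[lebesgue_rV d]_(x in B) (f x)%:E)%E)
  (iY : nu.-integrable setT (fun t => (t.1)%:E)).
Variables (I : set 'rV[R]_d) (cptI : compact I) (eps : R) (eps0 : 0 < eps).
Local Notation J := (closed_nbhd I eps).
Hypotheses (fc : {within J, continuous f}) (fp : forall x, J x -> 0 < f x).

Definition path_deviation n (z : path_space (R * 'rV[R]_d)%type) h x : R :=
  Num.sqrt (n%:R * h) *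
      `|(\sum_(i < n) (z i).1 * scaled_kernel K x h (z i).2) /
          (\sum_(i < n) scaled_kernel K x h (z i).2) -
        (\int[nu]_t (t.1 * scaled_kernel K x h t.2) / h) /
          (\int[nu]_t scaled_kernel K x h t.2 / h)| * (Num.sqrt (LL n h))^-1.

Lemma bounded_moment M (B : set 'rV[R]_d) : 0 < M ->
  {ae nu, forall t, `|t.1| * \1_B t.2 <= M} -> measurable B ->
  (\int[nu]_(t in snd @^-1` B) (`|t.1| `^ 2)%:E <= (M `^ 2)%:E * nu (snd @^-1` B))%E.
Proof.
move=> M0 hM mB; rewrite -integral_cst; last exact: measurable_fiber.
apply: ae_ge0_le_integral => //.
- exact: measurable_fiber.
- by apply/measurable_EFinP; apply: measurable_funTS; exact: measurable_moment.
- by move=> t _; rewrite lee_fin powR_ge0.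
- apply: filterS hM => t tM Bt; rewrite lee_fin.
  apply: ge0_ler_powR; rewrite ?nnegrE ?(ltW M0)//.
  by apply: le_trans tM; rewrite indicE mem_set ?mulr1.
Qed.

Lemma bounded_deviation M : 0 < M ->
  (forall B, measurable B -> B `<=` J -> {ae nu, forall t, `|t.1| * \1_B t.2 <= M}) ->
  exists2 c0, 0 < c0 & forall c, c0 <= c -> forall b : nat -> R, b n @[n --> \oo] --> (0 : R) ->
  exists2 C : R, 0 <= C & {ae mu, forall z : path_space (R * 'rV[R]_d)%type,
    \forall n \near \oo, forall h x, c * (ln n%:R / n%:R) <= h <= b n -> I x ->
    path_deviation n z h x <= C}.
Proof.
move=> M0 hM.
have [J0 [a [F [rho0 [D [[mJ0 J0J a0 F0 rho00] [fF fa IJ0 [D0 ID] fu]]]]]]] :=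
  regularity_near cptI eps0 fc fp.
have mom B (mB : measurable B) (BJ : B `<=` J0) := bounded_moment M0 (hM B mB (subset_trans BJ J0J)) mB.
have hM0 := hM J0 mJ0 J0J.
pose an n : R := ln n%:R / n%:R.
have al0 : 0 <= M `^ 2 by exact: powR_ge0.
have M20 : 0 < M ^+ 2 by rewrite exprn_gt0.
have [|||||||C1 C10 hC1] := numerator_deviation (Cr := 0) (tau := fun=> M) (a := an) (t0 := M)
  (c1 := 8^-1 / M ^+ 2) (D := D)
  d0 iid_mu mK hK2 hK3 hK4 sK kappa0 mJ0 iY mf f0 nuf fF F0 al0 (lexx _) mom rho0 => //.
- by rewrite divr_gt0.
- apply: filterS near_block_le_bandwidth => n h y /h; apply: le_trans.
  by rewrite mulrAC divfK ?gt_eqF// ler_wpM2l// ler_nat.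
- apply: filterS (ae_path iid_mu hM0) => z hz; apply: nearW => n h _.
  rewrite expected_excess_eq0// mulr0 addr0 big1 ?mul0r// => i _.
  exact: excess_eq0.
have [||C2 C20 hC2] := denominator_deviation (an := an) (c1 := 8^-1)
  d0 iid_mu mK hK2 hK3 hK4 sK kappa0 mf f0 nuf mJ0 F0 rho00 fF IJ0 D0 ID al0 mom => //.
- apply: filterS near_block_le_bandwidth => n h y /h; apply: le_trans.
  by rewrite ler_wpM2l// ler_nat.
pose B := 16 * C2 ^+ 2 / a ^+ 2.
have B0 : 0 <= B by rewrite !mulr_ge0 ?exprn_ge0 ?invr_ge0// exprn_ge0// ltW.
exists (1 + B) => [|c cB b b0]; first by rewrite ltr_pwDl.
have c1 : 1 <= c by apply: le_trans cB; rewrite lerDl.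
have anc : \forall n \near \oo, forall h, c * (ln n%:R / n%:R) <= h -> an n <= h.
  near=> n => h; apply: le_trans; rewrite -[leLHS]mul1r ler_wpM2r//.
  rewrite divr_ge0// ltW//; have : 1 <= ln n%:R :> R by near: n; exact: near_ln.
  exact: lt_le_trans.
have hn : \forall n \near \oo, n%:R^-1 <= c * (ln n%:R / n%:R) :> R.
  near=> n; have l1 : 1 <= ln n%:R :> R by near: n; exact: near_ln.
  by rewrite mulrA ler_peMl ?invr_ge0// mulr_ege1.
apply: (deviation_bounded d0 mK hK1 hK2 sK kappa0 mf f0 nuf iY mJ0 a0 F0 rho00 fF fa IJ0 ID fu
  al0 (lexx _) mom C10 C20 (an := fun n => c * (ln n%:R / n%:R)) (mu := mu) _ b0).
- near=> n; have n0 : 0 < n%:R :> R by near: n; exact: near_nat_gt0.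
  have : n%:R^-1 <= c * (ln n%:R / n%:R) :> R by near: n.
  by apply: lt_le_trans; rewrite invr_gt0.
- have hL := near_LL_le hn.
  near=> n => h ch; have n0 : 0 < n%:R :> R by near: n; exact: near_nat_gt0.
  have l1 : 1 <= ln n%:R :> R by near: n; exact: near_ln.
  have Ll : LL n h <= ln n%:R by move: h ch; near: n.
  rewrite -/B [leRHS]mulrC -ler_pdivrMr//; move: ch => /(le_trans _); apply; rewrite mulrA ler_wpM2r ?invr_ge0//.
  have L1 : 1 <= LL n h by move: h {Ll}; near: n; exact: near_LL_ge1.
  apply: ler_pM => //; first exact: le_trans L1.
  by apply: le_trans cB; rewrite lerDr.
- apply: filterS hC1 => z hz; near=> n => x h xD xJ h0 hr /andP[ch h2].
  have anh : an n <= h by move: h ch {h0 hr h2}; near: n.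
  have : an n <= h <= 2^-1 by rewrite anh.
  by move: x h xD xJ h0 hr {ch h2 anh}; near: n.
- apply: filterS hC2 => z hz; near=> n => x h Ix hh /andP[ch h2].
  have anh : an n <= h by move: h ch {hh h2}; near: n.
  have : an n <= h <= 2^-1 by rewrite anh.
  by move: x h Ix hh {ch h2 anh}; near: n.
Unshelve. all: by end_near. Qed.

Lemma power_deviation p alpha : 2 < p -> 0 <= alpha ->
  (forall B, measurable B -> B `<=` J ->
    (\int[nu]_(t in snd @^-1` B) (`|t.1| `^ p)%:E <= alpha%:E * nu (snd @^-1` B))%E) ->
  forall c, 0 < c -> forall b : nat -> R, b n @[n --> \oo] --> (0 : R) ->
  exists2 C : R, 0 <= C & {ae mu, forall z : path_space (R * 'rV[R]_d)%type,
    \forall n \near \oo, forall h x, c * (ln n%:R / n%:R) `^ (1 - 2 / p) <= h <= b n -> I x ->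
    path_deviation n z h x <= C}.
Proof.
move=> p2 al0 hmom c c0 b b0.
have [J0 [a [F [rho0 [D [[mJ0 J0J a0 F0 rho00] [fF fa IJ0 [D0 ID] fu]]]]]]] :=
  regularity_near cptI eps0 fc fp.
have mom B (mB : measurable B) (BJ : B `<=` J0) := hmom B mB (subset_trans BJ J0J).
pose an n : R := c * (ln n%:R / n%:R) `^ (1 - 2 / p).
have c80 : 0 < c / 8 by rewrite divr_gt0.
have lev := near_level_le_bandwidth p2 c0.
have [Cr Cr0 hCr] := power_residual iid_mu mJ0 al0 p2 mom iY c0.
have [|||||||C1 C10 hC1] := numerator_deviation (Cr := Cr) (tau := level p) (a := an) (t0 := 1)
  (c1 := c / 8) (D := D)
  d0 iid_mu mK hK2 hK3 hK4 sK kappa0 mJ0 iY mf f0 nuf fF F0 al0 (ltW p2) mom rho0 => //.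
- exact: level_ge1.
- apply: filterS lev => n h y /h; apply: le_trans.
  by rewrite ler_wpM2r ?exprn_ge0 ?powR_ge0// ler_wpM2l ?(ltW c80)// ler_nat.
- by apply: filterS hCr => z; apply: filterS => n h y /andP[/h].
have [||C2 C20 hC2] := denominator_deviation (an := an) (c1 := c / 8)
  d0 iid_mu mK hK2 hK3 hK4 sK kappa0 mf f0 nuf mJ0 F0 rho00 fF IJ0 D0 ID al0 mom => //.
- apply: filterS lev => n h y /h; apply: le_trans.
  rewrite -[leLHS]mulr1; apply: ler_pM => //; first by rewrite mulr_ge0// ltW.
    by rewrite ler_wpM2l ?(ltW c80)// ler_nat.
  by rewrite exprn_ege1// level_ge1.
pose B := 16 * C2 ^+ 2 / a ^+ 2.
have B0 : 0 <= B by rewrite !mulr_ge0 ?exprn_ge0 ?invr_ge0// exprn_ge0// ltW.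
apply: (deviation_bounded d0 mK hK1 hK2 sK kappa0 mf f0 nuf iY mJ0 a0 F0 rho00 fF fa IJ0 ID fu
  al0 (ltW p2) mom C10 C20 (an := an) (mu := mu) _ b0) => //.
- near=> n; rewrite mulr_gt0// powR_gt0// divr_gt0//; last by near: n; exact: near_nat_gt0.
  have : 1 <= ln n%:R :> R by near: n; exact: near_ln.
  exact: lt_le_trans.
- exact: near_LL_le_window.
Unshelve. all: by end_near. Qed.

End two_regimes.

(** * Measurability and symmetry of the deviation *)

Section measurable_real_functions.
Context {R : realType}.

Lemma measurable_invr : measurable_fun setT (fun x : R => x^-1).
Proof.
rewrite (_ : (fun x : R => x^-1) = (fun x => x * (x ^+ 2) `^ (-1))).
  apply: measurable_funM => //; apply: (measurableT_comp (measurable_powR (-1))).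
  exact: measurable_funX.
apply/funext => x; rewrite powR_inv1 ?sqr_ge0//.
have [->|x0] := eqVneq x 0; first by rewrite mul0r invr0.
by field.
Qed.

Lemma measurable_sqrtr : measurable_fun setT (@Num.sqrt R).
Proof. exact: (continuous_measurable_fun (@sqrt_continuous R)). Qed.

(** No integrability is needed: the positive and the negative part are
    integrated separately. *)
Lemma measurable_Rintegral_param d1 d2 (T1 : measurableType d1) (T2 : measurableType d2)
    (P2 : probability T2 R) (f : T1 * T2 -> R) : measurable_fun setT f ->
  measurable_fun setT (fun x => \int[P2]_y f (x, y)).
Proof.
move=> mf; apply: (measurableT_comp (fine_measurable measurableT)).
under eq_fun do rewrite integralE.
have mE : measurable_fun setT (EFin \o f) by exact/measurable_EFinP.
have mpos := @measurable_fun_fubini_tonelli_F _ _ _ _ _ P2 _ (measurable_funepos mE) (fun=> funepos_ge0 _ _).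
have mneg := @measurable_fun_fubini_tonelli_F _ _ _ _ _ P2 _ (measurable_funeneg mE) (fun=> funeneg_ge0 _ _).
apply: emeasurable_funB.
- rewrite (_ : (fun x => _) = fubini_F P2 (EFin \o f)^\+%E)//.
  by apply/funext => x; apply: eq_integral => y _; rewrite !funeposE.
- rewrite (_ : (fun x => _) = fubini_F P2 (EFin \o f)^\-%E)//.
  by apply/funext => x; apply: eq_integral => y _; rewrite !funenegE.
Qed.

End measurable_real_functions.

Section path_deviation_measurable.
Context {R : realType} {d : nat}.
Variables (nu : probability (R * 'rV[R]_d)%type R)
  (mu : probability (path_space (R * 'rV[R]_d)%type) R).
Hypothesis iid_mu : iid_law nu mu.
Variable K : 'rV[R]_d -> R.
Hypotheses (mK : measurable_fun [set: 'rV[R]_d] K).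

Lemma measurable_scaled_kernel_joint d' (X : measurableType d') (u y : X -> 'rV[R]_d) (v : X -> R) :
  measurable_fun setT u -> measurable_fun setT v -> measurable_fun setT y ->
  measurable_fun setT (fun q => scaled_kernel K (u q) (v q) (y q)).
Proof.
move=> mu' mv my; apply: (measurableT_comp mK); apply: measurable_rVP => i.
under eq_fun do rewrite !mxE.
apply: measurable_funM.
  apply: (measurableT_comp measurable_invr).
  exact: (measurableT_comp (measurable_powR _)).
apply: measurable_funB.
- exact: (measurableT_comp (measurable_coord_rV i)).
- exact: (measurableT_comp (measurable_coord_rV i)).
Qed.

Local Notation X := (('rV[R]_d * R) * path_space (R * 'rV[R]_d)%type)%type.

Let mx : measurable_fun setT (fun q : X => q.1.1).
Proof. by apply: measurableT_comp; [exact: measurable_fst|exact: measurable_fst]. Qed.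

Let mh : measurable_fun setT (fun q : X => q.1.2).
Proof. by apply: measurableT_comp; [exact: measurable_snd|exact: measurable_fst]. Qed.

Let mz i : measurable_fun setT (fun q : X => q.2 i).
Proof. by apply: (measurableT_comp (measurable_eval i)); exact: measurable_snd. Qed.

Let mz1 i : measurable_fun setT (fun q : X => (q.2 i).1).
Proof. by apply: (measurableT_comp measurable_fst); exact: mz. Qed.

Let mz2 i : measurable_fun setT (fun q : X => (q.2 i).2).
Proof. by apply: (measurableT_comp measurable_snd); exact: mz. Qed.

Lemma measurable_path_deviation n :
  measurable_fun setT (fun q : X => path_deviation nu K n q.2 q.1.2 q.1.1).
Proof.
have mXt1 : measurable_fun setT (fun r : X * (R * 'rV[R]_d) => r.2.1).
  by apply: (measurableT_comp measurable_fst); exact: measurable_snd.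
have mk : measurable_fun setT (fun r : X * (R * 'rV[R]_d) => scaled_kernel K r.1.1.1 r.1.1.2 r.2.2).
  apply: measurable_scaled_kernel_joint.
  - by apply: (measurableT_comp mx); exact: measurable_fst.
  - by apply: (measurableT_comp mh); exact: measurable_fst.
  - by apply: (measurableT_comp measurable_snd); exact: measurable_snd.
have mr : measurable_fun setT (fun q : X => \int[nu]_t (t.1 * scaled_kernel K q.1.1 q.1.2 t.2)).
  exact: (measurable_Rintegral_param nu (measurable_funM mXt1 mk)).
have mf : measurable_fun setT (fun q : X => \int[nu]_t scaled_kernel K q.1.1 q.1.2 t.2).
  exact: (measurable_Rintegral_param nu mk).
have minv (g : X -> R) : measurable_fun setT g -> measurable_fun setT (fun q => (g q)^-1).
  by move=> mg; exact: (measurableT_comp measurable_invr).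
apply: measurable_funM; first apply: measurable_funM.
- apply: (measurableT_comp measurable_sqrtr).
  by apply: measurable_funM => //; exact: measurable_cst.
- apply: measurableT_comp => //; apply: measurable_funB; apply: measurable_funM.
  + apply: measurable_sum => i; apply: measurable_funM; first exact: mz1.
    by apply: measurable_scaled_kernel_joint; [exact: mx|exact: mh|exact: mz2].
  + by apply: (minv _); apply: measurable_sum => i; apply: measurable_scaled_kernel_joint; [exact: mx|exact: mh|exact: mz2].
  + by apply: measurable_funM => //; exact: minv.
  + by apply: (minv _); apply: measurable_funM => //; exact: minv.
- apply: (minv _); apply: (measurableT_comp measurable_sqrtr).
  apply: measurable_maxr; last exact: measurable_cst.
  by apply: (measurableT_comp (@measurable_ln R)); exact: minv.
Qed.

End path_deviation_measurable.

Lemma sum_reindex d (T : measurableType d) (V : nmodType) n s (z : path_space T) (phi : T -> V) :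
  cancel s s -> (forall i, (n <= i)%N -> s i = i) ->
  \sum_(i < n) phi (reindex s z i) = \sum_(i < n) phi (z i).
Proof.
move=> sK sn; have sl i : (i < n)%N -> (s i < n)%N.
  move=> ni; rewrite ltnNge; apply/negP => ns; have := sn _ ns; rewrite sK => e.
  by move: ns; rewrite -e leqNgt ni.
pose g (i : 'I_n) := Ordinal (sl i (ltn_ord i)).
have gi : injective g.
  by move=> i j /(congr1 val)/= e; apply: val_inj; rewrite /= -(sK i) e sK.
by rewrite [RHS](reindex_inj gi).
Qed.

(** * The limit superior *)

Section scaled_sup_norm.
Context {R : realType} {T : Type} (I : set T) (psi : T -> R) (c1 c2 : R).
Hypotheses (c10 : 0 <= c1) (c20 : 0 <= c2).

Lemma lt_scaled_sup_norm (t : R) : I !=set0 ->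
  (t%:E < c1%:E * sup_norm I psi * c2%:E)%E <-> exists2 x, I x & t < c1 * `|psi x| * c2.
Proof.
move=> I0; rewrite muleAC -EFinM.
have e x : c1 * `|psi x| * c2 = (c1 * c2) * `|psi x| by rewrite mulrAC.
have := mulr_ge0 c10 c20; rewrite le_eqVlt => /predU1P[c0|c0].
  rewrite -c0 mul0e lte_fin; split=> [t0|[x _]]; last by rewrite e -c0 mul0r.
  by have [x Ix] := I0; exists x => //; rewrite e -c0 mul0r.
rewrite -lte_pdivrMl// -EFinM; split.
  move=> /ereal_sup_gt[_ [x Ix <-]]; rewrite lte_fin ltr_pdivrMl// => h.
  by exists x => //; rewrite e.
move=> [x Ix]; rewrite e -ltr_pdivrMl// => h.
rewrite -lte_fin in h; apply: lt_le_trans h _.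
by apply: ereal_sup_ubound; exists x.
Qed.

Lemma scaled_sup_norm_le (C : R) : 0 <= C ->
  (forall x, I x -> c1 * `|psi x| * c2 <= C) ->
  (c1%:E * sup_norm I psi * c2%:E <= C%:E)%E.
Proof.
move=> C0 hC; have [I0|/nonemptyPn I0] := pselect (I !=set0).
  rewrite leNgt; apply/negP => /(lt_scaled_sup_norm _ I0)[x Ix].
  by rewrite ltNge hC.
rewrite /sup_norm I0 image_set0 ereal_sup0.
apply: (@le_trans _ _ (c1%:E * 0 * c2%:E)%E); last by rewrite mule0 mul0e lee_fin.
by rewrite lee_wpmul2r ?lee_fin// lee_wpmul2l ?lee_fin// leNye.
Qed.

End scaled_sup_norm.

Section limsup.
Context {R : realType} {d : nat}.
Variables (nu : probability (R * 'rV[R]_d)%type R)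
  (mu : probability (path_space (R * 'rV[R]_d)%type) R).
Hypothesis iid_mu : iid_law nu mu.
Variable K : 'rV[R]_d -> R.
Hypotheses (mK : measurable_fun [set: 'rV[R]_d] K).
Variables (I : set 'rV[R]_d) (cptI : compact I).

Definition path_sup n (a b : R) (z : path_space (R * 'rV[R]_d)%type) : \bar R :=
  ereal_sup [set
    ((Num.sqrt (n%:R * h))%:E *
     sup_norm I (fun x => ((\sum_(i < n) (z i).1 * scaled_kernel K x h (z i).2) /
          (\sum_(i < n) scaled_kernel K x h (z i).2) -
        (\int[nu]_t (t.1 * scaled_kernel K x h t.2) / h) /
          (\int[nu]_t scaled_kernel K x h t.2 / h))%R) *
     ((Num.sqrt (LL n h))^-1)%:E)%E
    | h in `[a, b]].

Lemma cmeasurable_path_sup n a b (t : R) : cmeasurable mu [set z | (t%:E < path_sup n a b z)%E].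
Proof.
have [I0|/nonemptyPn I0] := pselect (I !=set0); last first.
  apply: measurable_cmeasurable.
  have e z z' : path_sup n a b z = path_sup n a b z'.
    by congr ereal_sup; apply: eq_imagel => h _; rewrite /sup_norm I0 !image_set0.
  have [h|h] := pselect (t%:E < path_sup n a b (fun=> point))%E.
    rewrite (_ : mkset _ = setT)//; apply/seteqP; split=> z //= _.
    by rewrite (e _ (fun=> point)).
  rewrite (_ : mkset _ = set0)//; apply/seteqP; split=> z //= h'; apply: h.
  by rewrite (e _ z).
have cptC : compact (I `*` `[a, b]) by apply: compact_setX => //; exact: segment_compact.
have mB : measurable [set q : ('rV[R]_d * R) * path_space (R * 'rV[R]_d)%type |
    t < path_deviation nu K n q.2 q.1.2 q.1.1].
  rewrite -[X in measurable X]setTI (_ : mkset _ =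
    (fun q => path_deviation nu K n q.2 q.1.2 q.1.1) @^-1` `]t, +oo[); last first.
    by apply/seteqP; split=> q /=; rewrite in_itv/= andbT.
  exact: measurable_path_deviation.
have := measurable_projection mu cptC mB; congr (cmeasurable _ _).
apply/seteqP; split=> z /=.
  move=> [[x h] [/= Ix hab] tz].
  have : (t%:E < ((Num.sqrt (n%:R * h))%:E *
     sup_norm I (fun x => ((\sum_(i < n) (z i).1 * scaled_kernel K x h (z i).2) /
          (\sum_(i < n) scaled_kernel K x h (z i).2) -
        (\int[nu]_t (t.1 * scaled_kernel K x h t.2) / h) /
          (\int[nu]_t scaled_kernel K x h t.2 / h))%R) *
     ((Num.sqrt (LL n h))^-1)%:E))%E.
    by apply/lt_scaled_sup_norm; rewrite ?sqrtr_ge0 ?invr_ge0 ?sqrtr_ge0//; exists x.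
  by move=> th; apply: lt_le_trans th _; apply: ereal_sup_ubound; exists h.
move=> /ereal_sup_gt[_ [h hab <-]] /lt_scaled_sup_norm[]; rewrite ?sqrtr_ge0 ?invr_ge0 ?sqrtr_ge0//.
by move=> x Ix tx; exists (x, h).
Qed.

Lemma path_sup_reindex n a b s (z : path_space (R * 'rV[R]_d)%type) :
  cancel s s -> (forall i, (n <= i)%N -> s i = i) ->
  path_sup n a b (reindex s z) = path_sup n a b z.
Proof.
move=> sK sn; rewrite /path_sup; congr ereal_sup; apply: eq_imagel => h _.
congr (_ * sup_norm I _ * _)%E; apply/funext => x.
by rewrite (sum_reindex z (fun t => t.1 * scaled_kernel K x h t.2) sK sn)
  (sum_reindex z (fun t => scaled_kernel K x h t.2) sK sn).
Qed.

Lemma path_sup_le n a b z (C : R) : 0 <= C ->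
  (forall h x, a <= h <= b -> I x -> path_deviation nu K n z h x <= C) ->
  (path_sup n a b z <= C%:E)%E.
Proof.
move=> C0 hC; apply: ge_ereal_sup => _ [h hab <-].
apply: scaled_sup_norm_le; rewrite ?sqrtr_ge0 ?invr_ge0 ?sqrtr_ge0// => x Ix.
by apply: hC => //; move: hab; rewrite /= in_itv.
Qed.

Lemma limsup_path_sup (a b : nat -> R) (C : R) : 0 <= C ->
  {ae mu, forall z : path_space (R * 'rV[R]_d)%type,
    \forall n \near \oo, forall h x, a n <= h <= b n -> I x -> path_deviation nu K n z h x <= C} ->
  exists2 L : \bar R, (L < +oo)%E &
    {ae mu, forall z : path_space (R * 'rV[R]_d)%type, limn_esup (fun n => path_sup n (a n) (b n) z) = L}.
Proof.
move=> C0 hC.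
have [n t|s sK [N sN]|L hL] := exchangeable_limn_esup_cst iid_mu (D := fun n => path_sup n (a n) (b n)).
- exact: cmeasurable_path_sup.
- by exists N => n Nn z; apply: path_sup_reindex => // i ni; apply: sN; exact: leq_trans ni.
exists L => //.
have muT : (0 < mu setT)%E by rewrite [X in (_ < X)%E](probability_setT mu) lte01.
have [z [hz [n0 _ hn0]]] := @filter_ex _ _ (ae_properfilter_algebraOfSetsType muT) _ (filterI hL hC).
rewrite -hz; apply: (@le_lt_trans _ _ C%:E); last by rewrite ltry.
by apply: (@limn_esup_le _ _ _ n0) => n nn; apply: path_sup_le => //; exact: hn0.
Qed.

End limsup.

(** * From the sample to its path *)

Section transfer.
Context {R : realType} {d : nat} {disp : measure_display} {Omega : measurableType disp}
  (P : probability Omega R) (Z : nat -> {RV P >-> (R * 'rV[R]_d)%type}).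
Hypothesis hZ : iid Z.
Local Notation Y := (fun w : Omega => (Z 0%N w).1).
Local Notation X := (fun w : Omega => (Z 0%N w).2).

Definition sample_path (w : Omega) : path_space (R * 'rV[R]_d)%type := fun i => Z i.+1 w.

Lemma measurable_sample_path : measurable_fun setT sample_path.
Proof. by apply: measurable_pathP => i; exact: measurable_funPT. Qed.

Definition sample_path_RV : {RV P >-> path_space (R * 'rV[R]_d)%type} :=
  mfun_Sub (mem_set measurable_sample_path).

Local Notation nu := (distribution P (Z 0%N)).
Local Notation mu := (distribution P sample_path_RV).

Lemma iid_sample_path : iid_law nu mu.
Proof.
have [indep ident] := hZ => s A us mA.
have := indep (map S s) (fun j => A j.-1) (etrans (map_inj_uniq succn_inj _) us) (fun=> mA _).
rewrite big_map => h.
transitivity (P (\bigcap_(j in [set` map S s]) (Z j @^-1` A j.-1))).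
  congr (P _); apply/seteqP; split=> w /= Aw.
    by move=> j /= /mapP[i si ->]; exact: Aw.
  by move=> i si; apply: (Aw i.+1); rewrite /= map_f.
rewrite h; apply: eq_bigr => i _ /=.
exact: ident.
Qed.

Lemma ae_sample_path (Q : path_space (R * 'rV[R]_d)%type -> Prop) :
  {ae mu, forall z, Q z} -> {ae P, forall w, Q (sample_path w)}.
Proof.
move=> [N [mN N0 QN]]; exists (sample_path @^-1` N); split => //.
  by rewrite -[X in measurable X]setTI; exact: measurable_sample_path.
by move=> w /= nQ; exact: QN.
Qed.

Hypothesis hY : P.-integrable [set: Omega] (EFin \o Y).

Let mZ0 : measurable_fun setT (Z 0%N).
Proof. exact: measurable_funPT. Qed.

Lemma integrable_first : nu.-integrable setT (fun t => (t.1)%:E).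
Proof.
apply: (integrable_pushforward mZ0) => //.
by apply/measurable_EFinP; exact: measurable_fst.
Qed.

Lemma expectation_distribution (g : R * 'rV[R]_d -> R) : measurable_fun setT g ->
  fine 'E_P[fun w => g (Z 0%N w)] = \int[nu]_t g t.
Proof.
move=> mg; have mE : measurable_fun setT (EFin \o g) by exact/measurable_EFinP.
rewrite unlock /Rintegral; congr fine; rewrite [LHS]integralE [RHS]integralE.
congr (_ - _)%E; apply/esym.
  rewrite [LHS](ge0_integral_pushforward mZ0 P)//; last exact: measurable_funepos mE.
  by rewrite preimage_setT; apply: eq_integral => w _; rewrite /= !funeposE.
rewrite [LHS](ge0_integral_pushforward mZ0 P)//; last exact: measurable_funeneg mE.
by rewrite preimage_setT; apply: eq_integral => w _; rewrite /= !funenegE.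
Qed.

Variable K : 'rV[R]_d -> R.
Hypothesis mK : measurable_fun [set: 'rV[R]_d] K.

Lemma normalized_deviation_path I n a b w :
  normalized_deviation K P Z I n a b w = path_sup nu K I n a b (sample_path w).
Proof.
rewrite /normalized_deviation /path_sup; congr ereal_sup; apply: eq_imagel => h _.
congr (_ * sup_norm I _ * _)%E; apply/funext => x.
rewrite /nadaraya_watson !big_add1 !big_mkord /rbar /fbar.
have mk : measurable_fun setT (fun t : R * 'rV[R]_d => scaled_kernel K x h t.2).
  by apply: (measurableT_comp (f := scaled_kernel K x h)); [exact: measurable_scaled_kernel|exact: measurable_snd].
rewrite (@expectation_distribution (fun t => t.1 * scaled_kernel K x h t.2)); last first.
  by apply: measurable_funM => //; exact: measurable_fst.
by rewrite (@expectation_distribution (fun t => scaled_kernel K x h t.2)).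
Qed.

Lemma ae_distribution_bounded M (J B : set 'rV[R]_d) :
  {ae P, forall w, `|Y w| * \1_J (X w) <= M} -> measurable B -> B `<=` J ->
  {ae nu, forall t, `|t.1| * \1_B t.2 <= M}.
Proof.
move=> hM mB BJ; pose N := [set t : R * 'rV[R]_d | M < `|t.1| * \1_B t.2].
have mN : measurable N.
  rewrite -[X in measurable X]setTI (_ : N = (fun t => `|t.1| * \1_B t.2) @^-1` `]M, +oo[); last first.
    by apply/seteqP; split=> t /=; rewrite in_itv/= andbT.
  suff : measurable_fun setT (fun t : R * 'rV[R]_d => `|t.1| * \1_B t.2) by exact.
  apply: measurable_funM; first by apply: measurableT_comp => //; exact: measurable_fst.
  apply: (measurableT_comp (f := \1_B : 'rV[R]_d -> R)); last exact: measurable_snd.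
  exact: measurable_indic.
exists N; split => //; last by move=> t /= /negP; rewrite -ltNge.
have [A [mA A0 hA]] := hM.
apply: (subset_measure0 _ mA _ A0).
  by rewrite -[X in measurable X]setTI; exact: mZ0.
move=> w Mw; apply: hA => /=; apply/negP; rewrite -ltNge; apply: lt_le_trans Mw _.
rewrite ler_wpM2l//= !indicE.
by case: (boolP (_ \in B)) => // /set_mem/BJ/mem_set ->.
Qed.

Lemma distribution_moment p alpha (g : 'rV[R]_d -> \bar R) (J B : set 'rV[R]_d) :
  (forall z, (0 <= g z)%E) ->
  cond_expectation P (fun w => (`|Y w| `^ p)%:E) X g ->
  (forall z, J z -> (g z <= alpha%:E)%E) -> measurable B -> B `<=` J ->
  (\int[nu]_(t in snd @^-1` B) (`|t.1| `^ p)%:E <= alpha%:E * nu (snd @^-1` B))%E.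
Proof.
move=> g0 [mg hg] ga mB BJ.
have mX : measurable_fun setT X by apply: (measurableT_comp measurable_snd); exact: mZ0.
have mXB : measurable (X @^-1` B) by rewrite -[X in measurable X]setTI; exact: mX.
rewrite (_ : integral _ _ _ = \int[P]_(w in X @^-1` B) (`|Y w| `^ p)%:E)%E; last first.
  apply: (ge0_integral_pushforward mZ0 P) => //.
  - exact: measurable_fiber.
  - by apply/measurable_EFinP; apply: measurable_funTS; exact: measurable_moment.
rewrite -hg// -[leRHS](integral_cst P mXB); apply: ge0_le_integral => //.
- by apply: measurable_funTS; exact: (measurableT_comp mg).
- by move=> w BXw; apply: ga; exact: BJ.
Qed.

End transfer.

Lemma kernel_bound_gt0 (R : realType) (d : nat) (K : 'rV[R]_d -> R) :
  kernel_cond_i K -> kernel_cond_ii K -> 0 < kernel_bound K.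
Proof.
move=> hK1 hK2; have k0 : 0 <= kernel_bound K.
  by apply: le_trans (kernel_le_bound hK2 0).
rewrite lt_neqAle k0 andbT; apply/eqP => k00.
have := hK1; rewrite /kernel_cond_i (_ : (fun s => (K s)%:E) = cst 0%E); last first.
  apply/funext => s; congr _%:E; apply/eqP; rewrite -normr_le0 k00.
  exact: kernel_le_bound.
by rewrite integral0 => /eqP; rewrite eq_sym onee_eq0.
Qed.

Theorem theorem2 (R : realType) (d : nat) (hd : (0 < d)%N)
  (disp : measure_display) (Omega : measurableType disp)
  (P : probability Omega R)
  (Z : nat -> {RV P >-> (R * 'rV[R]_d)%type})
  (Y : Omega -> R := fun w => (Z 0%N w).1) (X : Omega -> 'rV[R]_d := fun w => (Z 0%N w).2)
  (hZ : iid Z)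
  (f : 'rV[R]_d -> R) (hf : has_lebesgue_density P X f)
  (hY : P.-integrable [set: Omega] (EFin \o Y))
  (m : 'rV[R]_d -> R) (hm : cond_expectation P (EFin \o Y) X (EFin \o m))
  (I : set 'rV[R]_d) (hI : compact I)
  (K : 'rV[R]_d -> R) (hK : measurable_fun [set: 'rV[R]_d] K)
  (hK1 : kernel_cond_i K) (hK2 : kernel_cond_ii K)
  (hK3 : kernel_cond_iii K) (hK4 : kernel_cond_iv K)
  (hKs : kernel_support K)
  (eps : R) (heps : 0 < eps) (J : set 'rV[R]_d := closed_nbhd I eps)
  (hfc : {within J, continuous f}) (hfp : forall x, J x -> 0 < f x) :
  ((exists2 M : R, 0 < M & {ae P, forall w, `|Y w| * \1_J (X w) <= M}) ->
   exists2 c0 : R, 0 < c0 & forall c : R, c0 <= c ->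
   forall b : nat -> R, nonincreasing_seq b -> b n @[n --> \oo] --> 0 ->
   exists2 L : \bar R, (L < +oo)%E &
     {ae P, forall w,
       limn_esup (fun n =>
         normalized_deviation K P Z I n (c * (ln n%:R / n%:R)) (b n) w) = L})
  /\
  (forall p : R, 2 < p ->
   (exists g : 'rV[R]_d -> \bar R, [/\ forall z, (0 <= g z)%E,
      cond_expectation P (fun w => (`|Y w| `^ p)%:E) X g &
      (ereal_sup (g @` J) < +oo)%E]) ->
   forall c : R, 0 < c ->
   forall b : nat -> R, nonincreasing_seq b -> b n @[n --> \oo] --> 0 ->
   exists2 L : \bar R, (L < +oo)%E &
     {ae P, forall w,
       limn_esup (fun n =>
         normalized_deviation K P Z I n
           (c * (ln n%:R / n%:R) `^ (1 - 2 / p)) (b n) w) = L}).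

Proof.
pose nu := distribution P (Z 0%N); pose mu := distribution P (sample_path_RV Z).
have iid_mu : iid_law nu mu := iid_sample_path hZ.
have kappa0 := kernel_bound_gt0 hK1 hK2.
have [mf f0 Pf] := hf.
have nuf B : measurable B -> nu (snd @^-1` B) = (\int[lebesgue_rV d]_(x in B) (f x)%:E)%E.
  by move=> mB; rewrite -Pf.
have iY : nu.-integrable setT (fun t => (t.1)%:E) := integrable_first hY.
have conclude (a b : nat -> R) C : 0 <= C ->
    {ae mu, forall z : path_space (R * 'rV[R]_d)%type, \forall n \near \oo,
      forall h x, a n <= h <= b n -> I x -> path_deviation nu K n z h x <= C} ->
    exists2 L : \bar R, (L < +oo)%E & {ae P, forall w,
      limn_esup (fun n => normalized_deviation K P Z I n (a n) (b n) w) = L}.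
  move=> C0 hC; have [L Loo hL] := limsup_path_sup iid_mu hK hI C0 hC.
  exists L => //; apply: filterS (ae_sample_path hL) => w <-; congr limn_esup.
  by apply/funext => n; exact: normalized_deviation_path.
split=> [[M M0 hM]|p p2 [g [g0 cg gJ]] c c0 b _ b0].
  have [|c0 c00 hc0] := bounded_deviation hd iid_mu hK hK1 hK2 hK3 hK4 hKs kappa0 mf f0 nuf iY
    hI heps hfc hfp M0.
    by move=> B; exact: ae_distribution_bounded.
  exists c0 => // c cc b _ b0; have [C C0 hC] := hc0 c cc b b0.
  exact: conclude hC.
pose al := maxe 0%E (ereal_sup (g @` J)).
have alfin : al \is a fin_num.
  by rewrite ge0_fin_numE ?le_max ?lexx// gt_max ltry.
have gal z : J z -> (g z <= (fine al)%:E)%E.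
  move=> Jz; rewrite fineK// le_max; apply/orP; right.
  by apply: ereal_sup_ubound; exists z.
have al0 : 0 <= fine al by rewrite fine_ge0// le_max lexx.
have [|C C0 hC] := power_deviation hd iid_mu hK hK1 hK2 hK3 hK4 hKs kappa0 mf f0 nuf iY
    hI heps hfc hfp p2 al0 _ c0 b0.
  by move=> B mB BJ; exact: (distribution_moment g0 cg gal mB BJ).
exact: conclude hC.
Qed.
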